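(* The spectrum of the selfadjoint extension $L_{W_2}$ (where $W_2$ is a unitary operator in $H$) of the minimal operator $L_0(0,1,0)$ in the Hilbert space $L^2(0,1,0)$ is $$\sigma(L_{W_2})=\left\{\lambda\in\mathbb{R}:\ \lambda=\frac{1}{b_2-a_2}\arg\mu+\frac{2n\pi}{b_2-a_2},\ n\in\mathbb{Z},\ \mu\in\sigma\!\left(W_2^*e^{i\tilde A_2(b_2-a_2)}\right),\ 0\le\arg\mu<2\pi\right\}.$$
   Context: Let $H$ be a separable Hilbert space with $\dim H>0$, let $-\infty<a_2<b_2<+\infty$, and let $A_2:D(A_2)\subset H\to H$ be a linear selfadjoint operator. $L^2(H,(a_2,b_2))$ denotes the Hilbert space of square-integrable $H$-valued functions on $(a_2,b_2)$, and $L^2(0,1,0)=0\oplus L^2(H,(a_2,b_2))\oplus0$. $H_{2,+}$ is $D(A_2)$ with inner product $(f,g)_{2,+}=(A_2f,A_2g)_H+(f,g)_H$; $H_{2,-}$ is the corresponding negative space, i.e. the completion of $H$ in the norm $\|f\|_{2,-}=\sup\{|(f,g)_H|/\|g\|_{2,+}:0\ne g\in H_{2,+}\}$. $\tilde A_2:H\to H_{2,-}$ is the adjoint of the continuous operator $A_2:H_{2,+}\to H$; it is a continuous extension of $A_2$, and it is selfadjoint as an operator in $H_{2,-}$ with domain $H$. On $H$ the operator $e^{i\tilde A_2t}$ coincides with the unitary operator $e^{iA_2t}$, and $W_2^*e^{i\tilde A_2(b_2-a_2)}$ is regarded as a unitary operator in $H$. Operators: the maximal operator $L_2$ acts by $L_2u=iu'+\tilde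 A_2u$ on the domain of all $u\in L^2(H,(a_2,b_2))$ for which $iu'+\tilde A_2u$ (derivative in the sense of $H_{2,-}$-valued distributions) belongs to $L^2(H,(a_2,b_2))$. Each such $u$ has a representative continuous from $[a_2,b_2]$ into $H$, so $u(a_2),u(b_2)\in H$. The minimal operator $L_{20}$ is the closure of the restriction of $L_2$ to finite sums $\sum_j\varphi_jh_j$ with $\varphi_j\in C_0^\infty(a_2,b_2)$, $h_j\in D(A_2)$. Put $L_0(0,1,0)=0\oplus L_{20}\oplus0$. For a unitary operator $W_2:H\to H$, $L_{W_2}$ is the selfadjoint extension of $L_0(0,1,0)$ in $L^2(0,1,0)$ obtained by restricting $0\oplus L_2\oplus0$ to those $u=(0,u_2,0)$ in its domain with $u_2(b_2)=W_2u_2(a_2)$. *)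

(* Defs.v *)
From HB Require Import structures.
From mathcomp Require Import all_boot all_order all_algebra.
From mathcomp Require Import complex.
From mathcomp Require Import all_classical all_reals all_analysis.
Set Implicit Arguments.
Unset Strict Implicit.
Unset Printing Implicit Defensive.
Import Order.TTheory GRing.Theory Num.Theory.
Import numFieldNormedType.Exports.
Local Open Scope classical_set_scope.
Local Open Scope ring_scope.
Local Open Scope complex_scope.

(* Complex Hilbert space; the inner product is linear in its first argument. *)
Record hilbert (R : realType) := Hilbert {
  hsort :> completeNormedModType R[i] ;
  dot : hsort -> hsort -> R[i] ;
  dot_linear : forall (c : R[i]) (x y z : hsort),
    dot (c *: x + y) z = c * dot x z + dot y z ;
  dot_conj : forall x y : hsort, dot y x = (dot x y)^* ;
  dot_norm : forall x : hsort, `|x| ^+ 2 = dot x x }.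

Definition separable (T : topologicalType) : Prop :=
  exists S : set T, countable S /\ dense S.

(* A Hilbert space presented before identification of vectors at distance 0:  *)
(* the vectors are those of [smem], and x, y denote the same vector when      *)
(* [same_vec x y]. This is how L2 spaces are presented here: by functions,    *)
(* equality being equality almost everywhere.                                 *)
Record semihilbert (R : realType) := SemiHilbert {
  scar :> lmodType R[i] ;
  smem : set scar ;
  sdot : scar -> scar -> R[i] }.

Definition snorm (R : realType) (X : semihilbert R) (x : X) : R :=
  Num.sqrt (complex.Re (sdot x x)).

Definition same_vec (R : realType) (X : semihilbert R) (x y : X) : Prop :=
  snorm (x - y) = 0.

Definition hspace (R : realType) (H : hilbert R) : semihilbert R :=
  SemiHilbert [set: H] (@dot R H).

Definition zero_space (R : realType) : semihilbert R :=
  @SemiHilbert R 'rV[R[i]]_0 setT (fun _ _ => 0).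

Definition dsum (R : realType) (X Y : semihilbert R) : semihilbert R :=
  @SemiHilbert R (X * Y)%type
    [set p | smem p.1 /\ smem p.2]
    (fun p q => sdot p.1 q.1 + sdot p.2 q.2).

(* Operators are given by their graphs, which are sets of pairs of vectors.   *)
Section Operators.
Context {R : realType}.

Definition graph_on (T U : Type) (D : set T) (f : T -> U) : set (T * U) :=
  [set p | D p.1 /\ p.2 = f p.1].

Definition graph_comp (T U V : Type) (G : set (U * V)) (K : set (T * U)) :
    set (T * V) :=
  [set p | exists y, K (p.1, y) /\ G (y, p.2)].

Variable X : semihilbert R.
Implicit Type G : set (X * X).

Definition linear_operator G : Prop :=
  [/\ forall p, G p -> smem p.1 /\ smem p.2,
      G (0, 0),
      forall (c : R[i]) p q, G p -> G q -> G (c *: p.1 + q.1, c *: p.2 + q.2) &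
      forall p, G p -> same_vec p.1 0 -> same_vec p.2 0].

Definition adjoint G : set (X * X) :=
  [set q | [/\ smem q.1, smem q.2 &
    forall p, G p -> sdot p.2 q.1 = sdot p.1 q.2]].

(* A vector h orthogonal to the domain of G gives (0, h) \in adjoint G = G,   *)
(* hence h = 0 as G is single-valued: the domain of G is dense.               *)
Definition selfadjoint G : Prop := linear_operator G /\ adjoint G = G.

Definition closure_op G : set (X * X) :=
  [set p | [/\ smem p.1, smem p.2 & forall e : R, 0 < e ->
    exists q, [/\ G q, snorm (p.1 - q.1) < e & snorm (p.2 - q.2) < e]]].

(* G - z is a bijection of its domain onto the space with a bounded inverse;  *)
(* the second condition contains injectivity.                                 *)
Definition resolvent_set G : set R[i] :=
  [set z |
    (forall f : X, smem f -> exists p, G p /\ same_vec (p.2 - z *: p.1) f) /\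
    (exists c : R, forall p, G p -> snorm p.1 <= c * snorm (p.2 - z *: p.1))].

Definition spectrum G : set R[i] := ~` resolvent_set G.

End Operators.

Definition zero_op (R : realType) : set (zero_space R * zero_space R) :=
  [set p | p.2 = 0].

Definition dsum_op (R : realType) (X Y : semihilbert R)
    (G : set (X * X)) (K : set (Y * Y)) : set (dsum X Y * dsum X Y) :=
  [set p | G (p.1.1, p.2.1) /\ K (p.1.2, p.2.2)].

Definition unitary (R : realType) (H : hilbert R) (W : H -> H) : Prop :=
  [/\ forall (c : R[i]) (x y : H), W (c *: x + y) = c *: W x + W y,
      forall x y : H, dot (W x) (W y) = dot x y &
      forall y : H, exists x : H, W x = y].

(* [E t] is e^{iGt}: E is the strongly continuous one-parameter unitary group *)
(* whose infinitesimal generator is iG.                                       *)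
Definition expi_group (R : realType) (H : hilbert R) (G : set (H * H))
    (E : R -> H -> H) : Prop :=
  [/\ forall t, unitary (E t),
      forall x, E 0 x = x,
      forall s t x, E (s + t) x = E s (E t x),
      forall x, E t x @[t --> (0 : R)] --> x &
      forall x y, G (x, y) <->
        ((t%:C)^-1 *: (E t x - x)) @[t --> (0 : R)^'] --> 'i%C *: y].

Section NegativeSpace.
Context {R : realType} (H : hilbert R) (D : set H) (A : H -> H).

Definition norm_plus (g : H) : R :=
  Num.sqrt (complex.Re (dot (A g) (A g) + dot g g)).

Definition norm_minus (f : H) : R :=
  sup [set r | exists g,
    [/\ D g, g <> 0 & r = complex.Re `|dot f g| / norm_plus g]].

Variables (Hm : hilbert R) (iota : {linear H -> Hm}).

(* Hm, with the embedding iota, is the completion of H in the negative norm.  *)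
Definition negative_space : Prop :=
  (forall f : H, `|iota f| = (norm_minus f)%:C) /\ dense (range iota).

(* [pairing al g c]: c is the value at (al, g) of the pairing of H_- with H_+ *)
(* extending (f, g)_H by continuity in f.                                     *)
Definition pairing (al : Hm) (g : H) (c : R[i]) : Prop :=
  exists f : nat -> H,
    iota (f n) @[n --> \oo] --> al /\
    ((dot (f n) g : R[i]^o) @[n --> \oo] --> (c : R[i]^o)).

(* At : H -> H_- is the adjoint of A : H_+ -> H.                              *)
Definition plus_adjoint (At : H -> Hm) : Prop :=
  forall f g : H, D g -> pairing (At f) g (dot f (A g)).

(* At as an operator in H_- with domain H.                                    *)
Definition tilde_op (At : H -> Hm) : set (Hm * Hm) :=
  [set p | exists f : H, p = (iota f, At f)].

(* The operator induced in H by an operator of H_-.                           *)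
Definition restrict_to_H (S : Hm -> Hm) : set (H * H) :=
  [set p | iota p.2 = S (iota p.1)].

End NegativeSpace.

Section VectorFunctions.
Context {R : realType} (a b : R).
Let mu := @lebesgue_measure R.

Definition cint (f : R -> R[i]) : R[i] :=
  (\int[mu]_(t in `]a, b[) complex.Re (f t))%R
  +i* (\int[mu]_(t in `]a, b[) complex.Im (f t))%R.

(* As H is separable, weak and strong measurability coincide (Pettis).        *)
Definition square_integrable (H : hilbert R) (u : R -> H) : Prop :=
  (forall h : H, measurable_fun `]a, b[ (fun t => complex.Re (dot (u t) h)) /\
                 measurable_fun `]a, b[ (fun t => complex.Im (dot (u t) h))) /\
  (\int[mu]_(t in `]a, b[) ((complex.Re `|u t|) ^+ 2)%:E < +oo)%E.

Definition L2space (H : hilbert R) : semihilbert R :=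
  @SemiHilbert R (R -> H) [set u | square_integrable u]
    (fun u v => cint (fun t => dot (u t) (v t))).

Definition test_function (phi : R -> R[i]) : Prop :=
  (forall n x, derivable (derive1n n (fun t => complex.Re (phi t))) x 1 /\
               derivable (derive1n n (fun t => complex.Im (phi t))) x 1) /\
  (exists c d : R, [/\ a < c, d < b &
    forall x, ~ (c <= x <= d) -> phi x = 0]).

Definition cderive (phi : R -> R[i]) (t : R) : R[i] :=
  derive1 (fun s => complex.Re (phi s)) t
    +i* derive1 (fun s => complex.Im (phi s)) t.

(* The integral of a vector-valued function, characterized by duality.        *)
Definition vint (H : hilbert R) (F : R -> H) : H :=
  xget 0 [set I : H | forall y, dot I y = cint (fun t => dot (F t) y)].

(* Vector-valued distributions as maps on test functions.                     *)
Definition dist_of (H : hilbert R) (F : R -> H) (phi : R -> R[i]) : H :=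
  vint (fun t => phi t *: F t).

Definition dist_derive (H : hilbert R) (T : (R -> R[i]) -> H)
    (phi : R -> R[i]) : H := - T (cderive phi).

End VectorFunctions.

Section Extensions.
Context {R : realType} (H Hm : hilbert R) (D : set H).
Variables (iota : {linear H -> Hm}) (At : H -> Hm) (a b : R).

(* L_2: pairs (u, f) with i u' + At u = f as H_- -valued distributions.       *)
Definition L2max : set (L2space a b H * L2space a b H) :=
  [set p | [/\ square_integrable a b p.1, square_integrable a b p.2 &
    forall phi, test_function a b phi ->
      'i%C *: dist_derive (dist_of a b (fun t => iota (p.1 t))) phi
        + dist_of a b (fun t => At (p.1 t)) phi
      = dist_of a b (fun t => iota (p.2 t)) phi]].

Definition test_sum (u : R -> H) : Prop :=
  exists (n : nat) (phi : 'I_n -> R -> R[i]) (h : 'I_n -> H),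
    (forall j, test_function a b (phi j) /\ D (h j)) /\
    u = (fun t => \sum_(j < n) phi j t *: h j).

Definition L2min : set (L2space a b H * L2space a b H) :=
  closure_op (L2max `&` [set p | test_sum p.1]).

Definition L2_010 : semihilbert R :=
  dsum (dsum (zero_space R) (L2space a b H)) (zero_space R).

Definition op_010 (G : set (L2space a b H * L2space a b H)) :
    set (L2_010 * L2_010) :=
  dsum_op (dsum_op (@zero_op R) G) (@zero_op R).

(* The boundary values of u are those of its representative v which is        *)
(* continuous on [a, b].                                                      *)
Definition boundary_condition (W : H -> H) (u : R -> H) : Prop :=
  exists v : R -> H,
    [/\ {within `[a, b], continuous v},
        {ae @lebesgue_measure R, forall t, t \in `]a, b[ -> u t = v t} &
        v b = W (v a)].

Definition LW (W : H -> H) : set (L2_010 * L2_010) :=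
  op_010 L2max `&` [set p | boundary_condition W p.1.1.2].

End Extensions.

Arguments L2max {R H Hm} iota At a b _.
Arguments L2min {R H Hm} D iota At a b _.
Arguments LW {R H Hm} iota At a b W _.

(* theta = arg mu, normalized by 0 <= arg mu < 2 pi.                          *)
Definition is_arg (R : realType) (mu : R[i]) (theta : R) : Prop :=
  [/\ mu != 0, 0 <= theta < 2 * pi &
      mu = `|mu| * (cos theta +i* sin theta)].

(* Main.v *)
Require Import Defs.
From HB Require Import structures.
From mathcomp Require Import all_boot all_order all_algebra.
From mathcomp Require Import complex ring lra.
From mathcomp Require Import all_classical all_reals all_analysis.
From mathcomp Require Import measurable_realfun ftc.
Import Order.TTheory GRing.Theory Num.Theory.
Import numFieldNormedType.Exports.
Local Open Scope classical_set_scope.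
Local Open Scope ring_scope.
Local Open Scope complex_scope.
Set Implicit Arguments.
Unset Strict Implicit.
Unset Printing Implicit Defensive.

(** Write l = b - a and V t = e^{iAt}, where a, b, A stand for a2, b2, A_2. The
    theorem holds because the boundary value problem i u' + A u - z u = f,
    u(b) = W u(a), can be solved explicitly. By Duhamel's formula

      u(t) = e^{-iz(t-a)} V(t-a) (u0 - i q(t)),
      q(t) = int_a^t e^{-iz(a-s)} V(a-s) f(s) ds,

    and with T = W^* V l the boundary condition reads
    (T - e^{izl}) u0 = i T q(b) ([sol_boundary]). Hence z is in the resolvent set of
    L_W exactly when e^{izl} is in that of T ([bvp_resolvent_set]): a bounded
    inverse of T - e^{izl} bounds u0, hence u, by f; and the forcing term
    f(s) = e^{-iz(s-a)} V(s-a) k / l, for which q(b) = k, turns the resolvent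
    equation for L_W into an arbitrary equation for T. Since T is unitary, only real
    z can be spectral ([unitary_regular]), and for real z the angle zl is determined
    modulo 2 pi by e^{izl}.

    Two points need work. The first is that every u in the domain of the maximal
    operator, defined by a distributional equation in H_-, is given by Duhamel's
    formula. The negative norm is |(A - i)^-1 f|, so h |-> A~ h - i h is an isometry of
    H onto H_- ([neg_iso]); it carries A to A~, thus e^{iAt} to e^{i A~ t}
    ([group_in_H]), and turns the equation into
    m' = i u - m - i (A - i)^-1 f for m = (A - i)^-1 u, in the weak sense in H. By the
    du Bois-Reymond lemma m is then a primitive of the right-hand side
    ([L2max_prim]), and integrating by parts against the C^1 orbits of the adjoint
    group gives Duhamel's formula for m, hence for u ([sol_unique]).

    The second is selfadjointness. The representation of u by q makes Green's
    formula an integration by parts, whose boundary term vanishes because W is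
    isometric ([bvp_graph_green]). Symmetry, together with the solvability for z = i
    and z = -i that comes from the resolvent criterion, gives selfadjointness
    ([bvp_adjoint_sub]). The minimal operator is contained in L_W as finite sums
    phi_j h_j vanish near a and b and the graph of L_W, being an adjoint, is closed.

    The domains of integration are the open intervals and vector integrals are weak,
    defined by the Riesz representation; separability of H makes norms measurable. *)


(** * Real norms and real inner products *)

Lemma cvg_ext (T : Type) (U : nbhsType) (F : set_system T) (f g : T -> U) (l : U) :
  f =1 g -> f @ F --> l -> g @ F --> l.
Proof. by move/funext->. Qed.

Section Norm.
Context {R : realType}.

(** Norms over R[i] take values in R[i], whose order is partial; their real part
    carries the same information and lives in a totally ordered field. *)
Definition nr (V : normedZmodType R[i]) (x : V) : R := complex.Re `|x|.

Section NormedZmod.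
Variable V : normedZmodType R[i].
Implicit Types x y z : V.

Lemma nrE x : `|x| = (nr x)%:C.
Proof. by rewrite /nr RRe_real ?normr_real. Qed.

Lemma nr_ge0 x : 0 <= nr x.
Proof. by rewrite -ler0c -nrE. Qed.

Lemma nr0 : nr (0 : V) = 0.
Proof. by rewrite /nr normr0. Qed.

Lemma nr_eq0 x : (nr x == 0) = (x == 0).
Proof. by rewrite -(normr_eq0 x) nrE; apply/eqP/eqP => [->|/complexI]. Qed.

Lemma nr_gt0 x : (0 < nr x) = (x != 0).
Proof. by rewrite lt_def nr_ge0 andbT nr_eq0. Qed.

Lemma nrN x : nr (- x) = nr x.
Proof. by rewrite /nr normrN. Qed.

Lemma nr_distC x y : nr (x - y) = nr (y - x).
Proof. by rewrite /nr distrC. Qed.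

Lemma ler_nrD x y : nr (x + y) <= nr x + nr y.
Proof. by rewrite -lecR rmorphD /= -!nrE ler_normD. Qed.

Lemma ler_nrB x y : nr (x - y) <= nr x + nr y.
Proof. by rewrite (le_trans (ler_nrD _ _))// nrN. Qed.

Lemma ler_nr_distD z x y : nr (x - y) <= nr (x - z) + nr (z - y).
Proof. by rewrite (le_trans _ (ler_nrD _ _))// addrA subrK. Qed.

Lemma ler_nr_dist x y : `|nr x - nr y| <= nr (x - y).
Proof.
rewrite ler_norml; apply/andP; split.
  have := ler_nrD (y - x) x; rewrite subrK (nr_distC y x) => h; lra.
have := ler_nrD (x - y) y; rewrite subrK => h; lra.
Qed.

End NormedZmod.

Lemma nrR (r : R) : nr r%:C = `|r|.
Proof. by rewrite /nr normc_def /= expr0n addr0 sqrtr_sqr. Qed.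

Lemma nrJ (c : R[i]) : nr c^*%C = nr c.
Proof. by rewrite /nr normcJ. Qed.

Lemma nri : nr ('i%C : R[i]) = 1.
Proof. by rewrite /nr normc_def /= expr0n expr1n add0r sqrtr1. Qed.

Lemma sqr_nr (c : R[i]) : nr c ^+ 2 = complex.Re c ^+ 2 + complex.Im c ^+ 2.
Proof.
by rewrite /nr normc_def /= sqr_sqrtr// addr_ge0 ?sqr_ge0.
Qed.

Lemma ler_Re_nr (c : R[i]) : `|complex.Re c| <= nr c.
Proof.
by rewrite -(@ler_pXn2r _ 2) ?nnegrE ?nr_ge0// sqr_nr real_normK ?num_real// lerDl sqr_ge0.
Qed.

Lemma nr_le_Re_Im (z : R[i]) : nr z <= `|complex.Re z| + `|complex.Im z|.
Proof.
rewrite -(@ler_pXn2r _ 2) ?nnegrE ?nr_ge0 ?addr_ge0// sqr_nr sqrrD !real_normK ?num_real//.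
by rewrite lerD2r lerDl mulrn_wge0// mulr_ge0.
Qed.

Lemma nrZ (V : normedModType R[i]) (c : R[i]) (x : V) : nr (c *: x) = nr c * nr x.
Proof. by apply: complexI; rewrite rmorphM /= -!nrE normrZ. Qed.

Lemma cvg_nrP (V : normedModType R[i]) T (F : set_system T) {FF : Filter F}
    (f : T -> V) (l : V) :
  f @ F --> l <-> forall e : R, 0 < e -> \forall t \near F, nr (l - f t) < e.
Proof.
split=> [/cvgrPdist_lt fl e e0|fl].
  have : (0 : R[i]) < e%:C by rewrite ltcR.
  by move/fl; apply: filterS => t; rewrite nrE ltcR.
apply/cvgrPdist_lt => e e0.
have eR : e = (complex.Re e)%:C by rewrite RRe_real// gtr0_real.
move: e0; rewrite eR ltcR => /fl.
by apply: filterS => t; rewrite nrE ltcR.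
Qed.

Lemma cvg_nr0P (V : normedModType R[i]) T (F : set_system T) {FF : Filter F}
    (f : T -> V) (l : V) :
  f @ F --> l <-> (fun t => nr (f t - l)) @ F --> (0 : R).
Proof.
rewrite cvg_nrP; split=> [fl|/cvgrPdist_lt fl e /fl].
  apply/cvgrPdist_lt => e /fl.
  by apply: filterS => t; rewrite sub0r normrN ger0_norm ?nr_ge0// nr_distC.
by apply: filterS => t; rewrite sub0r normrN ger0_norm ?nr_ge0// nr_distC.
Qed.

Lemma cvg_nr (V : normedModType R[i]) T (F : set_system T) {FF : Filter F}
    (f : T -> V) (l : V) : f @ F --> l -> (fun t => nr (f t)) @ F --> nr l.
Proof.
move=> /cvg_nrP fl; apply/cvgrPdist_lt => e /fl.
by apply: filterS => t; apply: le_lt_trans (ler_nr_dist _ _).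
Qed.

Lemma nr_cauchy_cvg (V : completeNormedModType R[i]) (u : nat -> V) :
  (forall e : R, 0 < e -> exists N, forall m n, (N <= m)%N -> (N <= n)%N ->
     nr (u m - u n) < e) -> cvg (u @ \oo).
Proof.
move=> cu; apply/cauchy_cvgP/cauchy_ballP => e e0.
have eR : e = (complex.Re e)%:C by rewrite RRe_real// gtr0_real.
move: e0; rewrite eR ltcR => /cu[N uN].
rewrite near_map2; exists ([set n | (N <= n)%N], [set n | (N <= n)%N]).
  by split; exists N.
by move=> [m n] [/= Nm Nn]; rewrite -ball_normE /= nrE ltcR; exact: uN.
Qed.

End Norm.

Section InnerProduct.
Context {R : realType}.

(** All estimates use the underlying real Hilbert space; [dotE] recovers the complex
    inner product from this one. *)
Definition dR (H : hilbert R) (x y : H) : R := complex.Re (dot x y).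

Variable H : hilbert R.
Implicit Types (x y z h : H) (c : R[i]) (r : R).

Lemma dotDl x y z : dot (x + y) z = dot x z + dot y z.
Proof. by have := dot_linear 1 x y z; rewrite scale1r mul1r. Qed.

Lemma dot0l z : dot 0 z = 0 :> R[i].
Proof. by have := dotDl 0 0 z; rewrite addr0 => /esym/(canRL (addrK _)); rewrite subrr. Qed.

Lemma dotZl c x z : dot (c *: x) z = c * dot x z.
Proof. by have := dot_linear c x 0 z; rewrite addr0 dot0l addr0. Qed.

Lemma dotNl x z : dot (- x) z = - dot x z.
Proof. by rewrite -scaleN1r dotZl mulN1r. Qed.

Lemma dotZr c x z : dot z (c *: x) = c^*%C * dot z x.
Proof. by rewrite dot_conj dotZl rmorphM /= -dot_conj. Qed.

Lemma dRC x y : dR x y = dR y x.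
Proof. by rewrite /dR dot_conj; case: (dot y x). Qed.

Lemma dRDl x y z : dR (x + y) z = dR x z + dR y z.
Proof. by rewrite /dR dotDl; case: (dot x z); case: (dot y z). Qed.

Lemma dRNl x z : dR (- x) z = - dR x z.
Proof. by rewrite /dR dotNl; case: (dot x z). Qed.

Lemma dRBl x y z : dR (x - y) z = dR x z - dR y z.
Proof. by rewrite dRDl dRNl. Qed.

Lemma dR0l z : dR 0 z = 0. Proof. by rewrite /dR dot0l. Qed.

Lemma dRZl r x z : dR (r%:C *: x) z = r * dR x z.
Proof. by rewrite /dR dotZl; case: (dot x z) => a b /=; rewrite mul0r subr0. Qed.

Lemma dRDr x y z : dR z (x + y) = dR z x + dR z y.
Proof. by rewrite !(dRC z) dRDl. Qed.

Lemma dRNr x z : dR z (- x) = - dR z x.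
Proof. by rewrite !(dRC z) dRNl. Qed.

Lemma dRBr x y z : dR z (x - y) = dR z x - dR z y.
Proof. by rewrite !(dRC z) dRBl. Qed.

Lemma dR0r z : dR z 0 = 0. Proof. by rewrite dRC dR0l. Qed.

Lemma dRZr r x z : dR z (r%:C *: x) = r * dR z x.
Proof. by rewrite !(dRC z) dRZl. Qed.

(** Negation as a real scaling, so that closure under sums and real scalings
    covers differences. *)
Lemma oppE x : - x = (-1 : R)%:C *: x.
Proof. by rewrite rmorphN rmorph1 scaleN1r. Qed.

Lemma dRcl c x y : dR (c *: x) y = dR x (c^*%C *: y).
Proof. by rewrite /dR dotZl dotZr; case: c => a b; rewrite /= opprK. Qed.

Lemma dotE x y : dot x y = dR x y +i* dR x ('i%C *: y).
Proof.
by rewrite /dR dotZr; case: (dot x y) => a b /=; rewrite mul0r sub0r mulNr opprK mul1r.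
Qed.

Lemma dRi x y : dR ('i%C *: x) ('i%C *: y) = dR x y.
Proof. rewrite dRcl scalerA; congr dR; rewrite -[RHS]scale1r; congr (_ *: _).
by apply/eqP; rewrite eq_complex /= !mul0r !mulr0 ?(mulN1r, mulr1) ?oppr0 ?addr0 ?sub0r ?opprK !eqxx. Qed.

Lemma dRii x y : dR ('i%C *: x) y = - dR x ('i%C *: y).
Proof.
rewrite dRcl -dRNr; congr dR; rewrite -scaleNr; congr (_ *: _).
by apply/eqP; rewrite eq_complex /= oppr0 !eqxx.
Qed.

Lemma dRxx x : dR x x = nr x ^+ 2.
Proof.
by rewrite /dR -dot_norm nrE -rmorphXn.
Qed.

Lemma nr_sqrD x y : nr (x + y) ^+ 2 = nr x ^+ 2 + 2 * dR x y + nr y ^+ 2.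
Proof. rewrite -!dRxx !dRDl !dRDr (dRC y x); ring. Qed.

Lemma nr_sqrB x y : nr (x - y) ^+ 2 = nr x ^+ 2 - 2 * dR x y + nr y ^+ 2.
Proof. by rewrite nr_sqrD dRNr nrN mulrN. Qed.

(** Cauchy-Schwarz, from the square of | |y| x - |x| y |. *)
Lemma dR_le x y : dR x y <= nr x * nr y.
Proof.
have [/eqP|y0] := eqVneq (nr y) 0.
  by rewrite nr_eq0 => /eqP ->; rewrite dR0r nr0 mulr0.
have yp : 0 < nr y by rewrite lt_def y0 nr_ge0.
have := sqr_ge0 (nr ((nr y)%:C *: x - (nr x)%:C *: y)).
rewrite nr_sqrB !nrZ !nrR !ger0_norm ?nr_ge0// dRZl dRZr.
have [x0|x0] := eqVneq (nr x) 0.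
  by move=> _; move/eqP: x0; rewrite nr_eq0 => /eqP ->; rewrite dR0l nr0 mul0r.
have xp : 0 < nr x by rewrite lt_def x0 nr_ge0.
move=> h; rewrite -subr_ge0.
have : 0 <= 2 * (nr x * nr y) * (nr x * nr y - dR x y).
  by apply: le_trans h _; rewrite le_eqVlt; apply/orP; left; apply/eqP; ring.
by rewrite pmulr_rge0// mulr_gt0// mulr_gt0.
Qed.

Lemma dR_norm_le x y : `|dR x y| <= nr x * nr y.
Proof. by rewrite ler_norml dR_le andbT lerNl -dRNr (le_trans (dR_le _ _))// nrN. Qed.

(** Rotating x by the conjugate phase of (x, y) makes the inner product real. *)
Lemma nr_dot_le x y : nr (dot x y) <= nr x * nr y.
Proof.
have [->|w0] := eqVneq (dot x y) 0; first by rewrite nr0 mulr_ge0 ?nr_ge0.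
have wp : 0 < nr (dot x y) by rewrite nr_gt0.
rewrite -(ler_pM2l wp).
have := dR_le ((dot x y)^*%C *: x) y; rewrite nrZ nrJ mulrA; apply: le_trans.
rewrite /dR dotZl le_eqVlt; apply/orP; left; apply/eqP.
by rewrite -expr2 sqr_nr; case: (dot x y) => a b /=; ring.
Qed.

Lemma dR_ext x y : (forall h, dR x h = dR y h) -> x = y.
Proof.
move=> xy; apply/eqP; rewrite -subr_eq0 -nr_eq0 -sqrf_eq0 -dRxx.
by rewrite dRBl xy subrr.
Qed.

Lemma cvg_dR T (F : set_system T) {FF : Filter F} (f : T -> H) (l h : H) :
  f @ F --> l -> (fun t => dR (f t) h) @ F --> dR l h.
Proof.
move=> /cvg_nr0P fl; apply/cvgrPdist_lt => e e0 /=.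
have h0 : 0 < nr h + 1 by rewrite ltr_wpDl ?nr_ge0.
have : 0 < e / (nr h + 1) by rewrite divr_gt0.
move/cvgrPdist_lt: fl => /[apply]; apply: filterS => t.
rewrite sub0r normrN ger0_norm ?nr_ge0// ltr_pdivlMr// => /(le_lt_trans _); apply.
rewrite -dRBl (le_trans (dR_norm_le _ _))// nr_distC ler_wpM2l ?nr_ge0// lerDl ler01 //.
Qed.

Lemma cvg_uniq (T : Type) (F : set_system T) {FF : ProperFilter F}
    (f : T -> H) (x y : H) : f @ F --> x -> f @ F --> y -> x = y.
Proof. by move=> fx fy; exact: (cvg_unique (norm_hausdorff (V := H)) fx fy). Qed.

End InnerProduct.

(** * The projection theorem *)

Section Riesz.
Context {R : realType}.

(** The minimizing sequence of the energy |x|^2 - 2 l(x) over M is Cauchy by the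
    parallelogram identity, and at the minimum the first variation vanishes.
    For M = H this is the representation of bounded functionals; for the
    functional (k, _) it gives the orthogonal projection of k on M. *)
Lemma riesz_on (H : hilbert R) (M : set H) (l : H -> R) (C : R) :
  M 0 -> (forall x y, M x -> M y -> M (x + y)) ->
  (forall (r : R) x, M x -> M (r%:C *: x)) ->
  (forall (u : nat -> H) x, (forall n, M (u n)) -> u @ \oo --> x -> M x) ->
  (forall x y, l (x + y) = l x + l y) ->
  (forall (r : R) x, l (r%:C *: x) = r * l x) ->
  (forall x, `|l x| <= C * nr x) ->
  exists2 m, M m & forall x, M x -> l x = dR m x.
Proof.
move=> M0 MD MZ Mcl lD lZ lC.
pose J x := nr x ^+ 2 - 2 * l x.
have lN x : l (- x) = - l x.
  by have := lZ (-1) x; rewrite rmorphN rmorph1 scaleN1r mulN1r.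
have Jlb x : - C ^+ 2 <= J x.
  have := lC x; have := ler_norm (l x); have := sqr_ge0 (nr x - C); rewrite /J.
  set a := nr x; set b := l x; move=> h1 h2 h3; nra.
pose S := [set J x | x in M].
have S0 : has_inf S.
  split; first by exists (J 0); exists 0.
  by exists (- C ^+ 2) => _ [x _ <-].
pose d := inf S.
have dJ x : M x -> d <= J x.
  by move=> Mx; apply: (ge_inf (proj2 S0)); exists x.
have hu (n : nat) : exists x, M x /\ J x < d + n.+1%:R^-1.
  have n0 : 0 < n.+1%:R^-1 :> R by rewrite invr_gt0.
  by have [_ [x Mx <-] h] := inf_adherent n0 S0; exists x.
have [u uP] := choice hu.
have upar m n : nr (u m - u n) ^+ 2 < 2 * m.+1%:R^-1 + 2 * n.+1%:R^-1.
  have [Mm Jm] := uP m; have [Mn Jn] := uP n.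
  have := dJ _ (MZ 2^-1 _ (MD _ _ Mm Mn)).
  rewrite {1}/J lZ lD nrZ nrR ger0_norm ?invr_ge0// exprMn.
  move: Jm Jn; rewrite nr_sqrB /J nr_sqrD.
  move: m.+1%:R^-1 n.+1%:R^-1 (nr (u m)) (nr (u n)) (dR _ _) (l (u m)) (l (u n)).
  by move=> p q a b c e f h1 h2 h3; rewrite expr2 in h3; lra.
have small (e : R) : 0 < e -> exists N : nat, forall n, (N <= n)%N -> n.+1%:R^-1 < e.
  move=> e0; have [N _ hN] := near_infty_natSinv_lt (PosNum e0).
  by exists N => n Nn; exact: hN.
have cu : cvg (u @ \oo).
  apply: nr_cauchy_cvg => e e0.
  have [N hN] := small (e ^+ 2 / 4) ltac:(by rewrite divr_gt0// exprn_gt0).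
  exists N => m n Nm Nn; rewrite -(@ltr_pXn2r _ 2) ?nnegrE ?nr_ge0// ?(ltW e0)//.
  have := upar m n; have := hN m Nm; have := hN n Nn.
  by move: m.+1%:R^-1 n.+1%:R^-1 => p q h1 h2 h3; lra.
have /cvg_ex[m um] := cu.
have Mm : M m by apply: (Mcl u) => // n; have [] := uP n.
have um0 : (fun n => nr (u n - m)) @ \oo --> (0 : R) by apply/cvg_nr0P.
have Jm : J m <= d.
  have lum : (fun n => l (u n)) @ \oo --> l m.
    have C0 : 0 <= C * nr (m - u 0%N) by apply: le_trans (lC _).
    have : (fun n => C * nr (u n - m)) @ \oo --> C * 0 by apply: cvgMr.
    rewrite mulr0 => /cvgr0Pnorm_lt h; apply/cvgrPdist_lt => e /h.
    apply: filterS => n; apply: le_lt_trans; rewrite -lN -lD nr_distC.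
    by rewrite (le_trans (lC _))// ler_norm.
  have Jum : (fun n => J (u n)) @ \oo --> J m.
    have num : (fun n => nr (u n)) @ \oo --> nr m by exact: cvg_nr.
    by apply: cvgB; [apply: cvgM|apply: cvgMr].
  have du : (fun n => d + n.+1%:R^-1) @ \oo --> d + 0.
    by apply: cvgD; [exact: cvg_cst|exact: cvg_harmonic].
  rewrite addr0 in du.
  apply: (ler_cvg_to Jum du); apply: nearW => n; exact/ltW/(uP n).2.
exists m => // x Mx.
apply/eqP; rewrite -subr_eq0; apply/negPn/negP => ne.
pose a := l x - dR m x.
have quad (t : R) : 0 <= t ^+ 2 * nr x ^+ 2 - 2 * t * a.
  have := le_trans Jm (dJ _ (MD _ _ Mm (MZ t _ Mx))).
  rewrite /J lD lZ nr_sqrD dRZr nrZ nrR exprMn real_normK ?num_real// /a; lra.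
have x1 : 0 < nr x ^+ 2 + 1 by rewrite ltr_wpDl ?sqr_ge0.
(* A step of this size makes the linear term beat the quadratic one; adding 1
   avoids dividing by |x|^2 when x = 0. *)
have := quad (a / (nr x ^+ 2 + 1)).
have -> : (a / (nr x ^+ 2 + 1)) ^+ 2 * nr x ^+ 2 - 2 * (a / (nr x ^+ 2 + 1)) * a
   = - (a ^+ 2 / (nr x ^+ 2 + 1) ^+ 2) * (nr x ^+ 2 + 2).
  by field; rewrite gt_eqF.
apply/negP; rewrite -ltNge mulNr oppr_lt0 mulr_gt0//.
  have a2 : 0 < a ^+ 2 by rewrite exprn_even_gt0.
  by rewrite divr_gt0// exprn_gt0.
by rewrite ltr_wpDl ?sqr_ge0.
Qed.

Lemma riesz (H : hilbert R) (l : H -> R) (C : R) :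
  (forall x y, l (x + y) = l x + l y) ->
  (forall (r : R) x, l (r%:C *: x) = r * l x) ->
  (forall x, `|l x| <= C * nr x) ->
  exists m, forall x, l x = dR m x.
Proof.
by move=> lD lZ lC; have [//|//|//|//|//|//|//|m _ hm] := @riesz_on H setT l C; exists m => x; exact: hm.
Qed.

(** A closed relation that is bounded below has closed range, and the projection
    theorem makes the range everything once nothing is orthogonal to it. *)
Lemma closed_range (H1 H2 : hilbert R) (G : set (H1 * H2)) (c : R) :
  G (0, 0) -> (forall x x' y y', G (x, y) -> G (x', y') -> G (x + x', y + y')) ->
  (forall (r : R) x y, G (x, y) -> G (r%:C *: x, r%:C *: y)) ->
  (forall u v x y, (forall n : nat, G (u n, v n)) -> u @ \oo --> x -> v @ \oo --> y ->
     G (x, y)) ->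
  (forall x y, G (x, y) -> nr x <= c * nr y) ->
  (forall h, (forall x y, G (x, y) -> dR h y = 0) -> h = 0) ->
  forall y, exists x, G (x, y).
Proof.
move=> G0 GD GZ Gcl Gc Gd k.
pose M : set H2 := [set y | exists x, G (x, y)].
have [| | | | | | |m [xm Gm] hm] := @riesz_on H2 M (dR k) (nr k).
- by exists 0.
- by move=> x y [x' Gx] [y' Gy]; exists (x' + y'); exact: GD.
- by move=> r x [x' Gx]; exists (r%:C *: x'); exact: GZ.
- move=> v y Mv vy.
  have [u uv] := choice Mv.
  have GB m n : G (u m - u n, v m - v n).
    by apply: GD => //; rewrite !oppE; exact: GZ.
  have /cvg_ex[x ux] : cvg (u @ \oo).
    apply: nr_cauchy_cvg => e e0.
    have c1 : 0 < `|c| + 1 by rewrite ltr_wpDl.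
    have e1 : 0 < e / (`|c| + 1) / 2 by rewrite !divr_gt0.
    move/cvg_nrP: vy => /(_ _ e1)[N _ hN]; exists N => m n Nm Nn.
    apply: le_lt_trans (Gc _ _ (GB m n)) _.
    have : nr (v m - v n) < e / (`|c| + 1).
      apply: le_lt_trans (ler_nr_distD y _ _) _.
      by rewrite [ltRHS]splitr ltrD// ?hN// nr_distC hN.
    rewrite ltr_pdivlMr// => h; apply: le_lt_trans h.
    rewrite mulrC ler_wpM2l ?nr_ge0// (le_trans (ler_norm _))// lerDl ler01 //.
  by exists x; exact: Gcl uv ux vy.
- by move=> x y; exact: dRDr.
- by move=> r x; exact: dRZr.
- exact: dR_norm_le.
suff -> : k = m by exists xm.
apply/eqP; rewrite -subr_eq0; apply/eqP/Gd => x y Gxy.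
by rewrite dRBl hm ?subrr//; exists x.
Qed.

End Riesz.

(** * The resolvent of a selfadjoint operator at i and -i *)

Section SelfadjointOperator.
Context {R : realType} (H : hilbert R) (D : set H) (A : H -> H).
Hypothesis Asa : @selfadjoint R (hspace H) (graph_on D A).
Implicit Types (x y g h k : H) (c s : R[i]).

Lemma sa_dom0 : D 0.
Proof. by case: Asa => -[_ [/= D0 _] _ _] _. Qed.

Lemma sa_lin c x y : D x -> D y -> D (c *: x + y) /\ A (c *: x + y) = c *: A x + A y.
Proof.
move=> Dx Dy; case: Asa => -[_ _ h _] _.
by have [/= ? ->] := h c (x, A x) (y, A y) (conj Dx erefl) (conj Dy erefl).
Qed.

Lemma sa_domZ c x : D x -> D (c *: x).
Proof. by move=> Dx; have := (sa_lin c Dx sa_dom0).1; rewrite addr0. Qed.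

Lemma sa_domD x y : D x -> D y -> D (x + y).
Proof. by move=> Dx Dy; have := (sa_lin 1 Dx Dy).1; rewrite scale1r. Qed.

Lemma sa_op0 : A 0 = 0.
Proof.
have := (sa_lin 1 sa_dom0 sa_dom0).2; rewrite !scale1r addr0.
by move/esym/(canRL (addrK _)); rewrite subrr.
Qed.

Lemma sa_opZ c x : D x -> A (c *: x) = c *: A x.
Proof. by move=> Dx; have := (sa_lin c Dx sa_dom0).2; rewrite addr0 sa_op0 addr0. Qed.

Lemma sa_opD x y : D x -> D y -> A (x + y) = A x + A y.
Proof. by move=> Dx Dy; have := (sa_lin 1 Dx Dy).2; rewrite !scale1r. Qed.

Lemma sa_sym x y : D x -> D y -> dot (A x) y = dot x (A y).
Proof.
move=> Dx Dy; case: Asa => _ /seteqP[_ /(_ (y, A y) (conj Dy erefl))[/= _ _]].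
by move=> /(_ (x, A x) (conj Dx erefl)).
Qed.

Lemma sa_symR x y : D x -> D y -> dR (A x) y = dR x (A y).
Proof. by move=> Dx Dy; rewrite /dR sa_sym. Qed.

(** Maximality of a selfadjoint operator. Real parts suffice in the test: replacing g
    by ig gives the imaginary parts. *)
Lemma sa_max x y : (forall g, D g -> dR (A g) x = dR g y) -> D x /\ A x = y.
Proof.
move=> h; case: Asa => _ /seteqP[/(_ (x, y)) + _]; rewrite /graph_on /=.
case=> [|Dx ->//]; split=> // -[g _] /= [Dg ->]; rewrite !dotE; congr (_ +i* _); first exact: h.
have := h _ (sa_domZ 'i%C Dg); rewrite sa_opZ// !dRii => /eqP.
by rewrite eqr_opp => /eqP.
Qed.

(** (Ax, x) is real. *)
Lemma sa_cross x : D x -> dR (A x) ('i%C *: x) = 0.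
Proof.
move=> Dx; have := sa_symR Dx (sa_domZ 'i%C Dx); rewrite sa_opZ//.
by rewrite [in X in _ = X]dRC dRii => h; lra.
Qed.

Lemma sa_nr_sqr s x : s = 'i%C \/ s = - 'i%C -> D x ->
  nr (A x + s *: x) ^+ 2 = nr (A x) ^+ 2 + nr x ^+ 2.
Proof.
move=> hs Dx; rewrite nr_sqrD nrZ.
have -> : nr s = 1 by case: hs => ->; rewrite ?nrN nri.
have -> : dR (A x) (s *: x) = 0 by case: hs => ->; rewrite ?scaleNr ?dRNr sa_cross// oppr0.
by rewrite mulr0 addr0 mul1r.
Qed.

(** A + s is bounded below by [sa_nr_sqr] and closed; a vector orthogonal to its range
    would be an eigenvector of A for the eigenvalue s, which is not real. *)
Lemma sa_range s : s = 'i%C \/ s = - 'i%C -> forall k, exists2 g, D g & A g + s *: g = k.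
Proof.
move=> hs k.
have [] := @closed_range R H H [set p | D p.1 /\ p.2 = A p.1 + s *: p.1] 1 _ _ _ _ _ _ k.
- by split=> /=; [exact: sa_dom0|rewrite sa_op0 scaler0 addr0].
- move=> x x' y y' /= [Dx ->] [Dx' ->]; split; first exact: sa_domD.
  by rewrite sa_opD// scalerDr addrACA.
- move=> r x y /= [Dx ->]; split; first exact: sa_domZ.
  by rewrite sa_opZ// scalerDr !scalerA mulrC.
- move=> u v x y Guv ux vy /=.
  have vs : (fun n => v n - s *: u n) @ \oo --> y - s *: x.
    by apply: cvgB => //; apply: cvgZr.
  have [Dx Ax] : D x /\ A x = y - s *: x.
    apply: sa_max => g Dg; rewrite dRC [RHS]dRC.
    have h1 : (fun n => dR (u n) (A g)) @ \oo --> dR x (A g) by exact: cvg_dR.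
    have h2 : (fun n => dR (v n - s *: u n) g) @ \oo --> dR (y - s *: x) g.
      exact: cvg_dR.
    apply: (cvg_unique (@Rhausdorff R) h1).
    apply: cvg_trans h2; apply: near_eq_cvg; apply: nearW => n.
    have [/= Du ->] := Guv n; rewrite addrK dRC [RHS]dRC; exact: esym (sa_symR _ _).
  by split=> //; rewrite Ax subrK.
- move=> x y /= [Dx ->]; rewrite mul1r -(@ler_pXn2r _ 2) ?nnegrE ?nr_ge0//.
  by rewrite sa_nr_sqr// lerDr sqr_ge0.
- move=> h hG.
  have [Dh Ah] : D h /\ A h = s *: h.
    apply: sa_max => g Dg; have := hG g (A g + s *: g) (conj Dg erefl).
    rewrite dRDr !(dRC h) => /eqP; rewrite addr_eq0 => /eqP ->.
    rewrite dRcl -dRNr -scaleNr; congr (dR _ (_ *: _)).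
    by case: hs => ->; apply/eqP; rewrite eq_complex /= ?oppr0 ?opprK !eqxx.
  have := sa_cross Dh; rewrite Ah.
  have e := dRi h h; rewrite (dRxx h) in e.
  by case: hs => ->; rewrite ?scaleNr ?dRNl e => /eqP;
    rewrite ?oppr_eq0 sqrf_eq0 nr_eq0 => /eqP.
by move=> g [/= Dg ->]; exists g.
Qed.

(** (A + s)^-1; for s = i and s = -i these are bounded everywhere defined operators,
    through which A enters all the estimates. *)
Definition resolvent s k : H := xget 0 [set g | D g /\ A g + s *: g = k].

Section Resolvent.
Variable s : R[i].
Hypothesis hs : s = 'i%C \/ s = - 'i%C.

Lemma resolventP k : D (resolvent s k) /\ A (resolvent s k) + s *: resolvent s k = k.
Proof.
by rewrite /resolvent; case: xgetP => [g -> //|]; have [g Dg Ag] := sa_range hs k => /(_ g)[].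
Qed.

Lemma op_resolvent k : A (resolvent s k) = k - s *: resolvent s k.
Proof. by have [_ h] := resolventP k; rewrite -{2}h addrK. Qed.

Lemma resolvent_uniq g k : D g -> A g + s *: g = k -> resolvent s k = g.
Proof.
move=> Dg Ag; have [Dr Ar] := resolventP k.
apply/eqP; rewrite -subr_eq0 -scaleN1r addrC -nr_eq0 -sqrf_eq0.
have DB : D (-1 *: g + resolvent s k) by apply: sa_domD => //; exact: sa_domZ.
have := sa_nr_sqr hs DB.
rewrite sa_opD ?sa_opZ//; last exact: sa_domZ.
have -> : -1 *: A g + A (resolvent s k) + s *: (-1 *: g + resolvent s k) = 0.
  by rewrite scalerDr addrACA Ar scalerA mulrC -scalerA -scalerDr Ag scaleN1r addNr.
rewrite nr0.
rewrite expr0n /= => /esym/eqP.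
by rewrite paddr_eq0 ?sqr_ge0// => /andP[].
Qed.

Lemma resolventK g : D g -> resolvent s (A g + s *: g) = g.
Proof. by move=> Dg; exact: resolvent_uniq. Qed.

Lemma resolvent_lin c x y : resolvent s (c *: x + y) = c *: resolvent s x + resolvent s y.
Proof.
have [Dx Ax] := resolventP x; have [Dy Ay] := resolventP y.
have [D1 A1] := sa_lin c Dx Dy.
apply: resolvent_uniq => //; rewrite A1 scalerDr addrACA Ay; congr (_ + _).
by rewrite scalerA mulrC -scalerA -scalerDr Ax.
Qed.

Lemma resolvent0 : resolvent s 0 = 0.
Proof. by apply: resolvent_uniq; [exact: sa_dom0|rewrite sa_op0 scaler0 addr0]. Qed.

Lemma resolventZ c x : resolvent s (c *: x) = c *: resolvent s x.
Proof. by have := resolvent_lin c x 0; rewrite !addr0 resolvent0 addr0. Qed.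

Lemma resolventD x y : resolvent s (x + y) = resolvent s x + resolvent s y.
Proof. by have := resolvent_lin 1 x y; rewrite !scale1r. Qed.

Lemma resolventB x y : resolvent s (x - y) = resolvent s x - resolvent s y.
Proof. by rewrite resolventD !oppE resolventZ. Qed.

Lemma nr_resolvent k : nr (resolvent s k) <= nr k.
Proof.
have [Dr {2}<-] := resolventP k.
by rewrite -(@ler_pXn2r _ 2) ?nnegrE ?nr_ge0// sa_nr_sqr// lerDr sqr_ge0.
Qed.

Lemma resolvent_inj x y : resolvent s x = resolvent s y -> x = y.
Proof. by have [_ {2}<-] := resolventP x; have [_ {2}<-] := resolventP y => ->. Qed.

End Resolvent.

Let hp : 'i%C = 'i%C :> R[i] \/ 'i%C = - 'i%C :> R[i]. Proof. by left. Qed.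
Let hm : - 'i%C = 'i%C :> R[i] \/ - 'i%C = - 'i%C :> R[i]. Proof. by right. Qed.

Lemma resolvent_adj x y : dR (resolvent (- 'i%C) x) y = dR x (resolvent 'i%C y).
Proof.
have [Dx {2}<-] := resolventP hm x; have [Dy {1}<-] := resolventP hp y.
rewrite dRDl dRDr sa_symR//; congr (_ + _).
by rewrite scaleNr dRNl dRii opprK.
Qed.

(** A vector orthogonal to D, the range of (A + i)^-1, is in the kernel of
    (A - i)^-1. *)
Lemma sa_dense x : (forall g, D g -> dR x g = 0) -> x = 0.
Proof.
move=> h; apply: (@resolvent_inj _ hm); rewrite (resolvent0 hm).
by apply: dR_ext => k; rewrite resolvent_adj dR0l h//; have [] := resolventP hp k.
Qed.

End SelfadjointOperator.

(** * One-parameter unitary groups *)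

Section UnitaryGroup.
Context {R : realType} (H : hilbert R) (D : set H) (A : H -> H).
Hypothesis Asa : @selfadjoint R (hspace H) (graph_on D A).
Variable V : R -> H -> H.
Hypothesis Vgrp : expi_group (graph_on D A) V.
Implicit Types (x y g h : H) (c : R[i]) (s t : R).

Lemma grp_lin t c x y : V t (c *: x + y) = c *: V t x + V t y.
Proof. by case: Vgrp => /(_ t)[h _ _] _ _ _ _; exact: h. Qed.

Lemma grp_dot t x y : dot (V t x) (V t y) = dot x y.
Proof. by case: Vgrp => /(_ t)[_ h _] _ _ _ _; exact: h. Qed.

Lemma grp0 x : V 0 x = x.
Proof. by case: Vgrp. Qed.

Lemma grpD s t x : V (s + t) x = V s (V t x).
Proof. by case: Vgrp. Qed.

Lemma grpKN t x : V t (V (- t) x) = x.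
Proof. by rewrite -grpD subrr grp0. Qed.

Lemma grp_add t x y : V t (x + y) = V t x + V t y.
Proof. by have := grp_lin t 1 x y; rewrite !scale1r. Qed.

Lemma grp_zero t : V t 0 = 0.
Proof. by have := grp_add t 0 0; rewrite addr0 => /esym/(canRL (addrK _)); rewrite subrr. Qed.

Lemma grpZ t c x : V t (c *: x) = c *: V t x.
Proof. by have := grp_lin t c x 0; rewrite !addr0 grp_zero addr0. Qed.

Lemma grpN t x : V t (- x) = - V t x.
Proof. by rewrite -scaleN1r grpZ scaleN1r. Qed.

Lemma grpB t x y : V t (x - y) = V t x - V t y.
Proof. by rewrite grp_add grpN. Qed.

Lemma grp_dR t x y : dR (V t x) (V t y) = dR x y.
Proof. by rewrite /dR grp_dot. Qed.

Lemma nr_grp t x : nr (V t x) = nr x.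
Proof. by apply/eqP; rewrite -(@eqrXn2 _ 2) ?nr_ge0// -!dRxx grp_dR. Qed.

Lemma grp_adj t x y : dR (V t x) y = dR x (V (- t) y).
Proof. by rewrite -{1}(grpKN t y) grp_dR. Qed.

Lemma grp_cvg t T (F : set_system T) {FF : Filter F} (f : T -> H) x :
  f @ F --> x -> (fun n => V t (f n)) @ F --> V t x.
Proof.
move=> /cvg_nrP fx; apply/cvg_nrP => e /fx.
by apply: filterS => n; rewrite -grpB nr_grp.
Qed.

Lemma grp_continuous x : continuous (fun t => V t x).
Proof.
move=> t; apply/cvg_nrP => e e0.
case: Vgrp => _ _ _ /(_ x)/cvg_nrP /(_ e e0) h _.
have : \forall s \near (t : R), nr (x - V (s - t) x) < e.
  have : (fun s : R => s - t) @ t --> (0 : R).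
    by rewrite -(subrr t); apply: cvgB; [exact: cvg_id|exact: cvg_cst].
  by move/(_ _ h).
apply: filterS => s; rewrite -(nr_grp t) grpB -grpD.
by rewrite [t + _]addrC subrK.
Qed.

Lemma grp_derive0 g : D g ->
  (fun t => (t%:C)^-1 *: (V t g - g)) @ (0 : R)^' --> 'i%C *: A g.
Proof. by move=> Dg; case: Vgrp => _ _ _ _ /(_ g (A g)) [h _]; exact: h. Qed.

(** The difference quotient at 0 of the orbit of V t g is the image under V t of that of g. *)
Lemma grp_dom t g : D g -> D (V t g) /\ A (V t g) = V t (A g).
Proof.
move=> Dg; case: (Vgrp) => _ _ _ _ /(_ (V t g) (V t (A g))) [_ h].
case: h => [|? /= -> //].
rewrite -grpZ; have /= := @grp_cvg t _ _ (dnbhs_filter _) _ _ (grp_derive0 Dg).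
apply: cvg_ext => s.
by rewrite grpZ grpB -!grpD [t + s]addrC.
Qed.

(** By uniqueness of the solution of (A + c) g = V t x. *)
Lemma resolvent_grp c t x : c = 'i%C \/ c = - 'i%C ->
  resolvent D A c (V t x) = V t (resolvent D A c x).
Proof.
move=> hc; have [Dr Ar] := resolventP Asa hc x.
have [DV AV] := grp_dom t Dr.
by apply: (resolvent_uniq Asa hc) => //; rewrite AV -grpZ -grp_add Ar.
Qed.

(** Stone's equation, tested against a fixed vector. *)
Lemma grp_is_derive g h t : D g ->
  is_derive t 1 (fun s => dR (V s g) h) (dR ('i%C *: V t (A g)) h).
Proof.
move=> Dg.
have cv : (fun s : R => s^-1 * (dR (V (s + t) g) h - dR (V t g) h)) @ (0 : R)^' -->
   dR ('i%C *: V t (A g)) h.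
  rewrite -grpZ; have /= := @cvg_dR _ _ _ _ (dnbhs_filter _) _ _ h (@grp_cvg t _ _ (dnbhs_filter _) _ _ (grp_derive0 Dg)).
  apply: cvg_ext => s.
  by rewrite grpZ -fmorphV /= dRZl grpB -grpD dRBl (addrC s).
have e : (fun s : R => s^-1 *: (((fun s => dR (V s g) h) \o shift t) (s *: 1) -
     dR (V t g) h)) = (fun s : R => s^-1 * (dR (V (s + t) g) h - dR (V t g) h)).
  by apply/funext => s /=; rewrite [s *: 1]mulr1.
apply: DeriveDef.
  by apply/cvg_ex; exists (dR ('i%C *: V t (A g)) h); rewrite e.
by rewrite /derive; apply: cvg_lim; [exact: Rhausdorff|rewrite e].
Qed.

End UnitaryGroup.

(** * The negative space as an isometric copy of H *)

Section NegativeSpaceModel.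
Context {R : realType} (H : hilbert R) (D : set H) (A : H -> H).
Hypothesis H_nontrivial : exists x : H, x <> 0.
Hypothesis Asa : @selfadjoint R (hspace H) (graph_on D A).
Variables (Hm : hilbert R) (iota : {linear H -> Hm}).
Hypothesis Hm_negative : negative_space D A iota.
Variable At : H -> Hm.
Hypothesis At_adjoint : plus_adjoint D A iota At.
Implicit Types (f g h k x y : H).

Let hp : 'i%C = 'i%C :> R[i] \/ 'i%C = - 'i%C :> R[i]. Proof. by left. Qed.
Let hm : - 'i%C = 'i%C :> R[i] \/ - 'i%C = - 'i%C :> R[i]. Proof. by right. Qed.
Let Rm := resolvent D A (- 'i%C).
Let Rp := resolvent D A 'i%C.

Lemma norm_plusE g : D g -> norm_plus A g = nr (A g + 'i%C *: g).
Proof.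
move=> Dg; apply/eqP; rewrite -(@eqrXn2 _ 2) ?nr_ge0 ?sqrtr_ge0//.
have e : complex.Re (dot (A g) (A g) + dot g g) = nr (A g) ^+ 2 + nr g ^+ 2.
  by rewrite -!dRxx /dR; case: (dot (A g) _); case: (dot g g).
by rewrite /norm_plus e sqr_sqrtr ?addr_ge0 ?sqr_ge0// (sa_nr_sqr Asa hp Dg).
Qed.

Lemma dot_resolvent f g : D g -> dot f g = dot (Rm f) (A g + 'i%C *: g).
Proof.
move=> Dg; have Rg := resolventK Asa hp Dg.
have e k : dR (Rm k) (A g + 'i%C *: g) = dR k g by rewrite resolvent_adj// Rg.
rewrite !dotE e; congr (_ +i* _).
by apply: oppr_inj; rewrite -!dRii -(resolventZ Asa hm) e.
Qed.

(** |f|_- = |(A - i)^-1 f|, as (f, g) = ((A - i)^-1 f, (A + i) g) and (A + i) maps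
    H_+ isometrically onto H. *)
Lemma norm_minusE f : norm_minus D A f = nr (Rm f).
Proof.
rewrite /norm_minus; set S := (X in sup X).
have ubS : ubound S (nr (Rm f)).
  move=> _ [g [Dg g0 ->]]; rewrite norm_plusE// dot_resolvent//.
  have p0 : 0 < nr (A g + 'i%C *: g).
    rewrite lt_def nr_ge0 andbT; apply/eqP => /eqP.
    rewrite -(@sqrf_eq0 R) (sa_nr_sqr Asa hp Dg) paddr_eq0 ?sqr_ge0// => /andP[_].
    by rewrite sqrf_eq0 nr_eq0 => /eqP.
  by rewrite ler_pdivrMr//; exact: nr_dot_le.
have [g1 Dg1 g10] : exists2 g, D g & g <> 0.
  case: H_nontrivial => x x0; apply: contrapT => hN; apply: x0.
  apply: (sa_dense Asa) => g Dg; have [->|g0] := eqVneq g 0; first exact: dR0r.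
  by exfalso; apply: hN; exists g => //; apply/eqP.
have S0 : S !=set0.
  by exists (complex.Re `|dot f g1| / norm_plus A g1); exists g1.
have hS : has_sup S by split=> //; exists (nr (Rm f)).
apply/eqP; rewrite eq_le; apply/andP; split; first exact: ge_sup.
have [Rf0|Rf0] := eqVneq (Rm f) 0.
  rewrite Rf0 nr0; have [r Sr] := S0.
  apply: (@le_trans _ _ r); last exact: ub_le_sup (proj2 hS) _ Sr.
  by case: Sr => g [_ _ ->]; exact: divr_ge0 (nr_ge0 (dot f g)) (sqrtr_ge0 _).
have [Dr Ar] := resolventP Asa hp (Rm f).
apply: (ub_le_sup (proj2 hS)); exists (Rp (Rm f)); split => //.
  move=> r0; move: Ar; rewrite -/(Rp _) r0 (sa_op0 Asa) scaler0 addr0 => /esym/eqP.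
  exact/negP.
rewrite norm_plusE// dot_resolvent// Ar -dot_norm -/(nr _).
rewrite nrE -rmorphXn /= nrR ger0_norm ?sqr_ge0// expr2 mulfK//.
by rewrite nr_eq0.
Qed.

Lemma nr_iota f : nr (iota f) = nr (Rm f).
Proof. by rewrite /nr Hm_negative.1 /= norm_minusE. Qed.

(** The isometry of H onto H_- extending iota o (A - i). *)
Definition neg_iso h : Hm := At h - 'i%C *: iota h.

(** Both isometry and linearity of the map are limits of the corresponding facts for
    iota, once At h - i iota h is approximated by iota e_n with (A - i)^-1 e_n -> h.
    The sequence comes from the pairing that characterizes At h; its limit does not
    depend on the sequence, so testing against all g in D identifies it. *)
Lemma neg_iso_seq h : exists e : nat -> H,
  (fun n => iota (e n)) @ \oo --> neg_iso h /\ (fun n => Rm (e n)) @ \oo --> h.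
Proof.
have [f0 [f0h _]] := At_adjoint h (sa_dom0 Asa).
have nrB f g : nr (iota f - iota g) = nr (Rm f - Rm g).
  by rewrite -linearB nr_iota /Rm (resolventB Asa hm).
have /cvg_ex[j jP] : cvg ((fun n => Rm (f0 n)) @ \oo).
  apply: nr_cauchy_cvg => e e0.
  have e2 : 0 < e / 2 by rewrite divr_gt0.
  move/cvg_nrP: f0h => /(_ _ e2)[N _ hN]; exists N => m n Nm Nn.
  rewrite -nrB; apply: le_lt_trans (ler_nr_distD (At h) _ _) _.
  by rewrite [ltRHS]splitr ltrD ?hN// nr_distC hN.
have jE g : D g -> dR j (A g + 'i%C *: g) = dR h (A g).
  move=> Dg; have [f [fh fg]] := At_adjoint h Dg.
  have fj : (fun n => Rm (f n)) @ \oo --> j.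
    apply/cvg_nr0P.
    have : (fun n => nr (iota (f n) - iota (f0 n)) + nr (Rm (f0 n) - j)) @ \oo --> (0 + 0 : R).
      apply: cvgD; last exact/cvg_nr0P.
      rewrite -[X in _ --> X](nr0 Hm) -(subrr (At h)); apply: cvg_nr.
      exact: cvgB.
    rewrite addr0; apply: (@squeeze_cvgr _ _ _ _ (cst 0)); last exact: cvg_cst.
    by apply: nearW => n; rewrite nr_ge0 /= nrB ler_nr_distD.
  have h1 : (fun n => dR (Rm (f n)) (A g + 'i%C *: g)) @ \oo --> dR j (A g + 'i%C *: g).
    exact: cvg_dR.
  apply: (cvg_unique (@Rhausdorff R) h1).
  apply: (@cvg_ext _ _ _ (fun n => dR (f n) g)).
    by move=> n; rewrite /dR dot_resolvent.
  apply/cvgrPdist_lt => e e0; move/cvg_nrP: fg => /(_ e e0).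
  apply: filterS => n; apply: le_lt_trans.
  apply: le_trans (ler_Re_nr _); rewrite /dR.
  by case: (dot h (A g)); case: (dot (f n) g).
have jh : j = h + 'i%C *: Rm h.
  apply: dR_ext => k; have [Dk Ak] := resolventP Asa hp k.
  have := jE _ Dk; rewrite Ak => ->.
  rewrite (op_resolvent Asa hp) dRBr dRDl; congr (_ + _).
  by rewrite -dRii -(resolventZ Asa hm) resolvent_adj.
exists (fun n => f0 n - 'i%C *: h); split.
  apply: (@cvg_ext _ _ _ (fun n => iota (f0 n) - 'i%C *: iota h)).
    by move=> n /=; rewrite linearB; congr (_ - _); rewrite linearZ.
  by apply: cvgB => //; exact: cvg_cst.
apply: (@cvg_ext _ _ _ (fun n => Rm (f0 n) - 'i%C *: Rm h)).
  by move=> n; rewrite /Rm (resolventB Asa hm) (resolventZ Asa hm).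
have {2}-> : h = j - 'i%C *: Rm h by rewrite jh addrK.
by apply: cvgB; [|exact: cvg_cst].
Qed.

Lemma nr_neg_iso h : nr (neg_iso h) = nr h.
Proof.
have [e [eK eh]] := neg_iso_seq h.
have h1 : (fun n => nr (Rm (e n))) @ \oo --> nr h by exact: cvg_nr.
have h2 : (fun n => nr (iota (e n))) @ \oo --> nr (neg_iso h) by exact: cvg_nr.
apply: (cvg_unique (@Rhausdorff R) h2); apply: cvg_ext h1 => n.
by rewrite nr_iota.
Qed.

Lemma neg_iso_lin (c : R[i]) x y : neg_iso (c *: x + y) = c *: neg_iso x + neg_iso y.
Proof.
have [e [eK eh]] := neg_iso_seq (c *: x + y).
have [ex [exK exh]] := neg_iso_seq x; have [ey [eyK eyh]] := neg_iso_seq y.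
apply/eqP; rewrite -subr_eq0 -nr_eq0.
have h1 : (fun n => nr (iota (e n) - (c *: iota (ex n) + iota (ey n)))) @ \oo -->
    nr (neg_iso (c *: x + y) - (c *: neg_iso x + neg_iso y)).
  by apply: cvg_nr; apply: cvgB => //; apply: cvgD => //; exact: cvgZr.
have h2 : (fun n => nr (Rm (e n) - (c *: Rm (ex n) + Rm (ey n)))) @ \oo -->
    nr (c *: x + y - (c *: x + y)).
  by apply: cvg_nr; apply: cvgB => //; apply: cvgD => //; exact: cvgZr.
rewrite subrr nr0 in h2.
apply/eqP; apply: (cvg_unique (@Rhausdorff R) h1); apply: cvg_ext h2 => n.
by rewrite -linearP -linearB nr_iota /Rm (resolventB Asa hm) (resolvent_lin Asa hm).
Qed.

Lemma neg_isoD x y : neg_iso (x + y) = neg_iso x + neg_iso y.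
Proof. by have := neg_iso_lin 1 x y; rewrite !scale1r. Qed.

Lemma neg_iso0 : neg_iso 0 = 0.
Proof. by apply/eqP; rewrite -nr_eq0 nr_neg_iso nr0. Qed.

Lemma neg_isoZ (c : R[i]) x : neg_iso (c *: x) = c *: neg_iso x.
Proof. by have := neg_iso_lin c x 0; rewrite neg_iso0 !addr0. Qed.

Lemma neg_isoB x y : neg_iso (x - y) = neg_iso x - neg_iso y.
Proof. by rewrite neg_isoD !oppE neg_isoZ. Qed.

Lemma neg_iso_dR x y : dR (neg_iso x) (neg_iso y) = dR x y.
Proof.
have := nr_sqrD (neg_iso x) (neg_iso y); rewrite -neg_isoD !nr_neg_iso nr_sqrD.
by move=> h; lra.
Qed.

Lemma neg_iso_dot x y : dot (neg_iso x) (neg_iso y) = dot x y.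
Proof. by rewrite !dotE -neg_isoZ !neg_iso_dR. Qed.

Lemma neg_iso_inj : injective neg_iso.
Proof.
move=> x y xy; apply/eqP; rewrite -subr_eq0 -nr_eq0 -nr_neg_iso neg_isoB xy subrr.
by rewrite nr0.
Qed.

Lemma neg_iso_cvg T (F : set_system T) {FF : Filter F} (f : T -> H) x :
  (fun n => neg_iso (f n)) @ F --> neg_iso x <-> f @ F --> x.
Proof.
rewrite !cvg_nr0P; split; apply: cvg_ext => n;
  by rewrite -neg_isoB nr_neg_iso.
Qed.

Lemma neg_iso_resolvent f : neg_iso (Rm f) = iota f.
Proof.
have [e [eK eh]] := neg_iso_seq (Rm f).
apply/eqP; rewrite -subr_eq0 -nr_eq0.
have h1 : (fun n => nr (iota (e n) - iota f)) @ \oo --> nr (neg_iso (Rm f) - iota f).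
  by apply: cvg_nr; apply: cvgB => //; exact: cvg_cst.
have h2 : (fun n => nr (Rm (e n) - Rm f)) @ \oo --> nr (Rm f - Rm f).
  by apply: cvg_nr; apply: cvgB => //; exact: cvg_cst.
rewrite subrr nr0 in h2.
apply/eqP; apply: (cvg_unique (@Rhausdorff R) h1); apply: cvg_ext h2 => n.
by rewrite -linearB nr_iota /Rm (resolventB Asa hm).
Qed.

(** The range is closed by isometry, and dense since it contains the range of iota. *)
Lemma neg_iso_surj (y : Hm) : exists x, neg_iso x = y.
Proof.
have [| | | | | |x xy] := @closed_range R H Hm [set p | neg_iso p.1 = p.2] 1 _ _ _ _ _ _ y.
- exact: neg_iso0.
- by move=> x x' z z' /= <- <-; rewrite neg_isoD.
- by move=> r x z /= <-; rewrite neg_isoZ.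
- move=> u v x z /= uv ux vz; apply: (cvg_uniq (F := \oo) (f := v)) => //.
  by apply: cvg_ext uv _; apply/neg_iso_cvg.
- by move=> x z /= <-; rewrite nr_neg_iso mul1r.
- move=> h hG; apply/eqP; rewrite -nr_eq0; apply/negPn/negP => n0.
  have hp0 : 0 < nr h by rewrite lt_def n0 nr_ge0.
  have h0 : (0 : R[i]) < (nr h)%:C by rewrite ltcR.
  have [] := Hm_negative.2 (ball h (nr h)%:C).
  - by exists h; exact: ballxx.
  - exact: ball_open.
  move=> v [/= + [f _ fv]]; rewrite -fv -ball_normE /= nrE ltcR => hf.
  have := dR_le h (h - iota f); rewrite dRBr -neg_iso_resolvent.
  rewrite (hG (Rm f) (neg_iso (Rm f)) erefl) subr0 dRxx neg_iso_resolvent expr2.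
  by rewrite ler_pM2l// leNgt hf.
by exists x.
Qed.

Lemma At_neg_iso f : At f = neg_iso (f + 'i%C *: Rm f).
Proof. by rewrite neg_isoD neg_isoZ neg_iso_resolvent /neg_iso subrK. Qed.

(** The isometry carries the graph of A onto that of the extension of A to H_-. *)
Lemma neg_iso_op h k : (D h /\ k = A h) <-> tilde_op iota At (neg_iso h, neg_iso k).
Proof.
have AtE := At_neg_iso.
split=> [[Dh ->]|[f]].
  exists (A h - 'i%C *: h); have Rh : Rm (A h - 'i%C *: h) = h.
    by rewrite -scaleNr; apply: (resolventK Asa hm).
  by rewrite AtE -neg_iso_resolvent Rh subrK.
rewrite AtE -neg_iso_resolvent => -[/neg_iso_inj -> /neg_iso_inj ->].
have [Dr _] := resolventP Asa hm f; split => //.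
by rewrite (op_resolvent Asa hm) scaleNr opprK.
Qed.

Variable E : R -> Hm -> Hm.
Hypothesis E_exp : expi_group (tilde_op iota At) E.

(** e^{i A~ t} carried from H_- to H by the isometry is e^{iAt}; since (A - i)^-1
    commutes with the group, it is also the restriction of e^{i A~ t} to H. *)
Lemma group_in_H : exists V : R -> H -> H,
  expi_group (graph_on D A) V /\
  forall t x y, restrict_to_H iota (E t) (x, y) <-> y = V t x.
Proof.
have [Kinv KinvK] := choice neg_iso_surj.
pose V t x := Kinv (E t (neg_iso x)).
have KV t x : neg_iso (V t x) = E t (neg_iso x) by rewrite /V KinvK.
case: E_exp => Eu E0 ED Ec Egen.
have Vgrp : expi_group (graph_on D A) V.
  split.
  - move=> t; have [El Ed Es] := Eu t; split.
    + move=> c x y; apply: neg_iso_inj.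
      by rewrite neg_iso_lin !KV neg_iso_lin El.
    + by move=> x y; rewrite -neg_iso_dot !KV Ed neg_iso_dot.
    + move=> y; have [z Ez] := Es (neg_iso y); exists (Kinv z).
      by apply: neg_iso_inj; rewrite KV KinvK.
  - by move=> x; apply: neg_iso_inj; rewrite KV E0.
  - by move=> s t x; apply: neg_iso_inj; rewrite !KV ED.
  - move=> x; apply/neg_iso_cvg; apply: cvg_ext (Ec (neg_iso x)) => t.
    by rewrite KV.
  - move=> x y; rewrite -(neg_iso_cvg (F := (0 : R)^')) neg_isoZ.
    rewrite /graph_on /= neg_iso_op Egen; split; apply: cvg_ext => t;
    by rewrite neg_isoZ neg_isoB KV.
exists V; split => // t x y.
rewrite /restrict_to_H /= -!neg_iso_resolvent -KV; split=> [/neg_iso_inj|->].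
  by rewrite /Rm -(resolvent_grp Asa Vgrp _ _ hm) => /(resolvent_inj Asa hm).
by rewrite /Rm (resolvent_grp Asa Vgrp).
Qed.

(** Vector integrals in H_- reduce to integrals in H. *)
Lemma vint_neg_iso a b (u : R -> H) : (exists I : H, forall h, dot I h = cint a b (fun t => dot (u t) h)) ->
  vint a b (fun t => neg_iso (u t)) = neg_iso (vint a b u).
Proof.
have uniq (K : hilbert R) (I J : K) : (forall k : K, dot I k = dot J k) -> I = J.
  by move=> IJ; apply: dR_ext => h; rewrite /dR IJ.
move=> [I hI].
have hv : forall h, dot (vint a b u) h = cint a b (fun t => dot (u t) h).
  by rewrite /vint; case: xgetP => [? _ //|/(_ I)]; case.
rewrite {1}/vint; case: xgetP => [J _ hJ|].
  apply: uniq => y; rewrite hJ; have [k <-] := neg_iso_surj y.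
  rewrite neg_iso_dot hv; congr (cint a b _); apply/funext => t.
  by rewrite neg_iso_dot.
move=> /(_ (neg_iso (vint a b u))); case=> y; have [k <-] := neg_iso_surj y.
rewrite neg_iso_dot hv; congr (cint a b _); apply/funext => t.
by rewrite neg_iso_dot.
Qed.

End NegativeSpaceModel.

(** * Integrals over an interval *)

Section RealIntegral.
Context {R : realType}.
Let mu := @lebesgue_measure R.
Implicit Types (f g : R -> R) (a b s t r : R).

Definition rint s t f : R := \int[mu]_(x in `]s, t[) f x.
Definition rintg s t f : Prop := mu.-integrable `]s, t[ (EFin \o f).

Lemma rintg_meas s t f : rintg s t f -> measurable_fun `]s, t[ f.
Proof. by move/integrableP => [/measurable_EFinP]. Qed.

Lemma rintgS a b s t f : a <= s -> t <= b -> rintg a b f -> rintg s t f.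
Proof.
move=> as_ tb; apply: integrableS => //.
by apply: subset_itv; rewrite bnd_simp.
Qed.

Lemma rintgD s t f g : rintg s t f -> rintg s t g -> rintg s t (fun x => f x + g x).
Proof. by move=> hf hg; apply: (integrableD _ hf hg). Qed.

Lemma rintgZ s t c f : rintg s t f -> rintg s t (fun x => c * f x).
Proof. by move=> hf; apply: (integrableZl _ c hf). Qed.

Lemma rintgN s t f : rintg s t f -> rintg s t (fun x => - f x).
Proof. by move=> hf; apply: (integrableN hf). Qed.

Lemma rintgB s t f g : rintg s t f -> rintg s t g -> rintg s t (fun x => f x - g x).
Proof. by move=> hf hg; apply: rintgD => //; exact: rintgN. Qed.

Lemma rintg_cst s t c : rintg s t (fun=> c).
Proof.
apply: measurable_bounded_integrable => //.
- rewrite /= lebesgue_measure_itv /=; case: ifP => // _.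
  by rewrite -EFinB ltry.
- exists (`|c|); split; first exact: num_real.
  by move=> x cx y _ /=; exact: ltW.
Qed.

Lemma le_rintg s t f g : measurable_fun `]s, t[ f -> rintg s t g ->
  (forall x, s < x < t -> `|f x| <= g x) -> rintg s t f.
Proof.
move=> mf ig fg; apply: (le_integrable _ _ _ ig) => //.
  exact/measurable_EFinP.
move=> x /=; rewrite in_itv /= => /fg h.
by rewrite lee_fin (le_trans h)// ler_norm.
Qed.

Lemma rintg_norm s t f : rintg s t f -> rintg s t (fun x => `|f x|).
Proof. by move=> hf; exact: integrable_norm. Qed.

Lemma eq_rint s t f g : (forall x, s < x < t -> f x = g x) -> rint s t f = rint s t g.
Proof.
move=> fg; apply: eq_Rintegral => x; rewrite inE /= in_itv /=; exact: fg.
Qed.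

Lemma eq_rintg s t f g : (forall x, s < x < t -> f x = g x) -> rintg s t f -> rintg s t g.
Proof.
move=> fg; apply: eq_integrable => // x.
by rewrite inE /= in_itv /= => /fg ->.
Qed.

Lemma rintD s t f g : rintg s t f -> rintg s t g ->
  rint s t (fun x => f x + g x) = rint s t f + rint s t g.
Proof. by move=> hf hg; exact: RintegralD. Qed.

Lemma rintB s t f g : rintg s t f -> rintg s t g ->
  rint s t (fun x => f x - g x) = rint s t f - rint s t g.
Proof. by move=> hf hg; exact: RintegralB. Qed.

Lemma rintZ s t c f : rintg s t f -> rint s t (fun x => c * f x) = c * rint s t f.
Proof. by move=> hf; exact: RintegralZl. Qed.

Lemma rint_cst s t c : s <= t -> rint s t (fun=> c) = c * (t - s).
Proof.
move=> st; rewrite /rint Rintegral_cst//; congr (_ * _).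
transitivity (fine (if (s < t)%R then (t - s)%:E else 0%E)).
  have := @lebesgue_measure_itv R `]s, t[; rewrite /= lte_fin -EFinB => e.
  by congr fine; exact: e.
by case: ltgtP st => // -> _; rewrite subrr.
Qed.

Lemma rint0 s t : rint s t (fun=> 0) = 0.
Proof. by rewrite /rint Rintegral_cst// mul0r. Qed.

Lemma rint_ge0 s t f : (forall x, s < x < t -> 0 <= f x) -> 0 <= rint s t f.
Proof. by move=> f0; apply: Rintegral_ge0 => x; rewrite /= in_itv /= => /f0. Qed.

Lemma le_rint s t f g : rintg s t f -> rintg s t g ->
  (forall x, s < x < t -> f x <= g x) -> rint s t f <= rint s t g.
Proof.
by move=> hf hg fg; apply: le_Rintegral => // x; rewrite /= in_itv /= => /fg.
Qed.

Lemma rint_norm_le s t f : rintg s t f -> `|rint s t f| <= rint s t (fun x => `|f x|).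
Proof. by move=> hf; exact: le_normr_Rintegral. Qed.

Lemma rint_norm_bound s t f g : rintg s t f -> rintg s t g ->
  (forall x, s < x < t -> `|f x| <= g x) -> `|rint s t f| <= rint s t g.
Proof.
move=> hf hg fg; apply: le_trans (rint_norm_le hf) _.
by apply: le_rint => //; exact: rintg_norm.
Qed.

Lemma rint_empty s t f : t <= s -> rint s t f = 0.
Proof. by move=> ts; rewrite /rint set_itv_ge ?Rintegral_set0// bnd_simp -leNgt. Qed.

Lemma rintg_cc s t f : rintg s t f <-> mu.-integrable `[s, t] (EFin \o f).
Proof.
split=> [hf|]; last by apply: integrableS => //; exact: subset_itv_oo_cc.
have mf := rintg_meas hf; have mc : measurable_fun `[s, t] f.
  exact/measurable_fun_itv_obnd_cbndP/measurable_fun_itv_bndo_bndcP.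
apply/integrableP; split; first exact/measurable_EFinP.
move/integrableP : hf => [_].
rewrite integral_itv_obnd_cbnd; last first.
  by apply: measurableT_comp => //; exact/measurable_EFinP.
rewrite integral_itv_bndo_bndc//.
apply: measurableT_comp => //; apply/measurable_EFinP.
exact/measurable_fun_itv_obnd_cbndP.
Qed.

Lemma rint_cc s t f : rintg s t f -> rint s t f = \int[mu]_(x in `[s, t]) f x.
Proof.
move=> hf; rewrite /rint Rintegral_itv_obnd_cbnd// Rintegral_itv_bndo_bndc//.
apply: integrableS (iffLR (rintg_cc _ _ _) hf) => //.
by apply: subset_itv; rewrite bnd_simp.
Qed.

Lemma rint_chasles s r t f : s <= r -> r <= t -> rintg s t f ->
  rint s t f = rint s r f + rint r t f.
Proof.
move=> sr rt hf.
have [->|sr'] := eqVneq s r; first by rewrite (@rint_empty r r)// add0r.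
have [e|rt'] := eqVneq r t; first by rewrite -e (@rint_empty r r)// addr0.
have {}sr : s < r by rewrite lt_neqAle sr' sr.
have {}rt : r < t by rewrite lt_neqAle rt' rt.
have := @Rintegral_itvB R f (BRight s) (BLeft t) r hf.
rewrite !bnd_simp => /(_ (ltW sr) rt) h.
rewrite /rint -h (@Rintegral_itv_bndo_bndc _ (BRight s) r).
  by rewrite addrCA subrr addr0.
exact: (rintgS (lexx s) (ltW rt) hf).
Qed.

Lemma rint_continuous a b f : a <= b -> rintg a b f ->
  {within `[a, b], continuous (fun t => rint a t f)}.
Proof.
move=> ab hf.
have := parameterized_integral_continuous ab (iffLR (rintg_cc _ _ _) hf).
apply: subspace_eq_continuous => t; rewrite inE /= in_itv /= => /andP[at_ tb].
by apply: esym; exact: rint_cc (rintgS (lexx a) tb hf).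
Qed.

Lemma rint_FTC s t (F f : R -> R) : s <= t -> (forall x : R, is_derive x 1 F (f x)) ->
  continuous f -> rint s t f = F t - F s.
Proof.
move=> st dF cf; have [<-|st'] := eqVneq s t; first by rewrite rint_empty// subrr.
have {}st : s < t by rewrite lt_neqAle st' st.
have hf : mu.-integrable `[s, t] (EFin \o f).
  apply: continuous_compact_integrable; first exact: segment_compact.
  exact: continuous_subspaceT.
rewrite rint_cc; last by apply: integrableS hf => //; exact: subset_itv_oo_cc.
rewrite /Rintegral (@continuous_FTC2 _ f F)//.
- exact: continuous_subspaceT.
- have cF : continuous F by move=> x; apply: differentiable_continuous; exact/derivable1_diffP.
  by split=> [x _| |] //; [exact: cvg_at_right_filter (cF s)|exact: cvg_at_left_filter (cF t)].
- by move=> x _; rewrite derive1E derive_val.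
Qed.

Lemma ae_eq_rint s t f g : measurable_fun `]s, t[ f -> measurable_fun `]s, t[ g ->
  {ae mu, forall x, x \in `]s, t[ -> f x = g x} -> rint s t f = rint s t g.
Proof.
move=> mf mg fg; congr fine; apply: ae_eq_integral => //.
- exact/measurable_EFinP.
- exact/measurable_EFinP.
- apply: filterS fg; first exact: (ae_filter_ringOfSetsType mu).
  by move=> x h /= xst; rewrite h.
Qed.

(** A function whose increments are dominated by the square of those of a
    continuous monotone function is constant: halving the increment of Gam, by
    the intermediate value theorem, halves the bound each time. *)
Lemma square_increment_const (Phi Gam : R -> R) a b : a <= b ->
  {within `[a, b], continuous Gam} ->
  (forall s t, a <= s -> s <= t -> t <= b -> Gam s <= Gam t) ->
  (forall s t, a <= s -> s <= t -> t <= b -> `|Phi t - Phi s| <= (Gam t - Gam s) ^+ 2) ->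
  Phi b = Phi a.
Proof.
move=> ab cG mG PG.
have step n : forall s t, a <= s -> s <= t -> t <= b ->
    `|Phi t - Phi s| <= (Gam t - Gam s) ^+ 2 / 2 ^+ n.
  elim: n => [|n IH] s t as_ st tb; first by rewrite expr0 divr1; exact: PG.
  have [||c] := @IVT R Gam s t ((Gam s + Gam t) / 2) st.
  - by apply: continuous_subspaceW cG; apply: subset_itv; rewrite bnd_simp.
  - have := mG _ _ as_ st tb => g; rewrite min_l// max_r//; apply/andP; split; lra.
  rewrite in_itv /= => /andP[sc ct] Gc.
  have h1 := IH s c as_ sc (le_trans ct tb).
  have h2 := IH c t (le_trans as_ sc) ct tb.
  have -> : Phi t - Phi s = (Phi t - Phi c) + (Phi c - Phi s) by ring.
  apply: (le_trans (ler_normD _ _)); apply: (le_trans (lerD h2 h1)).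
  have p0 : (2 : R) ^+ n != 0 by rewrite expf_eq0 /= pnatr_eq0 andbF.
  rewrite Gc [2 ^+ n.+1]exprS le_eqVlt; apply/orP; left; apply/eqP.
  by move: (2 ^+ n) p0 => p p0; field.
apply/eqP; rewrite -subr_eq0 -normr_le0; apply/ler_addgt0Pl => e e0; rewrite ?addr0.
have [n hn] : exists n : nat, (Gam b - Gam a) ^+ 2 / e < 2 ^+ n.
  exists (Num.truncn ((Gam b - Gam a) ^+ 2 / e)).+1.
  apply: (@lt_trans _ _ (Num.truncn ((Gam b - Gam a) ^+ 2 / e)).+1%:R).
    exact: truncnS_gt.
  by rewrite -natrX ltr_nat ltn_expl.
apply: le_trans (step n a b _ ab _) _ => //.
have p0 : 0 < (2 : R) ^+ n by rewrite exprn_gt0.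
by rewrite ler_pdivrMr// mulrC -ler_pdivrMr// ltW.
Qed.

End RealIntegral.

(** * Weak integrals and primitives of vector functions *)

Section VectorMeasurability.
Context {R : realType} (H : hilbert R).
Hypothesis H_separable : separable H.
Implicit Types (u v F G : R -> H) (s t a b r : R) (h : H).

Lemma dense_sequence : exists e : nat -> H,
  forall (x : H) (eps : R), 0 < eps -> exists n, nr (x - e n) < eps.
Proof.
case: H_separable => S [cS dS].
have dS' (x : H) (eps : R) : 0 < eps -> exists2 h, S h & nr (x - h) < eps.
  move=> e0; have e0' : (0 : R[i]) < eps%:C by rewrite ltcR.
  have [] := dS (ball x eps%:C).
  - by exists x; exact: ballxx.
  - exact: ball_open.
  by move=> h [+ Sh]; rewrite -ball_normE /= nrE ltcR => ?; exists h.
have [h0 Sh0 _] := dS' 0 1 ltr01.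
have /pfcard_geP[S0|[f]] := cS; first by rewrite S0 in Sh0.
exists f => x eps /(dS' x)[h Sh hx].
have [n _ fn] : (f @` setT) h by apply: (@surj _ _ _ _ f).
by exists n; rewrite fn.
Qed.

(** The imaginary part of (u, h) is the real part of (u, ih), so real parts suffice. *)
Definition wmeas s t u : Prop := forall h, measurable_fun `]s, t[ (fun x : R => dR (u x) h).

Lemma wmeasS a b s t u : a <= s -> t <= b -> wmeas a b u -> wmeas s t u.
Proof.
move=> as_ tb mu_ h; apply: measurable_funS (mu_ h) => //.
by apply: subset_itv; rewrite bnd_simp.
Qed.

Lemma eq_wmeas s t u v : (forall x, s < x < t -> u x = v x) -> wmeas s t u -> wmeas s t v.
Proof.
move=> uv mu_ h; apply: eq_measurable_fun (mu_ h) => x.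
by rewrite inE /= in_itv /= => /uv ->.
Qed.

Lemma wmeasD s t u v : wmeas s t u -> wmeas s t v -> wmeas s t (fun x : R => u x + v x).
Proof.
move=> mu_ mv h; apply: (eq_measurable_fun (fun x : R => dR (u x) h + dR (v x) h)).
  by move=> x _; rewrite dRDl.
exact: measurable_funD.
Qed.

Lemma wmeas_adj (K : hilbert R) s t u (T : H -> K) (T' : K -> H) :
  (forall x k, dR (T x) k = dR x (T' k)) -> wmeas s t u ->
  forall k, measurable_fun `]s, t[ (fun x : R => dR (T (u x)) k).
Proof.
move=> TT' mu_ h; apply: eq_measurable_fun (mu_ (T' h)) => x _.
by rewrite TT'.
Qed.

Lemma wmeasZ s t (c : R[i]) u : wmeas s t u -> wmeas s t (fun x : R => c *: u x).
Proof. by move=> mu_ h; apply: (wmeas_adj (dRcl c) mu_). Qed.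

Lemma wmeasN s t u : wmeas s t u -> wmeas s t (fun x : R => - u x).
Proof.
move=> /(wmeasZ (-1 : R)%:C); apply: eq_wmeas => x _.
by rewrite -oppE.
Qed.

Lemma wmeasB s t u v : wmeas s t u -> wmeas s t v -> wmeas s t (fun x : R => u x - v x).
Proof. by move=> mu_ mv; apply: wmeasD => //; exact: wmeasN. Qed.

(** This is where separability enters: |x| > c as soon as (x, e) > c |e| for some e
    of a countable dense set. *)
Lemma wmeas_nr s t u : wmeas s t u -> measurable_fun `]s, t[ (fun x : R => nr (u x)).
Proof.
move=> mu_; have [e eP] := dense_sequence.
move=> mD; apply: (measurability _ (RGenOInfty.measurableE R)) => //.
move=> _ [_ [c ->] <-].
have [c0|c0] := ltP c 0.
  rewrite (_ : _ `&` _ = `]s, t[%classic)//.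
  by apply/seteqP; split=> [x []//|x sx]; split => //=;
    rewrite in_itv /= andbT (lt_le_trans c0)// nr_ge0.
rewrite (_ : _ `&` _ = \bigcup_n (`]s, t[ `&`
    (fun x : R => dR (u x) (e n)) @^-1` `]c * nr (e n), +oo[)); last first.
  apply/seteqP; split=> [x [sx /=]|x [n _ [sx /=]]].
    rewrite in_itv /= andbT => cu.
    pose d := nr (u x) - c.
    have d0 : 0 < d by rewrite subr_gt0.
    have p0 : 0 < 1 + c + nr (u x) by rewrite -addrA ltr_pwDl// addr_ge0// nr_ge0.
    have [n hn] := eP (u x) (d * nr (u x) / (1 + c + nr (u x)))
       ltac:(by rewrite divr_gt0// mulr_gt0// (le_lt_trans c0)).
    exists n => //; split => //=; rewrite in_itv /= andbT.
    have h1 : nr (u x) ^+ 2 - nr (u x) * nr (u x - e n) <= dR (u x) (e n).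
      by have := dR_le (u x) (u x - e n); rewrite dRBr dRxx; lra.
    have h2 : nr (e n) <= nr (u x) + nr (u x - e n).
      by rewrite nr_distC; have := ler_nrD (e n - u x) (u x); rewrite subrK; lra.
    move: hn; rewrite ltr_pdivlMr//; move: h1 h2 c0 cu; rewrite /d.
    move: (nr (u x)) (nr (u x - e n)) (nr (e n)) (dR _ _) (nr_ge0 (u x - e n)).
    by move=> p q w z q0 h1 h2 c0 cu h; nra.
  rewrite in_itv /= andbT => h; split; first exact: sx.
  rewrite /= in_itv /= andbT ltNge; apply/negP => uc.
  have := le_lt_trans (ler_wpM2r (nr_ge0 (e n)) uc) h.
  by rewrite ltNge dR_le.
by apply: bigcup_measurable => n _; apply: mu_ => //; exact: measurable_itv.
Qed.

(** Polarization. *)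
Lemma wmeas_dR s t u v : wmeas s t u -> wmeas s t v ->
  measurable_fun `]s, t[ (fun x : R => dR (u x) (v x)).
Proof.
move=> mu_ mv.
apply: (eq_measurable_fun (fun x : R => 4^-1 * (nr (u x + v x) ^+ 2 - nr (u x - v x) ^+ 2))).
  by move=> x _; rewrite nr_sqrD nr_sqrB; field.
apply: measurable_funM => //; apply: measurable_funB; apply: measurable_funX;
  apply: wmeas_nr; [exact: wmeasD|exact: wmeasB].
Qed.

Lemma wmeas_scale s t (c : R -> R[i]) u :
  measurable_fun `]s, t[ (fun x : R => complex.Re (c x)) ->
  measurable_fun `]s, t[ (fun x : R => complex.Im (c x)) ->
  wmeas s t u -> wmeas s t (fun x : R => c x *: u x).
Proof.
move=> mc1 mc2 mu_ h.
apply: (eq_measurable_fun (fun x : R => complex.Re (c x) * dR (u x) h -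
    complex.Im (c x) * dR (u x) ('i%C *: h))).
  move=> x _; rewrite {3}/dR dotZl dotE.
  by case: (c x) => p q /=.
by apply: measurable_funB; apply: measurable_funM.
Qed.

Definition vL1 s t u : Prop := wmeas s t u /\ rintg s t (fun x : R => nr (u x)).

Lemma vL1S a b s t u : a <= s -> t <= b -> vL1 a b u -> vL1 s t u.
Proof. by move=> as_ tb [mu_ iu]; split; [exact: wmeasS mu_|exact: rintgS iu]. Qed.

Lemma eq_vL1 s t u v : (forall x, s < x < t -> u x = v x) -> vL1 s t u -> vL1 s t v.
Proof.
move=> uv [mu_ iu]; split; first exact: eq_wmeas mu_.
by apply: eq_rintg iu => x /uv ->.
Qed.

Lemma vL1_le s t u g : wmeas s t u -> rintg s t g ->
  (forall x, s < x < t -> nr (u x) <= g x) -> vL1 s t u.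
Proof.
move=> mu_ ig ug; split => //; apply: le_rintg ig _; first exact: wmeas_nr.
by move=> x sx; rewrite ger0_norm ?nr_ge0// ug.
Qed.

Lemma vL1D s t u v : vL1 s t u -> vL1 s t v -> vL1 s t (fun x : R => u x + v x).
Proof.
move=> [mu_ iu] [mv iv]; apply: (vL1_le (wmeasD mu_ mv) (rintgD iu iv)).
by move=> x _; exact: ler_nrD.
Qed.

Lemma vL1Z s t (c : R[i]) u : vL1 s t u -> vL1 s t (fun x : R => c *: u x).
Proof.
move=> [mu_ iu]; apply: (vL1_le (wmeasZ c mu_) (rintgZ (nr c) iu)).
by move=> x _; rewrite nrZ.
Qed.

Lemma vL1N s t u : vL1 s t u -> vL1 s t (fun x : R => - u x).
Proof. by move=> /(vL1Z (-1 : R)%:C); apply: eq_vL1 => x _; rewrite -oppE. Qed.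

Lemma vL1B s t u v : vL1 s t u -> vL1 s t v -> vL1 s t (fun x : R => u x - v x).
Proof. by move=> hu hv; apply: vL1D => //; exact: vL1N. Qed.

Lemma vL1_dR_bounded s t u v M : vL1 s t u -> wmeas s t v ->
  (forall x, s < x < t -> nr (v x) <= M) -> rintg s t (fun x : R => dR (u x) (v x)).
Proof.
move=> [mu_ iu] mv vM; apply: (le_rintg (wmeas_dR mu_ mv) (rintgZ M iu)).
move=> x sx; rewrite mulrC (le_trans (dR_norm_le _ _))//.
by rewrite ler_wpM2l ?nr_ge0 ?vM.
Qed.

Lemma wmeas_cst s t h : wmeas s t (fun=> h).
Proof. by move=> k; exact: measurable_cst. Qed.

Lemma vL1_dR s t u h : vL1 s t u -> rintg s t (fun x : R => dR (u x) h).
Proof. move=> hu; have h1 := @vL1_dR_bounded s t u (fun=> h) (nr h) hu (wmeas_cst h).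
exact: h1. Qed.

(** The Riesz representation of h |-> int (u, h). *)
Lemma vint_ex s t u : vL1 s t u -> exists I : H,
  forall h, dR I h = rint s t (fun x : R => dR (u x) h).
Proof.
move=> hu.
have [|||I hI] := @riesz R H (fun h => rint s t (fun x : R => dR (u x) h)) (rint s t (fun x : R => nr (u x))).
- move=> x y; rewrite -rintD; [|exact: vL1_dR|exact: vL1_dR].
  by apply: eq_rint => z _; rewrite dRDr.
- move=> r x; rewrite -rintZ; last exact: vL1_dR.
  by apply: eq_rint => z _; rewrite dRZr.
- move=> x; rewrite mulrC -rintZ; last by case: hu.
  apply: rint_norm_bound; [exact: vL1_dR|exact: rintgZ (proj2 hu)|].
  by move=> y _; rewrite mulrC dR_norm_le.
by exists I => h; rewrite hI.
Qed.

Lemma cint_dot s t u v : cint s t (fun x => dot (u x) (v x)) =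
  rint s t (fun x : R => dR (u x) (v x)) +i* rint s t (fun x : R => dR (u x) ('i%C *: v x)).
Proof.
rewrite /cint; congr (_ +i* _).
by apply: eq_rint => x _; rewrite dotE.
Qed.

Lemma vintP s t u h : vL1 s t u -> dR (vint s t u) h = rint s t (fun x : R => dR (u x) h).
Proof.
move=> hu; rewrite /vint; case: xgetP => [I _ hI|].
  by rewrite /dR hI cint_dot.
have [I hI] := vint_ex hu; move=> /(_ I); case=> h1.
by rewrite cint_dot dotE !hI.
Qed.

Lemma vint_uniq s t u I : vL1 s t u ->
  (forall h, dR I h = rint s t (fun x : R => dR (u x) h)) -> vint s t u = I.
Proof. by move=> hu hI; apply: dR_ext => h; rewrite vintP. Qed.

(** Pair the integral with itself. *)
Lemma nr_vint_le s t u : vL1 s t u -> nr (vint s t u) <= rint s t (fun x : R => nr (u x)).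
Proof.
move=> hu; have [->|n0] := eqVneq (vint s t u) 0.
  by rewrite nr0 rint_ge0// => x _; rewrite nr_ge0.
have p0 : 0 < nr (vint s t u) by rewrite nr_gt0.
rewrite -(ler_pM2l p0) -expr2 -dRxx vintP//.
rewrite -rintZ; last by case: hu.
apply: le_rint; [exact: vL1_dR|exact: rintgZ (proj2 hu)|].
by move=> x _; rewrite mulrC dR_le.
Qed.

(** The increments of a primitive are tested against fixed vectors: weak integrals
    suffice, as norms are measurable by [wmeas_nr]. *)
Definition is_prim a b (w F : R -> H) : Prop := vL1 a b F /\
  forall s t, a <= s -> s <= t -> t <= b ->
    forall h, dR (w t - w s) h = rint s t (fun x : R => dR (F x) h).

Lemma is_primS a b c d w F : a <= c -> d <= b -> is_prim a b w F -> is_prim c d w F.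
Proof.
move=> ac db [hF hw]; split; first exact: vL1S hF.
by move=> s t cs st td; apply: hw => //; [exact: le_trans cs|exact: le_trans db].
Qed.

Lemma vint_prim a b x0 F : vL1 a b F -> is_prim a b (fun t => x0 + vint a t F) F.
Proof.
move=> hF; split => // s t as_ st tb h.
rewrite opprD addrACA subrr add0r dRBl !vintP; last 2 first.
- by apply: vL1S hF => //; exact: le_trans tb.
- exact: vL1S hF.
rewrite (@rint_chasles _ a s t)//; first by rewrite addrAC subrr add0r.
by apply: rintgS (vL1_dR h hF).
Qed.

Lemma eq_prim a b w w' F F' : (forall t, a <= t <= b -> w t = w' t) ->
  (forall t, a < t < b -> F t = F' t) -> is_prim a b w F -> is_prim a b w' F'.
Proof.
move=> ww FF [hF hw]; split; first exact: eq_vL1 hF.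
move=> s t as_ st tb h; rewrite -!ww ?hw//; last 2 first.
- by rewrite as_ (le_trans st).
- by rewrite tb (le_trans as_).
apply: eq_rint => x /andP[sx xt]; rewrite FF//.
by rewrite (le_lt_trans as_ sx) (lt_le_trans xt tb).
Qed.

Lemma primZ a b (c : R[i]) w F : is_prim a b w F ->
  is_prim a b (fun t => c *: w t) (fun t => c *: F t).
Proof.
move=> [hF hw]; split; first exact: vL1Z.
move=> s t as_ st tb h; rewrite -scalerBr dRcl hw//.
by apply: eq_rint => x _; rewrite dRcl.
Qed.

Lemma primD a b w w' F F' : is_prim a b w F -> is_prim a b w' F' ->
  is_prim a b (fun t => w t + w' t) (fun t => F t + F' t).
Proof.
move=> [hF hw] [hF' hw']; split; first exact: vL1D.
move=> s t as_ st tb h; rewrite opprD addrACA dRDl hw// hw'// -rintD.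
- by apply: eq_rint => x _; rewrite dRDl.
- by apply: vL1_dR; exact: vL1S hF.
- by apply: vL1_dR; exact: vL1S hF'.
Qed.

Section Primitive.
Variables (a b : R) (w F : R -> H).
Hypothesis wF : is_prim a b w F.

Lemma nr_prim_le s t : a <= s -> s <= t -> t <= b ->
  nr (w t - w s) <= rint s t (fun x : R => nr (F x)).
Proof.
move=> as_ st tb; have hF : vL1 s t F by apply: vL1S wF.1.
have <- : vint s t F = w t - w s.
  by apply: vint_uniq => // h; rewrite wF.2.
exact: nr_vint_le.
Qed.

Lemma rint_nr_incr s t : a <= s -> s <= t -> t <= b ->
  rint a t (fun x : R => nr (F x)) - rint a s (fun x : R => nr (F x)) =
  rint s t (fun x : R => nr (F x)).
Proof.
move=> as_ st tb; rewrite (@rint_chasles _ a s t)//; first by rewrite addrAC subrr add0r.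
by apply: rintgS (proj2 wF.1).
Qed.

Lemma prim_weak_continuous h : a <= b -> {within `[a, b], continuous (fun t => dR (w t) h)}.
Proof.
move=> ab.
have := rint_continuous ab (vL1_dR h wF.1).
move=> hc; apply: (@subspace_eq_continuous _ _ _
   (fun t => dR (w a) h + rint a t (fun x : R => dR (F x) h))).
  move=> t; rewrite inE /= in_itv /= => /andP[at_ tb].
  have := wF.2 _ _ (lexx a) at_ tb h; rewrite /from_subspace dRBl => <-.
  by rewrite addrC subrK.
by move=> t; apply: cvgD; [exact: cvg_cst|exact: hc].
Qed.

Lemma prim_wmeas : a <= b -> wmeas a b w.
Proof.
move=> ab h.
have : measurable_fun `[a, b] (fun t => dR (w t) h).
  by apply: subspace_continuous_measurable_fun => //; exact: prim_weak_continuous.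
by apply: measurable_funS => //; exact: subset_itv_oo_cc.
Qed.

Lemma prim_bounded t : a <= t -> t <= b ->
  nr (w t) <= nr (w a) + rint a b (fun x : R => nr (F x)).
Proof.
move=> at_ tb; have := nr_prim_le (lexx a) at_ tb.
have : rint a t (fun x : R => nr (F x)) <= rint a b (fun x : R => nr (F x)).
  rewrite (@rint_chasles _ a t b)//; last by case: wF => -[].
  by rewrite lerDl rint_ge0// => x _; exact: nr_ge0.
by have := ler_nrD (w t - w a) (w a); rewrite subrK; lra.
Qed.

End Primitive.

(** Integration by parts for absolutely continuous vector functions. The defect
    over [s, t] pairs the increments of w and y with F and G, hence is at most
    the square of the integral of |F| + |G| over [s, t]. *)
Lemma prim_by_parts a b w y F G : a <= b -> is_prim a b w F -> is_prim a b y G ->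
  rintg a b (fun x : R => dR (F x) (y x) + dR (w x) (G x)) /\
  dR (w b) (y b) - dR (w a) (y a) = rint a b (fun x : R => dR (F x) (y x) + dR (w x) (G x)).
Proof.
move=> ab wF yG.
have mw := prim_wmeas wF ab; have my := prim_wmeas yG ab.
pose Mw := nr (w a) + rint a b (fun x : R => nr (F x)).
pose My := nr (y a) + rint a b (fun x : R => nr (G x)).
have bw x : a < x < b -> nr (w x) <= Mw.
  by move=> /andP[/ltW ax /ltW xb]; apply: prim_bounded.
have by_ x : a < x < b -> nr (y x) <= My.
  by move=> /andP[/ltW ax /ltW xb]; apply: prim_bounded.
have i1 : rintg a b (fun x : R => dR (F x) (y x)) by apply: vL1_dR_bounded wF.1 my by_.
have i2 : rintg a b (fun x : R => dR (w x) (G x)).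
  by apply: eq_rintg (vL1_dR_bounded yG.1 mw bw) => x _; rewrite dRC.
have i12 := rintgD i1 i2; split => //.
pose Phi t := dR (w t) (y t) - rint a t (fun x : R => dR (F x) (y x) + dR (w x) (G x)).
pose Gam t := rint a t (fun x : R => nr (F x)) + rint a t (fun x : R => nr (G x)).
suff : Phi b = Phi a.
  rewrite /Phi (@rint_empty _ a a)// subr0 => /eqP; rewrite subr_eq => /eqP ->.
  by rewrite addrC addKr.
have GamE s t : a <= s -> s <= t -> t <= b ->
    Gam t - Gam s = rint s t (fun x : R => nr (F x)) + rint s t (fun x : R => nr (G x)).
  move=> as_ st tb; rewrite /Gam -(rint_nr_incr wF as_ st tb) -(rint_nr_incr yG as_ st tb).
  by rewrite opprD addrACA.
have Gmono s t : a <= s -> s <= t -> t <= b -> Gam s <= Gam t.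
  move=> as_ st tb; rewrite -subr_ge0 GamE// addr_ge0// rint_ge0// => x _; exact: nr_ge0.
apply: (@square_increment_const _ Phi Gam a b ab) => //.
  move=> t; apply: cvgD; apply: rint_continuous => //; [exact: (proj2 wF.1)|exact: (proj2 yG.1)].
move=> s t as_ st tb.
have sb := le_trans st tb; have at_ := le_trans as_ st.
have hF : vL1 s t F by apply: vL1S wF.1.
have hG : vL1 s t G by apply: vL1S yG.1.
have inc : rint a t (fun x : R => dR (F x) (y x) + dR (w x) (G x)) =
    rint a s (fun x : R => dR (F x) (y x) + dR (w x) (G x)) +
    rint s t (fun x : R => dR (F x) (y x) + dR (w x) (G x)).
  by apply: rint_chasles => //; apply: rintgS i12.
have e1 : rint s t (fun x : R => dR (F x) (y t)) = dR (w t - w s) (y t).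
  by rewrite wF.2.
have e2 : rint s t (fun x : R => dR (w s) (G x)) = dR (w s) (y t - y s).
  by rewrite dRC yG.2//; apply: eq_rint => x _; rewrite dRC.
have j1 : rintg s t (fun x : R => dR (F x) (y t)) by exact: vL1_dR.
have j2 : rintg s t (fun x : R => dR (w s) (G x)).
  by apply: eq_rintg (vL1_dR (w s) hG) => x _; rewrite dRC.
have j12 : rintg s t (fun x : R => dR (F x) (y x) + dR (w x) (G x)) by apply: rintgS i12.
have -> : Phi t - Phi s = rint s t (fun x => (dR (F x) (y t) + dR (w s) (G x)) -
    (dR (F x) (y x) + dR (w x) (G x))).
  rewrite rintB//; last exact: rintgD.
  rewrite rintD// e1 e2 /Phi inc dRBl dRBr; ring.
pose d := Gam t - Gam s.
have k12 : rintg s t (fun x => d * (nr (F x) + nr (G x))).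
  by apply: rintgZ; apply: rintgD; [exact: (proj2 hF)|exact: (proj2 hG)].
have -> : (Gam t - Gam s) ^+ 2 = rint s t (fun x => d * (nr (F x) + nr (G x))).
  rewrite rintZ; last by apply: rintgD; [exact: (proj2 hF)|exact: (proj2 hG)].
  rewrite rintD; [|exact: (proj2 hF)|exact: (proj2 hG)].
  by rewrite -GamE.
apply: rint_norm_bound => //; first by apply: rintgB => //; exact: rintgD.
move=> x /andP[sx xt].
have ax : a <= x by rewrite (le_trans as_)// ltW.
have xb : x <= b by rewrite (le_trans _ tb)// ltW.
have -> : dR (F x) (y t) + dR (w s) (G x) - (dR (F x) (y x) + dR (w x) (G x)) =
    dR (F x) (y t - y x) - dR (w x - w s) (G x) by rewrite dRBl dRBr; ring.
have q1 : nr (y t - y x) <= d.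
  apply: le_trans (nr_prim_le yG ax (ltW xt) tb) _.
  have := GamE x t ax (ltW xt) tb; have := Gmono s x as_ (ltW sx) xb.
  have : 0 <= rint x t (fun x : R => nr (F x)) by rewrite rint_ge0// => z _; exact: nr_ge0.
  rewrite /d; lra.
have q2 : nr (w x - w s) <= d.
  apply: le_trans (nr_prim_le wF as_ (ltW sx) xb) _.
  have := GamE s x as_ (ltW sx) xb; have := Gmono x t ax (ltW xt) tb.
  have : 0 <= rint s x (fun x : R => nr (G x)) by rewrite rint_ge0// => z _; exact: nr_ge0.
  rewrite /d; lra.
apply: le_trans (ler_normB _ _) _; rewrite mulrDr; apply: lerD.
  by rewrite mulrC (le_trans (dR_norm_le _ _))// ler_wpM2l ?nr_ge0.
by rewrite (le_trans (dR_norm_le _ _))// ler_wpM2r ?nr_ge0.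
Qed.

End VectorMeasurability.

(** * Smooth bump functions *)

Section SmoothFunctions.
Context {R : realType}.
Implicit Types (f g : R -> R) (n : nat).

Lemma is_derive_cast f (x d d' : R) : is_derive x 1 f d -> d = d' -> is_derive x 1 f d'.
Proof. by move=> h <-. Qed.

(** Differentiability of order n with the derivatives as witnesses, a form that is
    stable under products and inverses by induction on n. *)
Fixpoint Cn n f : Prop :=
  if n is m.+1 then exists f', (forall x : R, is_derive x 1 f (f' x)) /\ Cn m f' else True.

Definition smooth f := forall n, Cn n f.

Lemma Cn_derive1 n f : Cn n.+1 f -> (forall x, derivable f x 1) /\ Cn n f^`()%classic.
Proof.
move=> [f' [df cf']]; split; first by move=> x; case: (df x).
rewrite (_ : f^`()%classic = f')//.
by apply/funext => x; rewrite derive1E; case: (df x).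
Qed.

Lemma Cn_weak n f : Cn n.+1 f -> Cn n f.
Proof.
elim: n f => [//|n IH] f [f' [df cf']].
by exists f'; split => //; exact: IH.
Qed.

Lemma smooth_derivable f n x : smooth f -> derivable (derive1n n f) x 1.
Proof.
move=> sf; suff : Cn 1 (derive1n n f) by case/Cn_derive1.
elim: n 1%N => [|n IH] m; first exact: sf.
rewrite derive1nS; exact: (Cn_derive1 (IH m.+1)).2.
Qed.

Lemma Cn_cst n (c : R) : Cn n (fun=> c).
Proof.
elim: n c => [//|n IH] c; exists (fun=> 0); split => // x.
exact: is_derive_cst.
Qed.

Lemma Cn_add n f g : Cn n f -> Cn n g -> Cn n (fun x => f x + g x).
Proof.
elim: n f g => [//|n IH] f g [f' [df cf]] [g' [dg cg]].
exists (fun x => f' x + g' x); split => [x|]; last exact: IH.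
exact: is_deriveD.
Qed.

Lemma Cn_mul n f g : Cn n f -> Cn n g -> Cn n (fun x => f x * g x).
Proof.
elim: n f g => [//|n IH] f g cf cg.
have cf0 := Cn_weak cf; have cg0 := Cn_weak cg.
case: cf => f' [df cf]; case: cg => g' [dg cg].
exists (fun x => f x * g' x + g x * f' x); split => [x|].
  exact: is_deriveM.
by apply: Cn_add; apply: IH.
Qed.

Lemma Cn_opp n f : Cn n f -> Cn n (fun x => - f x).
Proof.
move=> cf; rewrite (_ : (fun x => - f x) = (fun x => (-1) * f x)).
  by apply: Cn_mul => //; exact: Cn_cst.
by apply/funext => x; rewrite mulN1r.
Qed.

Lemma Cn_inv n f : (forall x, f x != 0) -> Cn n f -> Cn n (fun x => (f x)^-1).
Proof.
move=> f0; elim: n => [//|n IH] cf.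
have /IH cVf := Cn_weak cf.
case: cf => f' [df cf].
exists (fun x => - ((f x)^-1 * (f x)^-1) * f' x); split => [x|].
  apply: (is_derive_cast (@is_deriveV _ f x (f' x) 1 (f0 x) (df x))); rewrite -[_ *: _]/(_ * _); congr (- _ * _).
  by rewrite -expr2 exprVn.
by apply: Cn_mul => //; apply: Cn_opp; apply: Cn_mul.
Qed.

Lemma Cn_comp_affine n f (p q : R) : Cn n f -> Cn n (fun x => f (p * x + q)).
Proof.
elim: n f => [//|n IH] f [f' [df cf]].
exists (fun x => p * f' (p * x + q)); split => [x|]; last first.
  by apply: Cn_mul; [exact: Cn_cst|exact: IH].
have dg : is_derive x 1 (fun x : R => p * x + q) p.
  have := is_deriveD (is_deriveM (is_derive_cst p x 1) (is_derive_id x 1)) (is_derive_cst q x 1).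
  rewrite (_ : cst p * id + cst q = (fun x : R => p * x + q))// => h.
  by apply: (is_derive_cast h); rewrite scaler0 !addr0 [_ *: _]mulr1.
by apply: (is_derive_cast (@is_derive1_comp _ f (fun x => p * x + q) x _ _ (df _) dg)); rewrite mulrC.
Qed.

(** Each monomial is bounded by a term of the exponential series. *)
Lemma poly_expR_bound (p : {poly R}) : exists2 C : R, 0 <= C &
  forall s, 0 <= s -> `|p.[s]| <= C * expR s.
Proof.
exists (\sum_(i < size p) `|p`_i| * i`!%:R).
  by apply: sumr_ge0 => i _; rewrite mulr_ge0.
move=> s s0; rewrite horner_coef mulr_suml; apply: le_trans (ler_norm_sum _ _ _) _.
apply: ler_sum => i _; rewrite normrM -mulrA ler_wpM2l// ger0_norm ?exprn_ge0//.
case: (i : nat) => [|n]; first by rewrite expr0 fact0 mul1r -expR0 ler_expR.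
have := expR_ge1Dxn n s0 => h.
have h2 : s ^+ n.+1 / n.+1`!%:R <= expR s by rewrite (le_trans _ h)// lerDr.
by move: h2; rewrite ler_pdivrMr ?ltr0n ?fact_gt0// mulrC.
Qed.

(** The functions p(1/x) e^{-1/x}, extended by 0 to x <= 0: a class closed under
    differentiation, whence the smoothness of e^{-1/x}. *)
Definition flat (p : {poly R}) (x : R) : R := if 0 < x then p.[x^-1] * expR (- x^-1) else 0.

Lemma flat_derive (p : {poly R}) (x : R) :
  is_derive x 1 (flat p) (flat ('X^2 * (p - p^`()%R)) x).
Proof.
have [x0|x0|x0] := ltgtP x 0.
- have -> : flat ('X^2 * (p - p^`()%R)) x = 0 by rewrite /flat ltNge (ltW x0).
  apply: (@near_eq_is_derive _ _ _ (fun=> 0)).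
  near=> y; rewrite /flat ltNge.
  suff -> : y <= 0 by [].
  by near: y; exact: lt_le_nbhsl.
- have xn0 : x != 0 by rewrite gt_eqF.
  have nf : \forall y \near x, p.[y^-1] * expR (- y^-1) = flat p y.
    near=> y; rewrite /flat.
    suff -> : 0 < y by [].
    by near: y; exact: lt_nbhsr.
  suff h : is_derive x 1 (fun y : R => p.[y^-1] * expR (- y^-1)) (flat ('X^2 * (p - p^`()%R)) x).
    exact: (near_eq_is_derive nf).
  have dV : is_derive x 1 (fun y : R => y^-1) (- (x^-1 * x^-1)).
    by apply: (is_derive_cast (@is_deriveV _ id x 1 1 xn0 (is_derive_id x 1))); rewrite -[_ *: _]/(_ * _) mulr1 -expr2 exprVn.
  have d1 := @is_derive1_comp _ (horner p) (fun y : R => y^-1) x _ _ (is_derive_poly p _) dV.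
  have d2 := @is_derive1_comp _ expR (fun y : R => - y^-1) x _ _ (is_derive_expR _) (is_deriveN dV).
  apply: (is_derive_cast (is_deriveM d1 d2)).
  rewrite -![_ *: _]/(_ * _) /flat x0 /= hornerM hornerXn hornerD hornerN; ring.
rewrite x0.
have -> : flat ('X^2 * (p - p^`()%R)) 0 = 0 by rewrite /flat ltxx.
have [C C0 hC] := poly_expR_bound (p * 'X^2).
(* The difference quotient at 0 is (p X^2)(1/h) e^{-1/h} h, and the exponential absorbs
   the polynomial p X^2. *)
have bnd (h : R) : `|h^-1 * (flat p h - flat p 0)| <= C * `|h|.
  rewrite {2}/flat ltxx subr0 /flat; case: ifP => h0; last by rewrite mulr0 normr0 mulr_ge0.
  have hn0 : h != 0 by rewrite gt_eqF.
  have := hC h^-1 (ltW _); rewrite invr_gt0 => /(_ h0).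
  rewrite hornerM hornerXn => hb.
  have -> : h^-1 * (p.[h^-1] * expR (- h^-1)) = p.[h^-1] * h^-1 ^+ 2 / expR h^-1 * h.
    by rewrite expRN; field; rewrite hn0 gt_eqF ?expR_gt0.
  rewrite normrM ler_wpM2r// normrM normfV (gtr0_norm (expR_gt0 _)).
  by rewrite ler_pdivrMr ?expR_gt0.
have cv : (fun h : R => h^-1 * (flat p h - flat p 0)) @ (0 : R)^' --> (0 : R).
  have C1 : 0 < C + 1 by rewrite ltr_wpDl.
  apply/cvgr0Pnorm_lt => e e0; near=> h.
  apply: le_lt_trans (bnd h) _.
  apply: (@le_lt_trans _ _ ((C + 1) * `|h|)); first by rewrite ler_wpM2r// lerDl ler01.
  rewrite mulrC -ltr_pdivlMr//; near: h.
  apply: dnbhs0_lt; exact: divr_gt0.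
have e : (fun h : R => h^-1 *: ((flat p \o shift 0) (h *: 1) - flat p 0)) =
    (fun h : R => h^-1 * (flat p h - flat p 0)).
  by apply/funext => h /=; rewrite [h *: 1]mulr1 addr0.
apply: DeriveDef.
  by apply/cvg_ex; exists 0; rewrite e.
by rewrite /derive; apply: cvg_lim; [exact: Rhausdorff|rewrite e].
Unshelve. all: by end_near. Qed.

Lemma flat_smooth p : smooth (flat p).
Proof.
move=> n; elim: n p => [//|n IH] p.
by exists (flat ('X^2 * (p - p^`()%R))); split => // x; exact: flat_derive.
Qed.

(** A smooth step from 0 to 1 on [0, 1]; the denominator never vanishes, since x or
    1 - x is positive. *)
Definition smooth_step (x : R) : R := flat 1 x / (flat 1 x + flat 1 (1 - x)).

Lemma flat1_ge0 x : 0 <= flat 1 x.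
Proof. by rewrite /flat; case: ifP => // _; rewrite hornerC mul1r expR_ge0. Qed.

Lemma flat1_gt0 x : 0 < x -> 0 < flat 1 x.
Proof. by rewrite /flat => ->; rewrite hornerC mul1r expR_gt0. Qed.

Lemma flat_le0 p x : x <= 0 -> flat p x = 0.
Proof. by rewrite /flat leNgt => /negbTE ->. Qed.

Lemma smooth_step_smooth : smooth smooth_step.
Proof.
move=> n; apply: Cn_mul; first exact: flat_smooth.
apply: Cn_inv.
  move=> x; rewrite gt_eqF//; have [x0|x0] := ltP 0 x.
    by rewrite ltr_pwDl ?flat1_gt0 ?flat1_ge0.
  by rewrite ltr_wpDl ?flat1_ge0// flat1_gt0// subr_gt0 (le_lt_trans x0).
apply: Cn_add; first exact: flat_smooth.
rewrite (_ : (fun x => _) = (fun x => flat 1 (-1 * x + 1))).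
  by apply: Cn_comp_affine; exact: flat_smooth.
by apply/funext => x; rewrite mulN1r addrC.
Qed.

Lemma smooth_step0 x : x <= 0 -> smooth_step x = 0.
Proof. by move=> x0; rewrite /smooth_step flat_le0// mul0r. Qed.

Lemma smooth_step1 x : 1 <= x -> smooth_step x = 1.
Proof.
move=> x1; rewrite /smooth_step (@flat_le0 _ (1 - x)) ?subr_le0// addr0 divff//.
by rewrite gt_eqF// flat1_gt0// (lt_le_trans ltr01).
Qed.

Definition smooth_bump : R -> R := smooth_step^`()%classic.

Lemma smooth_bump_smooth : smooth smooth_bump.
Proof. by move=> n; exact: (Cn_derive1 (smooth_step_smooth n.+1)).2. Qed.

Lemma step_derive (x : R) : is_derive x 1 smooth_step (smooth_bump x).
Proof.
have [df _] := Cn_derive1 (smooth_step_smooth 1).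
by apply: DeriveDef; [exact: df|rewrite /smooth_bump derive1E].
Qed.

Lemma smooth_bump_out x : ~ (0 <= x <= 1) -> smooth_bump x = 0.
Proof.
move=> /negP; rewrite negb_and -!ltNge => /orP[x0|x1].
  rewrite /smooth_bump derive1E (@near_eq_derive _ _ _ _ (fun=> 0)) ?derive_cst//.
  near=> y; apply: smooth_step0; near: y; exact: lt_le_nbhsl.
rewrite /smooth_bump derive1E (@near_eq_derive _ _ _ _ (fun=> 1 : R)) ?derive_cst//.
near=> y; apply/smooth_step1/ltW; near: y; exact: lt_nbhsr.
Unshelve. all: by end_near. Qed.

Lemma smooth_continuous f : smooth f -> continuous f.
Proof.
move=> sf x; have [df _] := Cn_derive1 (sf 1).
by apply: differentiable_continuous; exact/derivable1_diffP.
Qed.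

Lemma smooth_bump_bounded : exists2 M : R, 0 <= M & forall x, `|smooth_bump x| <= M.
Proof.
have cb : {within `[(0 : R), 1], continuous (fun x => `|smooth_bump x|)}.
  apply: continuous_subspaceT => x; apply: continuous_comp; last exact: norm_continuous.
  exact: smooth_continuous smooth_bump_smooth x.
have [c _ hc] := EVT_max ler01 cb.
exists `|smooth_bump c|; first exact: normr_ge0.
move=> x.
have [x01|/negP x01] := boolP (0 <= x <= 1); first by apply: hc; rewrite in_itv.
by rewrite smooth_bump_out// normr0.
Qed.

End SmoothFunctions.

(** * Lebesgue points and the du Bois-Reymond lemma *)

Section LebesguePoints.
Context {R : realType}.
Let mu := @lebesgue_measure R.
Implicit Types (k : R -> R) (a b c d r : R).

Lemma davgE f c r : 0 < r -> rintg (c - r) (c + r) f ->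
  davg f c r = ((r *+ 2)^-1 * rint (c - r) (c + r) (fun x => `|f x - f c|))%:E.
Proof.
move=> r0 hf; rewrite /davg /iavg lebesgue_measure_ball ?ltW// inver.
rewrite mulrn_eq0 /= gt_eqF// EFinM; congr (_ * _)%E.
have hg : rintg (c - r) (c + r) (fun x => `|f x - f c|).
  by apply: rintg_norm; apply: rintgB => //; exact: rintg_cst.
rewrite /rint /Rintegral fineK; last exact: integrable_fin_num hg.
by rewrite ball_itv.
Qed.

(** Lebesgue's theorem has centered windows; passing to the right half of the window
    costs a factor 2. One-sided windows fit the mollifiers supported in [c, c + r]. *)
Lemma right_lebesgue_pt a b k : rintg a b k ->
  {ae mu, forall c, c \in `]a, b[ -> forall eps : R, 0 < eps ->
    \forall r \near (0 : R)^'+, [/\ 0 < r, c + r < b &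
      r^-1 * rint c (c + r) (fun x => `|k x - k c|) < eps]}.
Proof.
move=> hk; pose k0 := k \_ `]a, b[.
have ik0 : mu.-integrable setT (EFin \o k0).
  by rewrite /k0 -restrict_EFin; apply/integrable_restrict => //=; rewrite setTI.
have := lebesgue_differentiation (open_integrable_locally openT ik0).
apply: filterS; first exact: (ae_filter_ringOfSetsType mu).
move=> c hc cab eps e0; move: (cab); rewrite in_itv /= => /andP[ac cb].
have : \forall r \near (0 : R)^'+, (davg k0 c r < (eps / 2)%:E)%E.
  have e2 : (0 < (eps / 2)%:E)%E by rewrite lte_fin divr_gt0.
  exact: (hc _ (open_ereal_lt' e2)).
move=> hd; near=> r.
have r0 : 0 < r by [].
have crb : c + r < b by rewrite -ltrBrDl; near: r; apply: nbhs_right_lt; rewrite subr_gt0.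
split => //.
have : (davg k0 c r < (eps / 2)%:E)%E by near: r.
have ig : rintg (c - r) (c + r) k0 by apply: integrableS ik0.
rewrite davgE// lte_fin mulr2n.
have e1 : rint c (c + r) (fun x => `|k x - k c|) = rint c (c + r) (fun x => `|k0 x - k0 c|).
  apply: eq_rint => x /andP[cx xcr]; rewrite /k0 !patchE !mem_set//=.
  by rewrite in_itv /= (lt_trans ac cx) (lt_trans xcr crb).
have ih : rintg (c - r) (c + r) (fun x => `|k0 x - k0 c|).
  by apply: rintg_norm; apply: rintgB => //; exact: rintg_cst.
have e2 : rint c (c + r) (fun x => `|k0 x - k0 c|) <= rint (c - r) (c + r) (fun x => `|k0 x - k0 c|).
  rewrite [X in _ <= X](@rint_chasles _ _ c)//; [|by rewrite gerBl ltW|by rewrite lerDl ltW].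
  by rewrite lerDr rint_ge0.
rewrite e1 => h; rewrite mulrC ltr_pdivrMr//.
move: h; rewrite mulrC ltr_pdivrMr ?addr_gt0//.
move: e2; set p := rint c _ _; set q := rint (c - r) _ _; move=> h1 h2; lra.
Unshelve. all: by end_near. Qed.

(** The mollifier: derivative of the smooth step of width r at c. *)
Definition mstep c r (x : R) := smooth_step (r^-1 * x + - (r^-1 * c)).
Definition mollif c r (x : R) := r^-1 * smooth_bump (r^-1 * x + - (r^-1 * c)).

Lemma mstep_smooth c r : smooth (mstep c r).
Proof. by move=> n; apply: Cn_comp_affine; exact: smooth_step_smooth. Qed.

Lemma mollif_smooth c r : smooth (mollif c r).
Proof.
move=> n; apply: Cn_mul; first exact: Cn_cst.
by apply: Cn_comp_affine; exact: smooth_bump_smooth.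
Qed.

Lemma mstep_derive c r (x : R) : is_derive x 1 (mstep c r) (mollif c r x).
Proof.
have dg : is_derive x 1 (fun x : R => r^-1 * x + - (r^-1 * c)) r^-1.
  have := is_deriveD (is_deriveM (is_derive_cst r^-1 x 1) (is_derive_id x 1)) (is_derive_cst (- (r^-1 * c)) x 1).
  rewrite (_ : cst r^-1 * id + cst (- (r^-1 * c)) = (fun x : R => r^-1 * x + - (r^-1 * c)))// => h.
  by apply: (is_derive_cast h); rewrite scaler0 !addr0 [_ *: _]mulr1.
have := @is_derive1_comp _ smooth_step (fun x : R => r^-1 * x + - (r^-1 * c)) x _ _ (step_derive _) dg.
by move=> h; apply: (is_derive_cast h); rewrite /mollif mulrC.
Qed.

Let arg0 c r (x : R) : 0 < r -> x <= c -> r^-1 * x + - (r^-1 * c) <= 0.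
Proof. by move=> r0 xc; rewrite -mulrBr pmulr_rle0 ?invr_gt0// subr_le0. Qed.

Let arg1 c r (x : R) : 0 < r -> c + r <= x -> 1 <= r^-1 * x + - (r^-1 * c).
Proof. by move=> r0 xc; rewrite -mulrBr mulrC ler_pdivlMr// mul1r lerBrDl. Qed.

Lemma mstep_le c r x : 0 < r -> x <= c -> mstep c r x = 0.
Proof. by move=> r0 xc; apply: smooth_step0; exact: arg0. Qed.

Lemma mstep_ge c r x : 0 < r -> c + r <= x -> mstep c r x = 1.
Proof. by move=> r0 xc; apply: smooth_step1; exact: arg1. Qed.

Lemma mollif_out c r x : 0 < r -> ~ (c <= x <= c + r) -> mollif c r x = 0.
Proof.
move=> r0 h; rewrite /mollif smooth_bump_out ?mulr0// => /andP[h1 h2]; apply: h.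
rewrite -mulrBr in h1 h2.
move: h1; rewrite pmulr_rge0 ?invr_gt0// subr_ge0 => ->.
by move: h2; rewrite mulrC ler_pdivrMr// mul1r lerBlDl.
Qed.

Lemma mollif_rint_local a b c r k : 0 < r -> a < c -> c + r < b -> rintg a b k ->
  rintg a b (fun x => mollif c r x * k x) /\
  rint a b (fun x => mollif c r x * k x) = rint c (c + r) (fun x => mollif c r x * k x).
Proof.
move=> r0 ac crb hk; have [M M0 hM] := @smooth_bump_bounded R.
have cr : c <= c + r by rewrite lerDl ltW.
have ig : rintg a b (fun x => mollif c r x * k x).
  apply: (le_rintg _ (rintgZ (r^-1 * M) (rintg_norm hk))).
    apply: measurable_funM; last exact: rintg_meas hk.
    apply: measurable_funTS; apply: continuous_measurable_fun.
    exact: smooth_continuous (mollif_smooth c r).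
  move=> x _; rewrite normrM ler_wpM2r// /mollif normrM ger0_norm ?invr_ge0 ?(ltW r0)//.
  by rewrite ler_wpM2l// invr_ge0 ltW.
split => //.
rewrite (@rint_chasles _ a c b)//; [|exact: ltW|exact: le_trans cr (ltW crb)].
rewrite (@rint_chasles _ c (c + r) b)//; [|exact: ltW|by apply: rintgS ig => //; exact: ltW].
rewrite (@eq_rint _ a c _ (fun=> 0)) ?rint0 ?add0r; last first.
  move=> x /andP[_ xc]; rewrite mollif_out ?mul0r// => /andP[cx _].
  by move: xc; rewrite ltNge cx.
rewrite (@eq_rint _ (c + r) b _ (fun=> 0)) ?rint0 ?addr0//.
move=> x /andP[xc _]; rewrite mollif_out ?mul0r// => /andP[_ cx].
by move: xc; rewrite ltNge cx.
Qed.

(** The mollifier has integral 1 and is bounded by M / r, so the error is at most M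
    times the mean deviation of k from k c. *)
Lemma mollif_cvg a b k : rintg a b k ->
  {ae mu, forall c, c \in `]a, b[ -> forall eps : R, 0 < eps ->
    \forall r \near (0 : R)^'+, [/\ 0 < r, c + r < b &
      `|rint a b (fun x => mollif c r x * k x) - k c| < eps]}.
Proof.
move=> hk; have [M M0 hM] := @smooth_bump_bounded R.
have M1 : 0 < M + 1 by rewrite ltr_wpDl.
have := right_lebesgue_pt hk.
apply: filterS; first exact: (ae_filter_ringOfSetsType mu).
move=> c hc cab eps e0; move: (cab); rewrite in_itv /= => /andP[ac cb].
have e1 : 0 < eps / (M + 1) by rewrite divr_gt0.
have := hc cab _ e1; apply: filterS => r [r0 crb hr]; split => //.
have [ig ->] := mollif_rint_local r0 ac crb hk.
have cr : c <= c + r by rewrite lerDl ltW.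
have sub f : rintg a b f -> rintg c (c + r) f by apply: rintgS; exact: ltW.
have one : rint c (c + r) (mollif c r) = 1.
  have -> : rint c (c + r) (mollif c r) = mstep c r (c + r) - mstep c r c.
    apply: rint_FTC => //; first exact: mstep_derive.
    exact: smooth_continuous (mollif_smooth c r).
  by rewrite mstep_ge// mstep_le// subr0.
have im : rintg c (c + r) (mollif c r).
  apply: (@eq_rintg _ c (c + r) (fun x => mollif c r x * 1)); first by move=> x _; rewrite mulr1.
  by apply: sub; have [] := mollif_rint_local r0 ac crb (rintg_cst a b 1).
have i2 : rintg c (c + r) (fun x => k c * mollif c r x) by exact: rintgZ.
have -> : rint c (c + r) (fun x => mollif c r x * k x) - k c =
    rint c (c + r) (fun x => mollif c r x * k x - k c * mollif c r x).
  by rewrite [RHS]rintB ?(rintZ _ im) ?one ?mulr1//; exact: (sub _ ig).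
have ikc : rintg c (c + r) (fun x => `|k x - k c|).
  by apply: rintg_norm; apply: rintgB; [exact: sub|exact: rintg_cst].
apply: (@le_lt_trans _ _ (rint c (c + r) (fun x => (M * r^-1) * `|k x - k c|))).
  apply: rint_norm_bound; [|exact: rintgZ|].
    by apply: rintgB => //; exact: sub.
  move=> x _; rewrite (mulrC (k c)) -mulrBr normrM ler_wpM2r// /mollif normrM mulrC.
  by rewrite [`|r^-1|]ger0_norm ?invr_ge0 ?(ltW r0)// ler_wpM2r ?invr_ge0 ?(ltW r0).
rewrite rintZ// -mulrA.
move: hr; rewrite ltr_pdivlMr//; apply: le_lt_trans.
rewrite mulrC ler_wpM2l ?lerDl ?ler01// mulr_ge0 ?invr_ge0 ?(ltW r0)//.
by rewrite rint_ge0.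
Qed.

Lemma dist_le_of_close (p q u v eps : R) : `|p - u| < eps / 2 -> `|q - v| < eps / 2 ->
  p - q = 0 -> `|u - v| <= eps.
Proof.
rewrite !ltr_norml ler_norml => /andP[h1 h2] /andP[h3 h4] h5.
by apply/andP; split; lra.
Qed.

(** du Bois-Reymond: test with the difference of two steps of width r, whose
    derivative is the difference of the mollifiers at two Lebesgue points. *)
Lemma du_bois_reymond a b k : rintg a b k ->
  (forall phi, smooth phi ->
     (exists c d, [/\ a < c, d < b & forall x, ~ (c <= x <= d) -> phi x = 0]) ->
     rint a b (fun x => phi^`()%classic x * k x) = 0) ->
  exists v : R, {ae mu, forall x, x \in `]a, b[ -> k x = v}.
Proof.
move=> hk hphi; have hae := mollif_cvg hk.
pose good c := (c \in `]a, b[) /\ (forall eps : R, 0 < eps ->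
    \forall r \near (0 : R)^'+, [/\ 0 < r, c + r < b &
      (`|rint a b (fun x => mollif c r x * k x) - k c| < eps)]).
have eqk c d : c < d -> good c -> good d -> k c = k d.
  move=> cd [cab hc] [dab hd]; apply/eqP; rewrite -subr_eq0 -normr_le0.
  apply/ler_addgt0Pl => eps e0; rewrite ?addr0.
  have e2 : 0 < eps / 2 by rewrite divr_gt0.
  near (0 : R)^'+ => r.
  have [r0 crb hcr] : [/\ 0 < r, c + r < b &
      `|rint a b (fun x => mollif c r x * k x) - k c| < eps / 2] by near: r; exact: hc.
  have [_ drb hdr] : [/\ 0 < r, d + r < b &
      `|rint a b (fun x => mollif d r x * k x) - k d| < eps / 2] by near: r; exact: hd.
  move: cab dab; rewrite !in_itv /= => /andP[ac cb] /andP[ad db].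
  pose phi x := mstep c r x - mstep d r x.
  have sphi : smooth phi.
    by move=> n; apply: Cn_add; [exact: mstep_smooth|apply: Cn_opp; exact: mstep_smooth].
  have dphi x : phi^`()%classic x = mollif c r x - mollif d r x.
    have h := is_deriveB (mstep_derive c r x) (mstep_derive d r x).
    by rewrite derive1E; case: h.
  have [i1 _] := mollif_rint_local r0 ac crb hk.
  have [i2 _] := mollif_rint_local r0 ad drb hk.
  have := hphi phi sphi; rewrite (@eq_rint _ a b _ (fun x => mollif c r x * k x - mollif d r x * k x)); last first.
    by move=> x _; rewrite dphi mulrBl.
  rewrite rintB// => h.
  have {h} : rint a b (fun x => mollif c r x * k x) - rint a b (fun x => mollif d r x * k x) = 0.
    apply: h; exists c, (d + r); split => // x hx; rewrite /phi.
    have [xc|xc] := ltP x c.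
      by rewrite !mstep_le ?subrr// ltW// (lt_trans xc).
    have xd : d + r < x by rewrite ltNge; apply/negP => xd; apply: hx; rewrite xc xd.
    by rewrite !mstep_ge ?subrr// ltW// (lt_trans _ xd)// ltrD2r.
  exact: (dist_le_of_close hcr hdr).
have [[c0 gc0]|ng] := pselect (exists c, good c); last first.
  exists 0; apply: filterS hae; first exact: (ae_filter_ringOfSetsType mu).
  by move=> x hx xab; exfalso; apply: ng; exists x; split => //; exact: hx.
exists (k c0); apply: filterS hae; first exact: (ae_filter_ringOfSetsType mu).
move=> x hx xab; have gx : good x by split => //; exact: hx.
have [xc|xc|->//] := ltgtP x c0; first exact: eqk.
by apply: esym; apply: eqk.
Unshelve. all: by end_near. Qed.

(** At a Lebesgue point k is the limit of its means over shrinking intervals. *)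
Lemma ae_eq0_of_rint a b k : rintg a b k ->
  (forall s t, a <= s -> s <= t -> t <= b -> rint s t k = 0) ->
  {ae mu, forall x, x \in `]a, b[ -> k x = 0}.
Proof.
move=> hk h0; have := right_lebesgue_pt hk.
apply: filterS; first exact: (ae_filter_ringOfSetsType mu).
move=> c hc cab; move: (cab); rewrite in_itv /= => /andP[ac cb].
apply/eqP; rewrite -normr_le0; apply/ler_addgt0Pl => eps e0; rewrite ?addr0.
near (0 : R)^'+ => r.
have [r0 crb hr] : [/\ 0 < r, c + r < b &
    r^-1 * rint c (c + r) (fun x => `|k x - k c|) < eps] by near: r; exact: hc.
have cr : c <= c + r by rewrite lerDl ltW.
have ik : rintg c (c + r) k by apply: rintgS hk; exact: ltW.
have ikc : rintg c (c + r) (fun x => k x - k c) by apply: rintgB => //; exact: rintg_cst.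
have := rint_norm_le ikc; rewrite rintB//; last exact: rintg_cst.
rewrite h0 ?(ltW ac) ?(ltW crb)// rint_cst// sub0r normrN addrAC subrr add0r normrM (gtr0_norm r0).
move=> h; have := ltW hr; rewrite mulrC ler_pdivrMr// => h2; have := le_trans h h2.
by rewrite ler_pM2r.
Unshelve. all: by end_near. Qed.

End LebesguePoints.

(** * Weak derivatives of vector functions *)

Section AlmostEverywhere.
Context {R : realType}.
Let mu := @lebesgue_measure R.

Lemma aeS (P Q : R -> Prop) : (forall x, P x -> Q x) ->
  {ae mu, forall x, P x} -> {ae mu, forall x, Q x}.
Proof. by move=> PQ; apply: filterS; first exact: (ae_filter_ringOfSetsType mu). Qed.

Lemma aeS2 (P Q S : R -> Prop) : (forall x, P x -> Q x -> S x) ->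
  {ae mu, forall x, P x} -> {ae mu, forall x, Q x} -> {ae mu, forall x, S x}.
Proof. by move=> PQS; apply: filterS2; first exact: (ae_filter_ringOfSetsType mu). Qed.

End AlmostEverywhere.

Section C1Paths.
Context {R : realType} (H : hilbert R).
Hypothesis H_separable : separable H.
Let mu := @lebesgue_measure R.
Implicit Types (y G u v w F m : R -> H) (a b s t r : R) (h g : H) (c : R -> R[i]).

Definition cC1 c c' : Prop :=
  [/\ forall t : R, is_derive t 1 (fun s : R => complex.Re (c s)) (complex.Re (c' t)),
      forall t : R, is_derive t 1 (fun s : R => complex.Im (c s)) (complex.Im (c' t)),
      continuous (fun t : R => complex.Re (c' t)) &
      continuous (fun t : R => complex.Im (c' t))].

(** C^1 paths in the weak sense. Local boundedness is part of the definition, as weak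
    continuity of G does not bound it directly. *)
Definition vC1 y G : Prop :=
  [/\ forall h t, is_derive t 1 (fun s : R => dR (y s) h) (dR (G t) h),
      forall h, continuous (fun t : R => dR (G t) h) &
      forall a b, exists M, forall t, a <= t <= b -> nr (y t) <= M /\ nr (G t) <= M].

Lemma derive_continuous (f f' : R -> R) :
  (forall t : R, is_derive t 1 f (f' t)) -> continuous f.
Proof.
move=> df x; apply: differentiable_continuous; apply/derivable1_diffP.
by case: (df x).
Qed.

Lemma continuous_measurable_itv a b (f : R -> R) :
  continuous f -> measurable_fun `]a, b[ f.
Proof. by move=> cf; apply: measurable_funTS; apply: continuous_measurable_fun. Qed.

Lemma vC1_prim a b y G : a <= b -> vC1 y G -> is_prim a b y G.
Proof.
move=> ab [dy cG bG].
have mG : wmeas a b G.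
  by move=> h; apply: measurable_funTS; apply: continuous_measurable_fun; exact: cG.
split.
  have [M hM] := bG a b.
  apply: (vL1_le H_separable mG (rintg_cst a b M)) => x /andP[/ltW ax /ltW xb].
  by have [|_ ] := hM x _; first by rewrite ax xb.
move=> s t as_ st tb h; rewrite dRBl.
by rewrite (rint_FTC st (dy h) (cG h)).
Qed.

Lemma cC1_bounded c c' a b : cC1 c c' ->
  exists2 M, 0 <= M & forall t, a <= t <= b -> nr (c t) <= M /\ nr (c' t) <= M.
Proof.
move=> [d1 d2 c1 c2].
have bnd (f : R -> R) : continuous f -> exists2 M, 0 <= M & forall t, a <= t <= b -> `|f t| <= M.
  move=> cf; have [ab|ba] := leP a b; last first.
    by exists 0 => // t /andP[h1 h2]; have := le_trans h1 h2; rewrite leNgt ba.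
  have cb : {within `[a, b], continuous (fun x => `|f x|)}.
    apply: continuous_subspaceT => x; apply: continuous_comp; last exact: norm_continuous.
    exact: cf.
  have [x _ hx] := EVT_max ab cb; exists `|f x|; first exact: normr_ge0.
  by move=> t tab; apply: hx; rewrite in_itv.
have [M1 p1 h1] := bnd _ (derive_continuous d1).
have [M2 p2 h2] := bnd _ (derive_continuous d2).
have [M3 p3 h3] := bnd _ c1.
have [M4 p4 h4] := bnd _ c2.
exists (M1 + M2 + (M3 + M4)); first by rewrite !addr_ge0.
move=> t tab; split; apply: le_trans (nr_le_Re_Im _) _.
  by apply: (le_trans (lerD (h1 t tab) (h2 t tab))); rewrite lerDl addr_ge0.
by apply: (le_trans (lerD (h3 t tab) (h4 t tab))); rewrite lerDr addr_ge0.
Qed.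

Lemma dR_scale (z : R[i]) (x h : H) :
  dR (z *: x) h = complex.Re z * dR x h - complex.Im z * dR x ('i%C *: h).
Proof. by rewrite {1}/dR dotZl dotE; case: z. Qed.

Lemma vC1_scale c c' y G : cC1 c c' -> vC1 y G ->
  vC1 (fun t => c t *: y t) (fun t => c' t *: y t + c t *: G t).
Proof.
move=> hc [dy cG bG]; have [d1 d2 c1 c2] := hc; split.
- move=> h t.
  have p1 := is_deriveM (d1 t) (dy h t).
  have p2 := is_deriveM (d2 t) (dy ('i%C *: h) t).
  have p3 := is_deriveB p1 p2.
  rewrite (_ : (fun s => dR (c s *: y s) h) =
    ((fun s : R => complex.Re (c s)) * (fun s : R => dR (y s) h) -
     (fun s : R => complex.Im (c s)) * (fun s : R => dR (y s) ('i%C *: h)))); last first.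
    by apply/funext => s; rewrite dR_scale.
  have e : complex.Re (c t) * dR (G t) h + dR (y t) h * complex.Re (c' t) -
      (complex.Im (c t) * dR (G t) ('i%C *: h) + dR (y t) ('i%C *: h) * complex.Im (c' t)) =
      dR (c' t *: y t + c t *: G t) h by rewrite dRDl !dR_scale; ring.
  exact: (is_derive_cast p3 e).
- move=> h.
  have cy k := derive_continuous (dy k).
  have c3 := derive_continuous d1; have c4 := derive_continuous d2.
  rewrite (_ : (fun t => _) = (fun t : R =>
    (complex.Re (c' t) * dR (y t) h - complex.Im (c' t) * dR (y t) ('i%C *: h)) +
    (complex.Re (c t) * dR (G t) h - complex.Im (c t) * dR (G t) ('i%C *: h)))); last first.
    by apply/funext => t; rewrite dRDl !dR_scale.
  move=> t; apply: cvgD; apply: cvgB; apply: cvgM;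
    first [exact: c1|exact: c2|exact: c3|exact: c4|exact: cy|exact: cG].
- move=> a b; have [M hM] := bG a b; have [M' M'0 hM'] := cC1_bounded a b hc.
  exists (M' * M + M' * M) => t tab; have [y1 g1] := hM t tab; have [k1 k2] := hM' t tab.
  have h1 : nr (c t *: y t) <= M' * M by rewrite nrZ ler_pM ?nr_ge0.
  have h2 : nr (c t *: G t) <= M' * M by rewrite nrZ ler_pM ?nr_ge0.
  have h3 : nr (c' t *: y t) <= M' * M by rewrite nrZ ler_pM ?nr_ge0.
  split; last by rewrite (le_trans (ler_nrD _ _))// lerD.
  by rewrite (le_trans h1)// lerDl (le_trans _ h1)// nr_ge0.
Qed.

Lemma vC1_cst h : vC1 (fun=> h) (fun=> 0).
Proof.
split.
- by move=> k t; rewrite dR0l; exact: is_derive_cst.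
- by move=> k t; rewrite dR0l; exact: cvg_cst.
- by move=> a b; exists (nr h) => t _; rewrite nr0 nr_ge0.
Qed.

Lemma eq_vC1 y y' G G' : y =1 y' -> G =1 G' -> vC1 y G -> vC1 y' G'.
Proof. by move=> /funext -> /funext ->. Qed.

(** m' = F in the sense of distributions, in the form free of vector integrals. *)
Definition weak_deriv a b m F : Prop := forall phi, test_function a b phi ->
  forall h, rint a b (fun t => dR (cderive phi t *: m t + phi t *: F t) h) = 0.

Lemma test_cC1 a b phi : test_function a b phi -> cC1 phi (cderive phi).
Proof.
move=> [dphi _]; split.
- by move=> t; have [d1 _] := dphi 0%N t; apply: DeriveDef; [exact: d1|rewrite /= derive1E].
- by move=> t; have [_ d1] := dphi 0%N t; apply: DeriveDef; [exact: d1|rewrite /= derive1E].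
- move=> t; have [d1 _] := dphi 1%N t.
  by apply: differentiable_continuous; apply/derivable1_diffP; exact: d1.
- move=> t; have [_ d1] := dphi 1%N t.
  by apply: differentiable_continuous; apply/derivable1_diffP; exact: d1.
Qed.

Lemma vL1_test a b phi (u : R -> H) : test_function a b phi -> vL1 a b u ->
  vL1 a b (fun t => phi t *: u t) /\ vL1 a b (fun t => cderive phi t *: u t).
Proof.
move=> tphi hu; have [d1 d2 c1 c2] := test_cC1 tphi.
have mc := @continuous_measurable_itv a b.
have [M M0 hM] := cC1_bounded a b (test_cC1 tphi).
split; apply: (vL1_le H_separable _ (rintgZ M hu.2)).
- apply: wmeas_scale; [apply: mc; exact: derive_continuous d1
    |apply: mc; exact: derive_continuous d2|exact: hu.1].
- move=> x /andP[/ltW ax /ltW xb]; rewrite nrZ ler_wpM2r ?nr_ge0//.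
  by have [|] := hM x _; first by rewrite ax xb.
- by apply: wmeas_scale; [exact: mc|exact: mc|exact: hu.1].
- move=> x /andP[/ltW ax /ltW xb]; rewrite nrZ ler_wpM2r ?nr_ge0//.
  by have [|] := hM x _; first by rewrite ax xb.
Qed.

Lemma cC1_conj c c' : cC1 c c' -> cC1 (fun t => (c t)^*%C) (fun t => (c' t)^*%C).
Proof.
have reE (z : R[i]) : complex.Re z^*%C = complex.Re z by case: z.
have imE (z : R[i]) : complex.Im z^*%C = - complex.Im z by case: z.
move=> [d1 d2 c1 c2]; split.
- by move=> t; rewrite reE; under eq_fun do rewrite reE.
- by move=> t; rewrite imE; under eq_fun do rewrite imE; exact: is_deriveN.
- by under eq_fun do rewrite reE.
- by under eq_fun do rewrite imE; move=> t; apply: cvgN; exact: c2.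
Qed.

(** Integrate by parts against the path phi^* h, which vanishes at a and b. *)
Lemma prim_weak_deriv a b m w F : a < b -> is_prim a b w F -> wmeas a b m ->
  {ae mu, forall t, t \in `]a, b[ -> m t = w t} -> weak_deriv a b m F.
Proof.
move=> ab wF mm mw phi hphi h.
have hc := cC1_conj (test_cC1 hphi).
have hy : is_prim a b (fun t => (phi t)^*%C *: h) (fun t => (cderive phi t)^*%C *: h).
  apply: (vC1_prim (ltW ab)).
  by apply: eq_vC1 (vC1_scale hc (vC1_cst h)) => // t; rewrite scaler0 addr0.
have [ig] := prim_by_parts H_separable (ltW ab) wF hy.
have [_ [c [d [ac db phi0]]]] := hphi.
have -> : phi b = 0.
  by apply: phi0 => /andP[_ bd]; move: db; rewrite ltNge bd.
have -> : phi a = 0.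
  by apply: phi0 => /andP[ca _]; move: ac; rewrite ltNge ca.
rewrite conjc0 scale0r !dR0r subrr => ->.
have mphi := @continuous_measurable_itv a b.
have [d1 d2 c1 c2] := test_cC1 hphi.
apply: ae_eq_rint.
- apply: (wmeas_dR H_separable (v := fun=> h)); last exact: wmeas_cst.
  apply: wmeasD; apply: wmeas_scale => //; try exact: mphi.
  + apply: mphi; exact: derive_continuous d1.
  + apply: mphi; exact: derive_continuous d2.
  + exact: wF.1.1.
- exact: rintg_meas ig.
apply: aeS mw => t mt tab; rewrite mt// dRDl addrC.
by rewrite -!dRcl.
Qed.

(** The exceptional null set depends on h; a dense sequence of directions suffices. *)
Lemma ae_vec0 a b u : (forall h, {ae mu, forall t, t \in `]a, b[ -> dR (u t) h = 0}) ->
  {ae mu, forall t, t \in `]a, b[ -> u t = 0}.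
Proof.
move=> hu; have [e eP] := dense_sequence H_separable.
have := @ae_foralln _ _ _ mu _ (fun n => hu (e n)).
apply: aeS => t ht tab; apply/eqP; rewrite -nr_eq0; apply/negPn/negP => n0.
have p0 : 0 < nr (u t) by rewrite lt_def n0 nr_ge0.
have [n hn] := eP (u t) _ p0.
have := dR_le (u t) (u t - e n); rewrite dRBr ht// subr0 dRxx expr2 ler_pM2l//.
by rewrite leNgt hn.
Qed.

(** m minus a primitive of F has weak derivative 0, hence is constant in each direction
    h by du Bois-Reymond; these constants are the components of its mean value. *)
Lemma weak_deriv_prim a b m F : a < b -> vL1 a b m -> vL1 a b F -> weak_deriv a b m F ->
  exists w, is_prim a b w F /\ {ae mu, forall t, t \in `]a, b[ -> m t = w t}.
Proof.
move=> ab hm hF hw.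
pose P t := vint a t F.
have PF : is_prim a b P F.
  by apply: eq_prim (vint_prim H_separable 0 hF) => // t _; rewrite add0r.
have hP : vL1 a b P.
  apply: (vL1_le H_separable (prim_wmeas H_separable PF (ltW ab)) (rintg_cst a b _)).
  move=> x /andP[/ltW ax /ltW xb]; exact: (prim_bounded H_separable PF ax xb).
have wP : weak_deriv a b P F.
  apply: (prim_weak_deriv ab PF); first exact: hP.1.
  exact: aeW.
have hmP : vL1 a b (fun t => m t - P t) by exact: vL1B.
have cst h : exists c : R, {ae mu, forall t, t \in `]a, b[ -> dR (m t - P t) h = c}.
  apply: (du_bois_reymond (vL1_dR H_separable h hmP)) => phi sphi [c [d [ac db phi0]]].
  pose phic t := (phi t)%:C.
  have imE : (fun t => complex.Im (phic t)) = (fun=> 0) by [].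
  have dn0 n : derive1n n (fun=> 0 : R) = (fun=> 0 : R).
    elim: n => [//|n IH]; rewrite derive1nS IH; apply/funext => x.
    by rewrite derive1E derive_cst.
  have tphi : test_function a b phic.
    split; last by exists c, d; split => // x hx; rewrite /phic phi0.
    move=> n x; split; first exact: smooth_derivable.
    by rewrite imE dn0; exact: derivable_cst.
  have cphi t : cderive phic t = (phi^`()%classic t)%:C.
    by rewrite /cderive imE derive1E [X in _ +i* X]derive1E derive_cst.
  have iu u : vL1 a b u -> rintg a b (fun t => dR (cderive phic t *: u t + phic t *: F t) h).
    move=> hu; apply: vL1_dR => //; apply: vL1D => //.
      exact: (vL1_test tphi hu).2.
    exact: (vL1_test tphi hF).1.
  have := rintB (iu _ hm) (iu _ hP); rewrite hw// wP// subrr => e.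
  rewrite -[RHS]e; apply: eq_rint => t _.
  by rewrite -dRBl opprD addrACA subrr addr0 -scalerBr cphi dRZl.
pose m0 := ((b - a)^-1)%:C *: vint a b (fun t => m t - P t).
have ba : b - a != 0 by rewrite subr_eq0 gt_eqF.
exists (fun t => m0 + P t); split.
  split => // s t as_ st tb h.
  by rewrite opprD addrACA subrr add0r PF.2.
have : {ae mu, forall t, t \in `]a, b[ -> m t - (m0 + P t) = 0}.
  apply: ae_vec0 => h; have [c hc] := cst h.
  have em0 : dR m0 h = c.
    rewrite dRZl vintP//.
    rewrite (ae_eq_rint (g := fun=> c) _ _ hc); last 2 first.
    - exact: rintg_meas (vL1_dR H_separable h hmP).
    - exact: measurable_cst.
    by rewrite rint_cst ?ltW// mulrC mulfK.
  apply: aeS hc => t ht tab.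
  by rewrite opprD addrA addrAC dRBl em0 ht// subrr.
by apply: aeS => t ht /ht /eqP; rewrite subr_eq0 => /eqP.
Qed.

End C1Paths.

(** * Square-integrable functions *)

Section SquareIntegrable.
Context {R : realType} (H : hilbert R).
Hypothesis H_separable : separable H.
Let mu := @lebesgue_measure R.
Implicit Types (u v : R -> H) (a b s t r : R) (h : H).

Definition L2fun a b u : Prop := wmeas a b u /\ rintg a b (fun t => nr (u t) ^+ 2).

Lemma square_integrableP a b u : square_integrable a b u <-> L2fun a b u.
Proof.
split=> [[mu_ fin]|[mu_ /integrableP[_ fin]]].
  have wm : wmeas a b u by move=> h; have [] := mu_ h.
  split => //; apply/integrableP; split.
    by apply/measurable_EFinP; apply: measurable_funX; exact: wmeas_nr.
  apply: le_lt_trans fin; rewrite le_eqVlt; apply/orP; left; apply/eqP.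
  by apply: eq_integral => t _ /=; rewrite ger0_norm ?sqr_ge0.
split=> [h|]; last first.
  apply: le_lt_trans fin; rewrite le_eqVlt; apply/orP; left; apply/eqP.
  by apply: eq_integral => t _ /=; rewrite ger0_norm ?sqr_ge0.
split; first exact: mu_.
apply: (eq_measurable_fun (fun t : R => dR (u t) ('i%C *: h))); last exact: mu_.
by move=> t _; rewrite dotE.
Qed.

Lemma L2_vL1 a b u : L2fun a b u -> vL1 a b u.
Proof.
move=> [mu_ iu]; apply: (vL1_le H_separable mu_ (rintgD (rintg_cst a b 1) iu)) => x _.
have := sqr_ge0 (nr (u x) - 1); have := nr_ge0 (u x).
by move: (nr (u x)) => p p0 h; nra.
Qed.

Lemma L2_le a b u (g : R -> R) : wmeas a b u -> rintg a b g ->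
  (forall x, a < x < b -> nr (u x) ^+ 2 <= g x) -> L2fun a b u.
Proof.
move=> mu_ ig ug; split => //; apply: le_rintg ig _.
  by apply: measurable_funX; exact: wmeas_nr.
by move=> x ax; rewrite ger0_norm ?sqr_ge0// ug.
Qed.

Lemma L2_bounded a b u M : wmeas a b u -> (forall x, a < x < b -> nr (u x) <= M) ->
  L2fun a b u.
Proof.
move=> mu_ uM; apply: (L2_le mu_ (rintg_cst a b (M ^+ 2))) => x ax.
by rewrite lerXn2r ?nnegrE ?nr_ge0 ?(le_trans _ (uM x ax)) ?nr_ge0// uM.
Qed.

Lemma L2Z a b (c : R[i]) u : L2fun a b u -> L2fun a b (fun t => c *: u t).
Proof.
move=> [mu_ iu]; apply: (L2_le (wmeasZ c mu_) (rintgZ (nr c ^+ 2) iu)) => x _.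
by rewrite nrZ exprMn.
Qed.

Lemma L2D a b u v : L2fun a b u -> L2fun a b v -> L2fun a b (fun t => u t + v t).
Proof.
move=> [mu_ iu] [mv iv].
apply: (L2_le (wmeasD mu_ mv) (rintgD (rintgZ 2 iu) (rintgZ 2 iv))) => x _.
rewrite nr_sqrD; have := sqr_ge0 (nr (u x - v x)); rewrite nr_sqrB.
by move: (nr (u x)) (nr (v x)) (dR _ _) => p q z h; lra.
Qed.

Lemma L2N a b u : L2fun a b u -> L2fun a b (fun t => - u t).
Proof.
move=> hu; have := L2Z (-1 : R)%:C hu.
by rewrite (_ : (fun t => (-1)%:C *: u t) = (fun t => - u t))//; apply/funext => t; rewrite -oppE.
Qed.

Lemma L2B a b u v : L2fun a b u -> L2fun a b v -> L2fun a b (fun t => u t - v t).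
Proof. by move=> hu hv; apply: L2D => //; exact: L2N. Qed.

Lemma L2_cst0 a b : L2fun a b (fun=> 0).
Proof. by apply: (@L2_bounded _ _ _ 0); [exact: wmeas_cst|move=> x _; rewrite nr0]. Qed.

Lemma L2_dR a b u v : L2fun a b u -> L2fun a b v -> rintg a b (fun t => dR (u t) (v t)).
Proof.
move=> [mu_ iu] [mv iv]; apply: (le_rintg (wmeas_dR H_separable mu_ mv) (rintgD iu iv)) => x _.
apply: le_trans (dR_norm_le _ _) _.
have := sqr_ge0 (nr (u x) - nr (v x)); have := nr_ge0 (u x); have := nr_ge0 (v x).
by move: (nr (u x)) (nr (v x)) => p q p0 q0 h; nra.
Qed.

Lemma snormE a b (u : L2space a b H) : snorm u = Num.sqrt (rint a b (fun t => nr (u t) ^+ 2)).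
Proof.
rewrite /snorm /=; congr Num.sqrt.
by apply: eq_rint => t _; rewrite -dRxx.
Qed.

Lemma snorm_sqr a b (u : L2space a b H) : snorm u ^+ 2 = rint a b (fun t => nr (u t) ^+ 2).
Proof. by rewrite snormE sqr_sqrtr// rint_ge0// => x _; exact: sqr_ge0. Qed.

Lemma snorm_ge0 (X : semihilbert R) (x : X) : 0 <= snorm x.
Proof. exact: sqrtr_ge0. Qed.

Lemma snorm_eq0 a b (u : L2space a b H) : L2fun a b u ->
  snorm u = 0 <-> {ae mu, forall t, t \in `]a, b[ -> u t = 0}.
Proof.
move=> hu; split=> [u0|u0].
  have i0 : rint a b (fun t => nr (u t) ^+ 2) = 0 by rewrite -snorm_sqr u0 expr0n.
  have := ae_eq0_of_rint hu.2 _; move=> h.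
  have {h} : {ae mu, forall t, t \in `]a, b[ -> nr (u t) ^+ 2 = 0}.
    apply: h => s t as_ st tb; apply/eqP; rewrite eq_le rint_ge0 ?andbT; last first.
      by move=> x _; exact: sqr_ge0.
    have at_ := le_trans as_ st.
    rewrite -i0 (@rint_chasles _ a t b)//; last exact: hu.2.
    rewrite (@rint_chasles _ a s t)//; last by apply: rintgS hu.2.
    rewrite -addrA addrCA lerDl addr_ge0// rint_ge0// => x _; exact: sqr_ge0.
  by apply: aeS => t h /h /eqP; rewrite sqrf_eq0 nr_eq0 => /eqP.
rewrite snormE (ae_eq_rint (g := fun=> 0) _ _ _) ?rint0 ?sqrtr0//.
- exact: rintg_meas hu.2.
- by apply: aeS u0 => t h /h ->; rewrite nr0 expr0n.
Qed.

(** The discriminant of a nonnegative quadratic polynomial. *)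
Lemma quad_discr (U I V : R) : 0 <= U -> 0 <= V ->
  (forall x : R, 0 <= U - 2 * x * I + x ^+ 2 * V) -> I ^+ 2 <= U * V.
Proof.
move=> U0 V0 h; have [V00|V1] := eqVneq V 0.
  have [->|I0] := eqVneq I 0; first by rewrite V00 mulr0 expr0n.
  have := h ((U + 1) / (2 * I)); rewrite V00 mulr0 addr0.
  have -> : 2 * ((U + 1) / (2 * I)) * I = U + 1 by field.
  by rewrite opprD addrA subrr add0r oppr_ge0 ler10.
have Vp : 0 < V by rewrite lt_def V1.
have := h (I / V).
have -> : U - 2 * (I / V) * I + (I / V) ^+ 2 * V = (U * V - I ^+ 2) / V by field.
by rewrite pmulr_lge0 ?invr_gt0// subr_ge0.
Qed.

Lemma L2_cauchy_schwarz a b (u v : L2space a b H) : L2fun a b u -> L2fun a b v ->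
  `|rint a b (fun t => dR (u t) (v t))| <= snorm u * snorm v.
Proof.
move=> hu hv; rewrite -(@ler_pXn2r _ 2) ?nnegrE ?mulr_ge0 ?snorm_ge0// exprMn.
rewrite real_normK ?num_real// !snorm_sqr.
apply: quad_discr; [by rewrite rint_ge0// => x _; exact: sqr_ge0|by rewrite rint_ge0// => x _; exact: sqr_ge0|].
move=> x; have iuv := L2_dR hu hv.
rewrite -!rintZ//; last exact: hv.2.
rewrite -rintB; [|exact: hu.2|exact: rintgZ].
rewrite -rintD; [|by apply: rintgB; [exact: hu.2|exact: rintgZ]|by apply: rintgZ; exact: hv.2].
apply: rint_ge0 => t _.
have := sqr_ge0 (nr (u t - x%:C *: v t)); rewrite nr_sqrB dRZr nrZ nrR exprMn real_normK ?num_real//.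
by move: (dR _ _) => p; lra.
Qed.

Lemma L1_le_L2 a b (u : L2space a b H) : a <= b -> L2fun a b u ->
  rint a b (fun t => nr (u t)) ^+ 2 <= (b - a) * snorm u ^+ 2.
Proof.
move=> ab hu; rewrite snorm_sqr mulrC.
have h1 := (L2_vL1 hu).2.
apply: quad_discr; [by rewrite rint_ge0// => x _; exact: sqr_ge0|by rewrite subr_ge0|].
move=> x; rewrite -[b - a]mul1r -(rint_cst 1 ab) -!rintZ//; last exact: rintg_cst.
rewrite -rintB; [|exact: hu.2|exact: rintgZ].
rewrite -rintD; [|by apply: rintgB; [exact: hu.2|exact: rintgZ]|by apply: rintgZ; exact: rintg_cst].
apply: rint_ge0 => t _.
have := sqr_ge0 (nr (u t) - x); rewrite sqrrB mulr1.
by move: (nr (u t)) => p; rewrite -mulr_natl; lra.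
Qed.

End SquareIntegrable.

(** * The maximal operator as an equation in H *)

Section MaximalOperator.
Context {R : realType} (H : hilbert R) (D : set H) (A : H -> H).
Hypothesis H_separable : separable H.
Hypothesis H_nontrivial : exists x : H, x <> 0.
Hypothesis Asa : @selfadjoint R (hspace H) (graph_on D A).
Variables (Hm : hilbert R) (iota : {linear H -> Hm}).
Hypothesis Hm_negative : negative_space D A iota.
Variable At : H -> Hm.
Hypothesis At_adjoint : plus_adjoint D A iota At.
Let mu := @lebesgue_measure R.
Let hm : - 'i%C = 'i%C :> R[i] \/ - 'i%C = - 'i%C :> R[i]. Proof. by right. Qed.
Let Rm := resolvent D A (- 'i%C).
Let K := neg_iso iota At.
Let KZ := neg_isoZ H_nontrivial Asa Hm_negative At_adjoint.
Let KD := neg_isoD H_nontrivial Asa Hm_negative At_adjoint.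
Let KR := neg_iso_resolvent H_nontrivial Asa Hm_negative At_adjoint.

Lemma wmeas_resolvent a b u : wmeas a b u -> wmeas a b (fun t => Rm (u t)).
Proof. by move=> mu_ h; apply: (wmeas_adj (resolvent_adj Asa) mu_). Qed.

Lemma vL1_resolvent a b u : vL1 a b u -> vL1 a b (fun t => Rm (u t)).
Proof.
move=> [mu_ iu]; apply: (vL1_le H_separable (wmeas_resolvent mu_) iu) => x _.
exact: (nr_resolvent Asa hm).
Qed.

(** The right-hand side of m' = i u - m - i (A - i)^-1 f, the equation satisfied
    by m = (A - i)^-1 u when i u' + A u = f. *)
Definition resolvent_rhs (u f : R -> H) (t : R) : H :=
  'i%C *: u t - Rm (u t) - 'i%C *: Rm (f t).

Lemma vL1_resolvent_rhs a b u f : vL1 a b u -> vL1 a b f -> vL1 a b (resolvent_rhs u f).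
Proof.
move=> hu hf; apply: vL1B => //; last by apply: vL1Z => //; exact: vL1_resolvent.
by apply: vL1B => //; [exact: vL1Z|exact: vL1_resolvent].
Qed.

(** Read through the isometry of H onto H_-, the distributional equation says
    that (A - i)^-1 u has a weak derivative in H. *)
Lemma L2max_weak a b (u f : R -> H) :
  L2max iota At a b (u, f) <->
  [/\ L2fun a b u, L2fun a b f &
      weak_deriv a b (fun t => Rm (u t)) (resolvent_rhs u f)].
Proof.
have key : L2fun a b u -> L2fun a b f -> forall phi, test_function a b phi ->
  (('i%C *: dist_derive (dist_of a b (fun t => iota (u t))) phi
        + dist_of a b (fun t => At (u t)) phi
      = dist_of a b (fun t => iota (f t)) phi) <->
   forall h, rint a b (fun t => dR (cderive phi t *: Rm (u t) + phi t *: resolvent_rhs u f t) h) = 0).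
  move=> hu hf phi tphi.
  have lu := L2_vL1 H_separable hu; have lf := L2_vL1 H_separable hf.
  have lru := vL1_resolvent lu; have lrf := vL1_resolvent lf.
  have lA : vL1 a b (fun t => u t + 'i%C *: Rm (u t)) by apply: vL1D => //; exact: vL1Z.
  have [_ l1] := vL1_test H_separable tphi lru.
  have [l2 _] := vL1_test H_separable tphi lA.
  have [l3 _] := vL1_test H_separable tphi lrf.
  have [l4 _] := vL1_test H_separable tphi (vL1_resolvent_rhs lu lf).
  have iso v : vL1 a b v -> vint a b (fun t => K (v t)) = K (vint a b v).
    move=> hv; apply: (vint_neg_iso H_nontrivial Asa Hm_negative At_adjoint).
    by exists (vint a b v) => h; rewrite cint_dot dotE !vintP.
  have e1 : dist_derive (dist_of a b (fun t => iota (u t))) phi =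
      - K (vint a b (fun t => cderive phi t *: Rm (u t))).
    rewrite /dist_derive /dist_of -iso//; congr (- vint a b _); apply/funext => t.
    by rewrite /K KZ
       KR.
  have e2 : dist_of a b (fun t => At (u t)) phi =
      K (vint a b (fun t => phi t *: (u t + 'i%C *: Rm (u t)))).
    rewrite /dist_of -iso//; congr (vint a b _); apply/funext => t.
    by rewrite /K KZ
       (At_neg_iso H_nontrivial Asa Hm_negative At_adjoint).
  have e3 : dist_of a b (fun t => iota (f t)) phi = K (vint a b (fun t => phi t *: Rm (f t))).
    rewrite /dist_of -iso//; congr (vint a b _); apply/funext => t.
    by rewrite /K KZ
       KR.
  rewrite e1 e2 e3.
  set v1 := vint a b _; set v2 := vint a b _; set v3 := vint a b _.
  have -> : 'i%C *: - K v1 + K v2 = K ('i%C *: - v1 + v2).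
    rewrite /K KD
      KZ.
    congr ('i%C *: _ + _).
    by rewrite oppE (oppE v1) KZ.
  have vE h : dR ('i%C *: - v1 + v2 - v3) ('i%C *: h) =
      - rint a b (fun t => dR (cderive phi t *: Rm (u t) + phi t *: resolvent_rhs u f t) h).
    rewrite scalerN dRBl dRDl dRNl dRi.
    rewrite !vintP//.
    rewrite (_ : (fun t => dR (_ + _) h) = (fun t : R => dR (cderive phi t *: Rm (u t)) h -
       (dR (phi t *: (u t + 'i%C *: Rm (u t))) ('i%C *: h) -
        dR (phi t *: Rm (f t)) ('i%C *: h)))); last first.
      apply/funext => t; rewrite dRDl; congr (_ + _).
      rewrite -dRBl -scalerBr -dRii scalerA mulrC -scalerA; congr (dR (_ *: _) _).
      rewrite /resolvent_rhs !scalerBr scalerDr scalerA.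
      congr (_ + _ - _).
      rewrite -(scaleN1r (Rm (u t))); congr (_ *: _).
      by rewrite -expr2 sqr_i.
    rewrite !rintB//; try exact: vL1_dR.
      ring.
    by apply: rintgB; exact: vL1_dR.
  split=> [/(neg_iso_inj H_nontrivial Asa Hm_negative At_adjoint) ve h|hr].
    by have := vE h; rewrite ve subrr dR0l => /esym/eqP; rewrite oppr_eq0 => /eqP.
  congr K; apply/eqP; rewrite -subr_eq0; apply/eqP; apply: dR_ext => h.
  have := vE (- 'i%C *: h); rewrite hr oppr0 dR0l scalerA.
  have -> : 'i%C * - 'i%C = 1 :> R[i].
    by rewrite mulrN -expr2 sqr_i opprK.
  by rewrite scale1r.
split=> [[/square_integrableP hu /square_integrableP hf he]|[hu hf he]].
  have {}hu := hu H_separable; have {}hf := hf H_separable.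
  by split => // phi tphi; apply/key => //; exact: he.
split; [exact/square_integrableP|exact/square_integrableP|].
by move=> phi tphi; apply/key => //; exact: he.
Qed.

(** The H_- -valued distributional equation becomes the absolute continuity of
    (A - i)^-1 u, a statement about integrals in H. *)
Lemma L2max_prim a b (u f : R -> H) : a < b ->
  L2max iota At a b (u, f) <->
  [/\ L2fun a b u, L2fun a b f &
      exists w, is_prim a b w (resolvent_rhs u f) /\
        {ae mu, forall t, t \in `]a, b[ -> Rm (u t) = w t}].
Proof.
move=> ab; rewrite L2max_weak; split=> [[hu hf hw]|[hu hf [w [wF mw]]]]; split => //.
  have lu := L2_vL1 H_separable hu; have lf := L2_vL1 H_separable hf.
  apply: (weak_deriv_prim H_separable ab) => //; first exact: vL1_resolvent.
  exact: vL1_resolvent_rhs.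
apply: (prim_weak_deriv H_separable ab wF) => //.
by apply: wmeas_resolvent; case: hu.
Qed.

End MaximalOperator.

(** * Duhamel's formula *)

Lemma squeeze0 (R : realType) (T : Type) (F : set_system T) {FF : Filter F} (f g : T -> R) (l : R) :
  (\forall t \near F, 0 <= f t <= g t) -> g @ F --> l -> l = 0 -> f @ F --> (0 : R).
Proof.
move=> fg gl l0; rewrite l0 in gl.
apply: (@squeeze_cvgr _ _ _ _ (cst 0) g) => //; exact: cvg_cst.
Qed.

Section ComplexExponential.
Context {R : realType}.
Implicit Types (z : R[i]) (s t a sg : R).

(** e^{-izt}. *)
Definition ez z t : R[i] :=
  (expR (t * complex.Im z) * cos (t * complex.Re z)) +i*
  (- (expR (t * complex.Im z) * sin (t * complex.Re z))).

Lemma ez0 z : ez z 0 = 1.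
Proof. by rewrite /ez !mul0r expR0 cos0 sin0 mulr1 mulr0 oppr0. Qed.

Lemma ezD z s t : ez z (s + t) = ez z s * ez z t.
Proof.
apply/eqP; rewrite eq_complex /= !mulrDl expRD cosD sinD; apply/andP; split; apply/eqP; ring.
Qed.

Lemma ezJ z t : (ez z t)^*%C = ez z^*%C (- t).
Proof.
by case: z => x y; rewrite /ez /= mulrNN !mulNr cosN sinN mulrN opprK.
Qed.

Lemma nr_ez z t : nr (ez z t) = expR (t * complex.Im z).
Proof.
apply/eqP; rewrite -(@eqrXn2 _ 2) ?nr_ge0 ?expR_ge0// sqr_nr /= sqrrN !exprMn -mulrDr.
by rewrite cos2Dsin2 mulr1.
Qed.

Lemma is_derive_lin sg a (y t : R) : is_derive t 1 (fun s : R => sg * (s - a) * y) (sg * y).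
Proof.
have h0 := is_deriveB (is_derive_id t 1) (is_derive_cst a t 1).
have h1 := is_deriveM (is_derive_cst sg t 1) h0.
have h2 := is_deriveM h1 (is_derive_cst y t 1).
have e : sg * (t - a) * 0 + y * (sg * (1 - 0) + (t - a) * 0) = sg * y by ring.
exact: (is_derive_cast h2 e).
Qed.

Lemma is_derive_aff sg a (t : R) : is_derive t 1 (fun s : R => sg * (s - a)) sg.
Proof.
have h0 := is_deriveB (is_derive_id t 1) (is_derive_cst a t 1).
have h1 := is_deriveM (is_derive_cst sg t 1) h0.
have e : sg * (1 - 0) + (t - a) * 0 = sg by ring.
exact: (is_derive_cast h1 e).
Qed.

Lemma ez_cC1 z sg a : cC1 (fun t => ez z (sg * (t - a)))
  (fun t => (sg%:C * (- 'i%C * z)) * ez z (sg * (t - a))).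
Proof.
pose y := complex.Im z; pose x := complex.Re z.
pose e1 (t : R) := expR (sg * (t - a) * y) * cos (sg * (t - a) * x).
pose e2 (t : R) := expR (sg * (t - a) * y) * sin (sg * (t - a) * x).
have d0 t : is_derive t 1 (fun s : R => expR (sg * (s - a) * y)) (expR (sg * (t - a) * y) * (sg * y)).
  exact: (@is_derive1_comp _ expR (fun s : R => sg * (s - a) * y) t _ _ (is_derive_expR _) (is_derive_lin _ _ _ _)).
have d1 t : is_derive t 1 e1 (sg * (y * e1 t - x * e2 t)).
  have h1 := @is_derive1_comp _ cos (fun s : R => sg * (s - a) * x) t _ _ (is_derive_cos _) (is_derive_lin _ _ _ _).
  have h := is_deriveM (d0 t) h1.
  have e : expR (sg * (t - a) * y) * (- sin (sg * (t - a) * x) * (sg * x)) +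
     cos (sg * (t - a) * x) * (expR (sg * (t - a) * y) * (sg * y)) = sg * (y * e1 t - x * e2 t).
    by rewrite /e1 /e2; ring.
  exact: (is_derive_cast h e).
have d2 t : is_derive t 1 e2 (sg * (y * e2 t + x * e1 t)).
  have h1 := @is_derive1_comp _ sin (fun s : R => sg * (s - a) * x) t _ _ (is_derive_sin _) (is_derive_lin _ _ _ _).
  have h := is_deriveM (d0 t) h1.
  have e : expR (sg * (t - a) * y) * (cos (sg * (t - a) * x) * (sg * x)) +
     sin (sg * (t - a) * x) * (expR (sg * (t - a) * y) * (sg * y)) = sg * (y * e2 t + x * e1 t).
    by rewrite /e1 /e2; ring.
  exact: (is_derive_cast h e).
have reE t : complex.Re ((sg%:C * (- 'i%C * z)) * ez z (sg * (t - a))) = sg * (y * e1 t - x * e2 t).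
  by rewrite /e1 /e2 /x /y /ez; case: (z) => p q /=; ring.
have imE t : complex.Im ((sg%:C * (- 'i%C * z)) * ez z (sg * (t - a))) = - (sg * (y * e2 t + x * e1 t)).
  by rewrite /e1 /e2 /x /y /ez; case: (z) => p q /=; ring.
have c1 := derive_continuous d1; have c2 := derive_continuous d2.
split.
- by move=> t; rewrite reE; exact: d1.
- by move=> t; rewrite imE; exact: is_deriveN (d2 t).
- under eq_fun do rewrite reE.
  move=> t; apply: cvgMr; apply: cvgB; apply: cvgMr; [exact: c1|exact: c2].
- under eq_fun do rewrite imE.
  move=> t; apply: cvgN; apply: cvgMr; apply: cvgD; apply: cvgMr; [exact: c2|exact: c1].
Qed.

Lemma nr_Re_Im_continuous (phi : R -> R[i]) (t : R) :
  {for t, continuous (fun s => complex.Re (phi s))} ->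
  {for t, continuous (fun s => complex.Im (phi s))} ->
  (fun s : R => nr (phi s - phi t)) @ t --> (0 : R).
Proof.
move=> k1 k2.
have l1 : (fun s => `|complex.Re (phi s) - complex.Re (phi t)|) @ t --> (0 : R).
  rewrite -(normr0 R) -(subrr (complex.Re (phi t))); apply: cvg_norm.
  by apply: cvgB; [exact: k1|exact: cvg_cst].
have l2 : (fun s => `|complex.Im (phi s) - complex.Im (phi t)|) @ t --> (0 : R).
  rewrite -(normr0 R) -(subrr (complex.Im (phi t))); apply: cvg_norm.
  by apply: cvgB; [exact: k2|exact: cvg_cst].
apply: (squeeze0 _ (cvgD l1 l2)); last by rewrite addr0.
apply: nearW => s; rewrite nr_ge0 /=; apply: le_trans (nr_le_Re_Im _) _.
suff h (p q : R[i]) : `|complex.Re (p - q)| + `|complex.Im (p - q)| <=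
    `|complex.Re p - complex.Re q| + `|complex.Im p - complex.Im q| by exact: h.
by case: p; case: q.
Qed.

Lemma ez_continuous z (t : R) : (fun s : R => nr (ez z s - ez z t)) @ t --> (0 : R).
Proof.
have [d1 d2 _ _] := ez_cC1 z 1 0.
apply: nr_Re_Im_continuous.
- have h : continuous (fun s : R => complex.Re (ez z (1 * (s - 0)))) by exact: derive_continuous d1.
  by move: (h t); under eq_fun do rewrite mul1r subr0.
- have h : continuous (fun s : R => complex.Im (ez z (1 * (s - 0)))) by exact: derive_continuous d2.
  by move: (h t); under eq_fun do rewrite mul1r subr0.
Qed.

End ComplexExponential.

Section AeInterval.
Context {R : realType}.
Let mu := @lebesgue_measure R.

(** An interval of positive length is not a null set. *)
Lemma ae_itv_ex (a b : R) (P : R -> Prop) : a < b ->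
  {ae mu, forall t, t \in `]a, b[ -> P t} -> exists2 t, a < t < b & P t.
Proof.
move=> ab [N [mN N0 PN]]; apply: contrapT => hex.
have sub : `]a, b[ `<=` N.
  move=> t tab; apply: PN => /= h; apply: hex; exists t; first by move: tab; rewrite /= in_itv.
  exact: h.
have h : (mu `]a, b[ <= mu N)%E by apply: le_measure => //; rewrite inE.
have e : mu `]a, b[%classic = (b - a)%:E.
  by have := @lebesgue_measure_itv R `]a, b[; rewrite /= lte_fin ab -EFinB.
have : ((b - a)%:E <= 0%E :> \bar R)%E by rewrite -[X in (X <= _)%E]e -[X in (_ <= X)%E]N0.
by rewrite lee_fin leNgt subr_gt0 ab.
Qed.

End AeInterval.

Section Evolution.
Context {R : realType} (H : hilbert R) (D : set H) (A : H -> H).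
Hypothesis H_separable : separable H.
Hypothesis Asa : @selfadjoint R (hspace H) (graph_on D A).
Variable V : R -> H -> H.
Hypothesis Vgrp : expi_group (graph_on D A) V.
Let mu := @lebesgue_measure R.
Let hm : - 'i%C = 'i%C :> R[i] \/ - 'i%C = - 'i%C :> R[i]. Proof. by right. Qed.
Let hp : 'i%C = 'i%C :> R[i] \/ 'i%C = - 'i%C :> R[i]. Proof. by left. Qed.
Let Rm := resolvent D A (- 'i%C).
Let Rp := resolvent D A 'i%C.
Implicit Types (x y g h : H) (z c : R[i]) (s t a b sg : R) (u f w : R -> H).

(** The group e^{i(A - z)t}. *)
Definition Vz z t x : H := ez z t *: V t x.

Lemma Vz0 z x : Vz z 0 x = x.
Proof. by rewrite /Vz ez0 scale1r (grp0 Vgrp). Qed.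

Lemma VzD z s t x : Vz z (s + t) x = Vz z s (Vz z t x).
Proof. by rewrite /Vz (grpD Vgrp) (grpZ Vgrp) scalerA -ezD. Qed.

Lemma VzK z s t x : s + t = 0 -> Vz z s (Vz z t x) = x.
Proof. by move=> st; rewrite -VzD st Vz0. Qed.

Lemma Vz_add z t x y : Vz z t (x + y) = Vz z t x + Vz z t y.
Proof. by rewrite /Vz (grp_add Vgrp) scalerDr. Qed.

Lemma VzZ z t c x : Vz z t (c *: x) = c *: Vz z t x.
Proof. by rewrite /Vz (grpZ Vgrp) !scalerA mulrC. Qed.

Lemma VzN z t x : Vz z t (- x) = - Vz z t x.
Proof. by rewrite !oppE VzZ. Qed.

Lemma VzB z t x y : Vz z t (x - y) = Vz z t x - Vz z t y.
Proof. by rewrite Vz_add VzN. Qed.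

Lemma Vz_adj z t x y : dR (Vz z t x) y = dR x (Vz z^*%C (- t) y).
Proof. by rewrite /Vz dRcl (grp_adj Vgrp) (grpZ Vgrp) ezJ. Qed.

Lemma nr_Vz z t x : nr (Vz z t x) = expR (t * complex.Im z) * nr x.
Proof. by rewrite /Vz nrZ nr_ez (nr_grp Vgrp). Qed.

Lemma nr_Vz_le z t (l : R) x : `|t| <= l ->
  nr (Vz z t x) <= expR (l * `|complex.Im z|) * nr x.
Proof.
move=> tl; rewrite nr_Vz ler_wpM2r ?nr_ge0// ler_expR (le_trans (ler_norm _))//.
by rewrite normrM ler_wpM2r.
Qed.

Lemma Vz_dom z t g : D g -> D (Vz z t g) /\ A (Vz z t g) = Vz z t (A g).
Proof.
move=> Dg; have [DV AV] := grp_dom Vgrp t Dg.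
by split; [exact: (sa_domZ Asa)|rewrite /Vz (sa_opZ Asa)// AV].
Qed.

Lemma resolvent_Vz c z t x : c = 'i%C \/ c = - 'i%C ->
  resolvent D A c (Vz z t x) = Vz z t (resolvent D A c x).
Proof. by move=> hc; rewrite /Vz (resolventZ Asa hc) (resolvent_grp Asa Vgrp). Qed.

Lemma Vz_continuous z x : continuous (fun t => Vz z t x).
Proof.
move=> t; apply/cvg_nr0P.
have l1 : (fun s : R => nr (ez z s - ez z t) * nr x) @ t --> 0 * nr x.
  by apply: cvgMl; exact: ez_continuous.
have l2 : (fun s : R => nr (ez z t) * nr (V s x - V t x)) @ t --> nr (ez z t) * 0.
  by apply: cvgMr; apply/cvg_nr0P; exact: (grp_continuous Vgrp).
apply: (squeeze0 _ (cvgD l1 l2)); last by rewrite mul0r mulr0 addr0.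
apply: nearW => s; rewrite nr_ge0 /=.
have -> : Vz z s x - Vz z t x = (ez z s - ez z t) *: V s x + ez z t *: (V s x - V t x).
  by rewrite /Vz scalerBl scalerBr addrA subrK.
by apply: le_trans (ler_nrD _ _) _; rewrite !nrZ (nr_grp Vgrp).
Qed.

Lemma Vz_weak_continuous z sg a x h : continuous (fun t : R => dR (Vz z (sg * (t - a)) x) h).
Proof.
move=> t; apply: (@cvg_dR _ _ _ _ _ (fun t : R => Vz z (sg * (t - a)) x)).
apply: (@continuous_comp _ _ _ (fun t : R => sg * (t - a)) (fun t => Vz z t x)).
  exact: derive_continuous (is_derive_aff sg a) t.
exact: Vz_continuous.
Qed.

(** Stone's equation for e^{i(A - z)t}, with time running at speed sg from a. *)
Lemma orbit_vC1 z sg a g : D g -> vC1 (fun t => Vz z (sg * (t - a)) g)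
  (fun t => sg%:C *: ('i%C *: Vz z (sg * (t - a)) (A g) - ('i%C * z) *: Vz z (sg * (t - a)) g)).
Proof.
move=> Dg.
have vV : vC1 (fun t => V (sg * (t - a)) g) (fun t => (sg%:C * 'i%C) *: V (sg * (t - a)) (A g)).
  split.
  - move=> h t.
    have := @is_derive1_comp _ (fun s : R => dR (V s g) h) (fun s : R => sg * (s - a)) t _ _
       (grp_is_derive Vgrp h (sg * (t - a)) Dg) (is_derive_aff sg a t).
    move=> hd; apply: (is_derive_cast hd).
    by rewrite -scalerA dRZl mulrC.
  - move=> h t.
    apply: (@cvg_dR _ _ _ _ _ (fun t : R => (sg%:C * 'i%C) *: V (sg * (t - a)) (A g))).
    apply: cvgZr.
    apply: (@continuous_comp _ _ _ (fun t : R => sg * (t - a)) (fun t => V t (A g))).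
      exact: derive_continuous (is_derive_aff sg a) t.
    exact: (grp_continuous Vgrp).
  - move=> b c; exists (nr g + nr (sg%:C * 'i%C) * nr (A g)) => t _.
    rewrite nrZ !(nr_grp Vgrp); split; first by rewrite lerDl mulr_ge0 ?nr_ge0.
    by rewrite lerDr nr_ge0.
apply: eq_vC1 (vC1_scale (ez_cC1 z sg a) vV) => // t.
rewrite /Vz scalerBr !scalerA addrC; congr (_ + _).
  by congr (_ *: _); ring.
by rewrite -scaleNr; congr (_ *: _); ring.
Qed.

Lemma wmeas_Vz z sg a b d u : wmeas b d u -> wmeas b d (fun t => Vz z (sg * (t - a)) (u t)).
Proof.
move=> mu_ h.
have m2 : wmeas b d (fun t => Vz z^*%C ((- sg) * (t - a)) h).
  by move=> k; apply: measurable_funTS; apply: continuous_measurable_fun; exact: Vz_weak_continuous.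
apply: (eq_measurable_fun (fun t : R => dR (u t) (Vz z^*%C ((- sg) * (t - a)) h))).
  by move=> t _; rewrite Vz_adj mulNr.
exact: (wmeas_dR H_separable).
Qed.

Section Solution.
Variables (a b : R) (ab : a < b).
Let l := b - a.

Lemma itv_dist t : a <= t <= b -> `|t - a| <= l /\ `|a - t| <= l.
Proof.
move=> /andP[at_ tb]; rewrite (distrC a) ger0_norm ?subr_ge0//; split; rewrite lerB//.
Qed.

Lemma vL1_Vz z f : vL1 a b f -> vL1 a b (fun s => Vz z (a - s) (f s)).
Proof.
move=> [mf i_f].
have m : wmeas a b (fun s => Vz z (a - s) (f s)).
  by apply: eq_wmeas (wmeas_Vz z (-1) a mf) => t _; rewrite mulN1r opprB.
apply: (vL1_le H_separable m (rintgZ (expR (l * `|complex.Im z|)) i_f)) => x /andP[ax xb].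
by apply: nr_Vz_le; have [] := @itv_dist x _; first by rewrite !ltW.
Qed.

(** Duhamel's formula for i u' + (A - z) u = f, u(a) = u0. *)
Definition duhamel z f t : H := vint a t (fun s => Vz z (a - s) (f s)).
Definition sol z (u0 : H) f t : H := Vz z (t - a) (u0 - 'i%C *: duhamel z f t).

Lemma duhamel_prim z f : vL1 a b f -> is_prim a b (duhamel z f) (fun s => Vz z (a - s) (f s)).
Proof.
move=> hf; apply: eq_prim (vint_prim H_separable 0 (vL1_Vz z hf)) => // t _.
by rewrite add0r.
Qed.

Lemma duhamel_a z f : duhamel z f a = 0.
Proof.
have e : vL1 a a (fun s => Vz z (a - s) (f s)).
  split; first by move=> h; rewrite set_itvoo0; exact: measurable_fun_set0.
  by rewrite /rintg set_itvoo0; exact: integrable_set0.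
by apply: (vint_uniq H_separable e) => h; rewrite dR0l rint_empty.
Qed.

Lemma sol_a z (u0 : H) f : sol z u0 f a = u0.
Proof. by rewrite /sol duhamel_a scaler0 subr0 subrr Vz0. Qed.

Lemma data_prim z (u0 : H) f : vL1 a b f -> is_prim a b (fun t => u0 - 'i%C *: duhamel z f t)
  (fun s => - ('i%C *: Vz z (a - s) (f s))).
Proof.
move=> hf; have h := duhamel_prim z hf.
have h1 := primZ H_separable (- 'i%C) h.
have h2 := vC1_prim H_separable (ltW ab) (vC1_cst u0).
apply: eq_prim (primD H_separable h2 h1) => // t _; first by rewrite scaleNr.
by rewrite add0r scaleNr.
Qed.

(** The increments of w are bounded by those of the integral of |F|. *)
Lemma prim_continuous w F : is_prim a b w F -> {within `[a, b], continuous w}.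
Proof.
move=> wF; apply/subspace_continuousP => x /= xab.
apply/cvg_nrP => e e0.
have := rint_continuous (ltW ab) (proj2 wF.1) => /subspace_continuousP /(_ x xab).
move=> /cvgrPdist_lt /(_ e e0).
have near_in : \forall t \near within `[a, b]%classic (nbhs x), `[a, b]%classic t.
  by apply: withinT.
apply: filterS2 near_in => t /=; move: xab; rewrite !in_itv /= => /andP[ax xb] /andP[at_ tb].
apply: le_lt_trans; have [xt|/ltW tx] := leP x t.
  rewrite nr_distC (le_trans (nr_prim_le H_separable wF ax xt tb))//.
  by rewrite -(rint_nr_incr wF ax xt tb) distrC ler_norm.
rewrite (le_trans (nr_prim_le H_separable wF at_ tx xb))//.
by rewrite -(rint_nr_incr wF at_ tx xb) ler_norm.
Qed.

Lemma sol_continuous z (u0 : H) f : vL1 a b f -> {within `[a, b], continuous (sol z u0 f)}.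
Proof.
move=> hf; have := prim_continuous (data_prim z u0 hf).
set p := fun t => _ - _ => pc.
apply/subspace_continuousP => x /= xab.
have /subspace_continuousP /(_ x xab) /cvg_nr0P px := pc.
have l1 : (fun t : R => expR (l * `|complex.Im z|) * nr (p t - p x)) @ within `[a, b]%classic (nbhs x) -->
    expR (l * `|complex.Im z|) * 0 by apply: cvgMr; exact: px.
have l2 : (fun t : R => nr (Vz z (t - a) (p x) - Vz z (x - a) (p x))) @ within `[a, b]%classic (nbhs x) --> (0 : R).
  apply/cvg_nr0P; apply: cvg_within_filter.
  apply: (@continuous_comp _ _ _ (fun t : R => t - a) (fun t => Vz z t (p x))).
    by apply: cvgB; [exact: cvg_id|exact: cvg_cst].
  exact: Vz_continuous.
apply/cvg_nr0P; apply: (squeeze0 _ (cvgD l1 l2)); last by rewrite mulr0 addr0.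
have near_in : \forall t \near within `[a, b]%classic (nbhs x), `[a, b]%classic t.
  by apply: withinT.
apply: filterS near_in => t /=; rewrite in_itv /= => tab.
rewrite nr_ge0 /=.
have -> : sol z u0 f t - sol z u0 f x =
    Vz z (t - a) (p t - p x) + (Vz z (t - a) (p x) - Vz z (x - a) (p x)).
  by rewrite VzB addrA subrK.
apply: le_trans (ler_nrD _ _) _; rewrite lerD2r.
by apply: nr_Vz_le; have [] := itv_dist tab.
Qed.

Lemma sol_L2 z (u0 : H) f : vL1 a b f -> L2fun a b (sol z u0 f).
Proof.
move=> hf; have hp_ := data_prim z u0 hf.
refine (@L2_bounded _ _ H_separable _ _ _ (expR (l * `|complex.Im z|) *
  (nr (u0 - 'i%C *: duhamel z f a) + rint a b (fun r : R => nr (- ('i%C *: Vz z (a - r) (f r)))))) _ _).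
  apply: eq_wmeas (wmeas_Vz z 1 a (prim_wmeas H_separable hp_ (ltW ab))) => t _.
  by rewrite mul1r.
move=> x /andP[/ltW ax /ltW xb].
apply: le_trans (nr_Vz_le _ _ (itv_dist _).1) _; first by rewrite ax xb.
rewrite ler_wpM2l ?expR_ge0//.
exact: (prim_bounded H_separable hp_ ax xb).
Qed.

(** The formula solves the equation: pair it with (A + i)^-1 h moved to the other
    side by the adjoint group, where it is a C^1 path, and integrate by parts. *)
Lemma sol_prim z (u0 : H) f : vL1 a b f ->
  is_prim a b (fun t => Rm (sol z u0 f t))
    (resolvent_rhs D A (sol z u0 f) (fun t => f t + z *: sol z u0 f t)).
Proof.
move=> hf; set u := sol z u0 f; pose p t := u0 - 'i%C *: duhamel z f t.
have hu : vL1 a b u by apply: L2_vL1 => //; exact: sol_L2.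
have hfu : vL1 a b (fun t => f t + z *: u t) by apply: vL1D => //; exact: vL1Z.
split; first exact: (vL1_resolvent_rhs H_separable Asa).
move=> s t as_ st tb h.
have [Dg Ag] := resolventP Asa hp h; set g := resolvent D A 'i%C h in Dg Ag.
have hy : is_prim s t (fun r => Vz z^*%C (-1 * (r - a)) g) _ :=
  vC1_prim H_separable st (orbit_vC1 z^*%C (-1) a Dg).
have hp_ := is_primS as_ tb (data_prim z u0 hf).
have [_] := prim_by_parts H_separable st hp_ hy.
have uE r : dR (p r) (Vz z^*%C (-1 * (r - a)) g) = dR (Rm (u r)) h.
  rewrite (resolvent_adj Asa) -/g /u /sol Vz_adj; congr (dR _ (Vz _ _ _)); ring.
set I := rint _ _ _; rewrite !uE -dRBl => ->; apply: eq_rint => r /andP[sr rt].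
have uE2 k : dR (p r) (Vz z^*%C (-1 * (r - a)) k) = dR (u r) k.
  by rewrite /u /sol Vz_adj; congr (dR _ (Vz _ _ _)); ring.
have -> : dR (- ('i%C *: Vz z (a - r) (f r))) (Vz z^*%C (-1 * (r - a)) g) =
   dR (- ('i%C *: Rm (f r))) h.
  rewrite !dRNl -VzZ Vz_adj VzK; last by ring.
  by rewrite -(resolventZ Asa hm) (resolvent_adj Asa).
rewrite -/(p r) -!VzZ -VzB -VzZ uE2.
have -> : A g = h - 'i%C *: g by rewrite -Ag addrK.
have Rg x : dR x g = dR (Rm x) h by rewrite (resolvent_adj Asa).
rewrite rmorphN rmorph1 scaleN1r dRNr dRBr scalerBr dRBr scalerA -expr2 sqr_i scaleN1r dRNr.
have -> : dR (u r) ('i%C *: h) = - dR ('i%C *: u r) h by rewrite dRii opprK.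
have -> : dR (u r) (('i%C * z^*%C) *: g) = - dR ('i%C *: Rm (z *: u r)) h.
  rewrite -(resolventZ Asa hm) scalerA -Rg -dRNl -scaleNr [RHS]dRcl; congr (dR _ (_ *: _)).
  by case: (z) => zx zy; apply/eqP; rewrite eq_complex /=; apply/andP; split; apply/eqP; ring.
rewrite Rg /resolvent_rhs /= (resolventD Asa hm) -/Rm scalerDr !dRBl dRDl !dRNl.
ring.
Qed.

(** Conversely, with m = (A - i)^-1 u and y a C^1 orbit of the adjoint group, the
    derivative of (m, y) only involves f; so m, hence u, is given by Duhamel's
    formula. *)
Lemma sol_unique z u f w : vL1 a b u -> vL1 a b f ->
  is_prim a b w (resolvent_rhs D A u (fun t => f t + z *: u t)) ->
  {ae mu, forall t, t \in `]a, b[ -> Rm (u t) = w t} ->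
  exists u0 : H, {ae mu, forall t, t \in `]a, b[ -> u t = sol z u0 f t}.
Proof.
move=> hu hf wF mw; pose q := duhamel z f.
have main t : a <= t -> t <= b -> Vz z (a - t) (w t) = w a - 'i%C *: Rm (q t).
  move=> at_ tb; apply/eqP; rewrite -subr_eq0; apply/eqP; apply: (sa_dense Asa) => g Dg.
  have hy : is_prim a t (fun r => Vz z^*%C (1 * (r - a)) g) _ :=
    vC1_prim H_separable at_ (orbit_vC1 z^*%C 1 a Dg).
  have wFt := is_primS (lexx a) tb wF.
  have [ig] := prim_by_parts H_separable at_ wFt hy.
  have -> : dR (w t) (Vz z^*%C (1 * (t - a)) g) = dR (Vz z (a - t) (w t)) g.
    by rewrite Vz_adj; congr (dR _ (Vz _ _ _)); ring.
  rewrite mul1r subrr Vz0 => e.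
  rewrite dRBl dRBl opprB addrCA addrC e.
  have hq : vL1 a t (fun s => 'i%C *: Vz z (a - s) (f s)).
    by apply: vL1S (vL1Z H_separable 'i%C (vL1_Vz z hf)).
  have -> : dR ('i%C *: Rm (q t)) g = rint a t (fun s => dR ('i%C *: Vz z (a - s) (f s)) (Rp g)).
    rewrite -(resolventZ Asa hm) (resolvent_adj Asa) dRcl /q /duhamel vintP//; last first.
      by apply: vL1S (vL1_Vz z hf).
    by apply: eq_rint => s _; rewrite [RHS]dRcl.
  rewrite -rintD; [|exact: ig|exact: vL1_dR].
  rewrite -[RHS](rint0 a t); apply: ae_eq_rint.
  - exact: rintg_meas (rintgD ig (vL1_dR H_separable _ hq)).
  - exact: measurable_cst.
  apply: aeS mw => r hr; rewrite in_itv /= => /andP[ar rt].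
  have {}hr : Rm (u r) = w r by apply: hr; rewrite in_itv /= ar (lt_le_trans rt tb).
  rewrite mul1r; set Y := Vz z^*%C (r - a) g.
  have [DY AY] := Vz_dom z^*%C (r - a) Dg; rewrite -/Y in DY AY.
  rewrite -AY rmorph1 scale1r -hr.
  have RY : resolvent D A 'i%C (A Y) = Y - 'i%C *: Rp Y.
    rewrite -[A Y](addrK ('i%C *: Y)) (resolventB Asa hp) (resolventK Asa hp DY).
    by rewrite (resolventZ Asa hp).
  have e1 : dR (Rm (u r)) ('i%C *: A Y) = - dR ('i%C *: u r) Y + dR (Rm (u r)) Y.
    have -> : dR (Rm (u r)) ('i%C *: A Y) = - dR (Rm ('i%C *: u r)) (A Y).
      by rewrite /Rm (resolventZ Asa hm) dRii opprK.
    rewrite (resolvent_adj Asa) RY dRBr dRi opprB addrC; congr (_ + _).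
    by rewrite (resolvent_adj Asa).
  have e2 : dR (Rm (u r)) (('i%C * z^*%C) *: Y) = - dR ('i%C *: Rm (z *: u r)) Y.
    rewrite /Rm (resolventZ Asa hm) [in RHS]scalerA -dRNl -scaleNr [RHS]dRcl; congr (dR _ (_ *: _)).
    by case: (z) => zx zy; apply/eqP; rewrite eq_complex /=; apply/andP; split; apply/eqP; ring.
  have e3 : dR ('i%C *: Vz z (a - r) (f r)) (Rp g) = dR ('i%C *: Rm (f r)) Y.
    rewrite -(resolventZ Asa hm) (resolvent_adj Asa) -VzZ Vz_adj opprB /Y.
    by rewrite (resolvent_Vz _ _ _ hp).
  rewrite e3 dRBr e1 e2 /resolvent_rhs /= (resolventD Asa hm) -/Rm scalerDr !dRBl dRDl.
  ring.
have [t0 /andP[at0 t0b] ht0] := ae_itv_ex ab mw.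
pose u0 := Vz z (a - t0) (u t0) + 'i%C *: q t0.
have Ru0 : Rm u0 = w a.
  rewrite /u0 /Rm (resolventD Asa hm) (resolvent_Vz _ _ _ hm) (resolventZ Asa hm).
  by rewrite -/Rm ht0 main ?ltW// subrK.
exists u0; apply: aeS mw => t ht tab; move: (tab); rewrite in_itv /= => /andP[at_ tb].
have : Rm (Vz z (a - t) (u t)) = Rm (u0 - 'i%C *: q t).
  rewrite /Rm (resolvent_Vz _ _ _ hm) (resolventB Asa hm) (resolventZ Asa hm) -/Rm Ru0 ht//.
  by rewrite main ?ltW.
move=> /(resolvent_inj Asa hm) e.
by rewrite /sol -/q -e VzK//; ring.
Qed.

End Solution.
End Evolution.

(** * The boundary value problem *)

Section ContinuousRepresentative.
Context {R : realType} (H : hilbert R).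
Let mu := @lebesgue_measure R.

(** Points of coincidence are dense in [a, b]. *)
Lemma continuous_ae_eq (a b : R) (v v' : R -> H) : a < b ->
  {within `[a, b], continuous v} -> {within `[a, b], continuous v'} ->
  {ae mu, forall t, t \in `]a, b[ -> v t = v' t} ->
  forall x, a <= x <= b -> v x = v' x.
Proof.
move=> ab /subspace_continuousP cv /subspace_continuousP cv' vv' x xab.
have xin : `[a, b]%classic x by rewrite /= in_itv.
apply/eqP; rewrite -subr_eq0 -nr_eq0 -(inj_eq (@addIr _ 0)) addr0 addr0 eq_le nr_ge0 andbT.
apply/ler_addgt0Pr => e e0; rewrite add0r.
have e2 : 0 < e / 2 by rewrite divr_gt0.
have /cvg_nrP /(_ _ e2) n1 := cv x xin.
have /cvg_nrP /(_ _ e2) n2 := cv' x xin.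
have [/= d d0 hd] := filterI n1 n2.
have lt : Num.max a (x - d) < Num.min b (x + d).
  have d0' : (0 : R) < d := d0; move: xab => /andP[ax xb].
  by rewrite lt_min !gt_max; apply/andP; split; apply/andP; split; lra.
have vv2 : {ae mu, forall t, t \in `](Num.max a (x - d)), (Num.min b (x + d))[ -> v t = v' t}.
  apply: aeS vv' => t h; rewrite in_itv /= gt_max lt_min => /andP[/andP[at_ _] /andP[tb _]].
  by apply: h; rewrite in_itv /= at_ tb.
have [t tb vt] := ae_itv_ex lt vv2.
move: tb; rewrite gt_max lt_min => /andP[/andP[at_ xt] /andP[tb tx]].
have [] := hd t _ _.
- by rewrite /ball /= ltr_distlC; apply/andP; split.
- by rewrite /= in_itv /= !ltW.
rewrite /from_subspace vt => h1 h2.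
rewrite -(subrK (v' t) (v x)) -addrA; apply: le_trans (ler_nrD _ _) _.
by rewrite [e]splitr lerD// ltW// nr_distC.
Qed.

End ContinuousRepresentative.

(** ** Unitary operators *)

Section UnitaryOperator.
Context {R : realType} (H : hilbert R).
Implicit Types (x y k : H) (c m : R[i]) (T U : H -> H).

Lemma unitaryD T x y : unitary T -> T (x + y) = T x + T y.
Proof. by case=> Tl _ _; have := Tl 1 x y; rewrite !scale1r. Qed.

Lemma unitary0 T : unitary T -> T 0 = 0.
Proof. by move=> hT; apply: (addrI (T 0)); rewrite -(unitaryD _ _ hT) !addr0. Qed.

Lemma unitaryZ T c x : unitary T -> T (c *: x) = c *: T x.
Proof. by move=> hT; case: (hT) => Tl _ _; have := Tl c x 0; rewrite (unitary0 hT) !addr0. Qed.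

Lemma unitaryB T x y : unitary T -> T (x - y) = T x - T y.
Proof. by move=> hT; rewrite (unitaryD _ _ hT) !oppE (unitaryZ _ _ hT). Qed.

Lemma unitary_dR T x y : unitary T -> dR (T x) (T y) = dR x y.
Proof. by case=> _ Td _; rewrite /dR Td. Qed.

Lemma nr_unitary T x : unitary T -> nr (T x) = nr x.
Proof.
by move=> hT; apply/eqP; rewrite -(@eqrXn2 _ 2) ?nr_ge0// -!dRxx (unitary_dR _ _ hT).
Qed.

Lemma unitary_inj T : unitary T -> injective T.
Proof.
move=> hT x y e; apply/eqP; rewrite -subr_eq0 -nr_eq0 -(nr_unitary _ hT).
by rewrite (unitaryB _ _ hT) e subrr nr0.
Qed.

Lemma unitary_quotient W U T : unitary W -> unitary U -> (forall x, W (T x) = U x) -> unitary T.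
Proof.
move=> hW hU WT; have Wi := unitary_inj hW; have [Wl Wd Ws] := hW; have [Ul Ud Us] := hU.
split.
- by move=> c x y; apply: Wi; rewrite WT Ul Wl !WT.
- by move=> x y; rewrite -Wd !WT Ud.
- by move=> y; have [x xy] := Us (W y); exists x; apply: Wi; rewrite WT.
Qed.

(** Membership in the resolvent set of an everywhere defined operator, see
    [resolvent_set_graph]. *)
Definition regular T m : Prop := (forall k, exists x, T x - m *: x = k) /\
  exists c : R, forall x, nr x <= c * nr (T x - m *: x).

Lemma snorm_hspace (x : hspace H) : snorm x = nr (x : H).
Proof.
have e : complex.Re (sdot x x) = nr (x : H) ^+ 2 := dRxx (x : H).
by rewrite /snorm e sqrtr_sqr ger0_norm ?nr_ge0.
Qed.

Lemma resolvent_set_graph T m :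
  resolvent_set (X := hspace H) (graph_on setT T) m <-> regular T m.
Proof.
split=> [[hs [c hc]]|[hs [c hc]]]; split.
- move=> k; have [[x y] [[/= _ ->] e]] := hs k I; exists x.
  by move: e; rewrite /same_vec snorm_hspace => /eqP; rewrite nr_eq0 subr_eq0 => /eqP.
- exists c => x; have := hc (x, T x); rewrite !snorm_hspace; apply.
  by split.
- move=> k _; have [x e] := hs k; exists (x, T x); split; first by split.
  by rewrite /same_vec snorm_hspace /= e subrr nr0.
- by exists c => -[x y] [/= _ ->]; rewrite !snorm_hspace.
Qed.

(** |Tx - mx| >= |1 - |m|| |x|, and a vector h = Tk orthogonal to the range of T - m
    satisfies k = m^* h, so that |h| = |m| |h|. *)
Lemma unitary_regular T m : unitary T -> nr m != 1 -> regular T m.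
Proof.
move=> hT m1; pose d := `|1 - nr m|.
have d0 : 0 < d by rewrite normr_gt0 subr_eq0 eq_sym.
have low x : d * nr x <= nr (T x - m *: x).
  rewrite /d -[X in _ * X <= _]ger0_norm ?nr_ge0// -normrM mulrBl mul1r -nrZ -{1}(nr_unitary x hT).
  exact: ler_nr_dist.
have low' x : nr x <= d^-1 * nr (T x - m *: x).
  by rewrite -(ler_pM2l d0) mulrA divff ?gt_eqF// mul1r.
split; last by exists d^-1.
move=> k; pose G : set (H * H) := [set p | p.2 = T p.1 - m *: p.1].
have GE x y : G (x, y) <-> y = T x - m *: x by [].
have [||||||x xk] := @closed_range _ H H G d^-1 _ _ _ _ _ _ k; last by exists x; exact: esym xk.
- by apply/GE; rewrite (unitary0 hT) scaler0 subr0.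
- move=> x x' y y' /GE -> /GE ->; apply/GE; rewrite (unitaryD _ _ hT) scalerDr opprD !addrA.
  by congr (_ - _); rewrite addrAC.
- move=> r x y /GE ->; apply/GE; rewrite (unitaryZ _ _ hT) scalerBr; congr (_ - _).
  by rewrite !scalerA mulrC.
- move=> u v x y Guv ux vy; apply/GE.
  apply: (cvg_uniq vy).
  apply: (@cvg_ext _ _ _ (fun n => T (u n) - m *: u n)) => [n|]; first exact/esym/GE/Guv.
  apply: cvgB; last exact: cvgZr.
  apply/cvg_nr0P; have /cvg_nr0P := ux; apply: cvg_ext => n.
  by rewrite -(unitaryB _ _ hT) (nr_unitary _ hT).
- by move=> x y /GE ->; exact: low'.
- move=> h horth; have [_ _ /(_ h) [k0 Tk]] := hT.
  have e : k0 = m^*%C *: h.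
    apply: dR_ext => x; have := horth x (T x - m *: x) erefl.
    rewrite dRBr -{1}Tk (unitary_dR _ _ hT) => /eqP; rewrite subr_eq0 => /eqP ->.
    by rewrite dRcl conjcK.
  apply/eqP; rewrite -nr_eq0; have : nr h = nr m * nr h.
    by rewrite -{1}Tk (nr_unitary _ hT) e nrZ nrJ.
  move=> /eqP; rewrite -subr_eq0 -{1}[nr h]mul1r -mulrBl mulf_eq0 subr_eq0 eq_sym.
  by rewrite (negbTE m1).
Qed.

End UnitaryOperator.

(** ** Symmetry, selfadjointness and the resolvent set *)

Section BoundaryValueProblem.
Context {R : realType} (H : hilbert R) (D : set H) (A : H -> H).
Hypothesis H_separable : separable H.
Hypothesis Asa : @selfadjoint R (hspace H) (graph_on D A).
Variable V : R -> H -> H.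
Hypothesis Vgrp : expi_group (graph_on D A) V.
Variables (a b : R) (ab : a < b) (W : H -> H).
Hypothesis W_unitary : unitary W.
Let mu := @lebesgue_measure R.
Let l := b - a.
Let Rm := resolvent D A (- 'i%C).
Implicit Types (x y h k : H) (z c : R[i]) (s t r : R) (u v f g w : R -> H).

Let l0 : 0 < l. Proof. by rewrite subr_gt0. Qed.
Let lge0 : 0 <= l. Proof. exact: ltW. Qed.
Let leab : a <= b. Proof. exact: ltW. Qed.

(** The maximal operator in the form of [L2max_prim]. *)
Definition max_graph : set (L2space a b H * L2space a b H) :=
  [set p | [/\ L2fun a b p.1, L2fun a b p.2 &
    exists w, is_prim a b w (resolvent_rhs D A p.1 p.2) /\
      {ae mu, forall t, t \in `]a, b[ -> Rm (p.1 t) = w t}]].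

Definition bvp_graph : set (L2space a b H * L2space a b H) :=
  max_graph `&` [set p | boundary_condition a b W p.1].

Local Notation "u =ae v" := {ae mu, forall t, t \in `]a, b[ -> u t = v t}
  (at level 70).

Lemma ae_prim w F F' : vL1 a b F' -> F =ae F' -> is_prim a b w F -> is_prim a b w F'.
Proof.
move=> hF' FF' [hF wF]; split => // s t as_ st tb h; rewrite wF//.
apply: ae_eq_rint.
- exact: rintg_meas (vL1_dR H_separable h (vL1S as_ tb hF)).
- exact: rintg_meas (vL1_dR H_separable h (vL1S as_ tb hF')).
apply: aeS FF' => r e; rewrite in_itv /= => /andP[sr rt]; rewrite e//.
by rewrite in_itv /= (le_lt_trans as_ sr) (lt_le_trans rt tb).
Qed.

Lemma ae_sym u v : u =ae v -> v =ae u.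
Proof. by apply: aeS => t h /h ->. Qed.

Lemma ae_trans v u w : u =ae v -> v =ae w -> u =ae w.
Proof. by apply: aeS2 => t h h' tab; rewrite h// h'. Qed.

Lemma max_graph_ae u f u' f' : L2fun a b u' -> L2fun a b f' -> u =ae u' -> f =ae f' ->
  max_graph (u, f) -> max_graph (u', f').
Proof.
move=> hu' hf' uu' ff' [/= hu hf [w [wF mw]]]; split => //; exists w; split => /=.
  apply: (ae_prim _ _ wF); first by apply: (vL1_resolvent_rhs H_separable Asa); exact: L2_vL1.
  by apply: aeS2 uu' ff' => t e1 e2 tab; rewrite /resolvent_rhs e1// e2.
by apply: aeS2 uu' mw => t e1 e2 tab; rewrite -e1// e2.
Qed.

Lemma boundary_ae u u' : u =ae u' -> boundary_condition a b W u -> boundary_condition a b W u'.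
Proof.
move=> uu' [v [cv uv vW]]; exists v; split => //.
by apply: aeS2 uu' uv => t e1 e2 tab; rewrite -e1// e2.
Qed.

Lemma bvp_graph_ae u f u' f' : L2fun a b u' -> L2fun a b f' -> u =ae u' -> f =ae f' ->
  bvp_graph (u, f) -> bvp_graph (u', f').
Proof.
by move=> hu' hf' uu' ff' [h1 h2]; split; [exact: max_graph_ae h1|exact: boundary_ae h2].
Qed.

Local Notation soln := (sol V a).
Local Notation duh := (duhamel V a).
Local Notation Vz := (Vz V).

Lemma duhamelZD z c f g t : vL1 a b f -> vL1 a b g -> a <= t <= b ->
  duh z (fun s => c *: f s + g s) t = c *: duh z f t + duh z g t.
Proof.
move=> hf hg /andP[at_ tb].
have v1 := vL1S (lexx a) tb (vL1_Vz H_separable Vgrp z hf).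
have v2 := vL1S (lexx a) tb (vL1_Vz H_separable Vgrp z hg).
have e r : Vz z (a - r) (c *: f r + g r) = c *: Vz z (a - r) (f r) + Vz z (a - r) (g r).
  by rewrite (Vz_add Vgrp) (VzZ Vgrp).
have v3 := vL1D H_separable (vL1Z H_separable c v1) v2.
apply: (vint_uniq H_separable).
  by apply: eq_vL1 v3 => r _; rewrite e.
move=> h; rewrite dRDl dRcl /duhamel !(vintP H_separable)// -rintD; [|exact: vL1_dR|exact: vL1_dR].
by apply: eq_rint => r _; rewrite e dRDl; congr (_ + _); rewrite [RHS]dRcl.
Qed.

Lemma solZD z c (u0 v0 : H) f g t : vL1 a b f -> vL1 a b g -> a <= t <= b ->
  soln z (c *: u0 + v0) (fun s => c *: f s + g s) t = c *: soln z u0 f t + soln z v0 g t.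
Proof.
move=> hf hg tab; rewrite /sol duhamelZD// -(VzZ Vgrp) -(Vz_add Vgrp); congr (Vz _ _ _).
rewrite !scalerBr !scalerDr !scalerA (mulrC 'i%C) opprD !addrA; congr (_ - _).
by rewrite addrAC.
Qed.

(** Solutions of i u' + (A - z) u = f are given by Duhamel's formula, so the boundary
    condition is an equation for the initial value. *)
Lemma bvp_graphP z u f : L2fun a b u -> L2fun a b f ->
  bvp_graph (u, fun t => f t + z *: u t) <->
  exists2 u0 : H, u =ae soln z u0 f & soln z u0 f b = W u0.
Proof.
move=> hu hf; have lf := L2_vL1 H_separable hf; have lu := L2_vL1 H_separable hu.
split=> [[[/= _ _ [w [wF mw]]] [v [cv uv vW]]]|[u0 us bc]].
  have [u0 us] := sol_unique H_separable Asa Vgrp ab lu lf wF mw.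
  exists u0 => //.
  have cs : {within `[a, b], continuous (soln z u0 f)} 
    := @sol_continuous _ _ D A H_separable V Vgrp a b ab z u0 f lf.
  have e := continuous_ae_eq ab cv cs (ae_trans (ae_sym uv) us).
  by rewrite -e ?leab ?lexx// vW e ?leab ?lexx// (sol_a H_separable Vgrp).
have hs : L2fun a b (soln z u0 f) := sol_L2 H_separable Vgrp ab z u0 lf.
have hfz v : L2fun a b v -> L2fun a b (fun t => f t + z *: v t).
  by move=> hv; apply: L2D => //; exact: L2Z.
split.
  apply: (@max_graph_ae (soln z u0 f) (fun t => f t + z *: soln z u0 f t)) => //=.
  - exact: hfz.
  - exact: ae_sym.
  - by apply: aeS us => t e tab; rewrite e.
  split => //=; first exact: hfz.
  exists (fun t => Rm (soln z u0 f t)); split; last exact: aeW.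
  exact: (sol_prim H_separable Asa Vgrp ab).
exists (soln z u0 f); split => //.
  exact: (@sol_continuous _ _ D A H_separable V Vgrp a b ab z u0 f lf).
by rewrite bc (sol_a H_separable Vgrp).
Qed.

Lemma bvp_graph0P u f : bvp_graph (u, f) <-> [/\ L2fun a b u, L2fun a b f &
  exists2 u0 : H, u =ae soln 0 u0 f & soln 0 u0 f b = W u0].
Proof.
have e : (fun t => f t + 0 *: u t) = f by apply/funext => t; rewrite scale0r addr0.
split=> [h|[hu hf h]].
  have [[hu hf _] _] := h; split => //; apply/bvp_graphP => //.
  by rewrite e.
by have /(bvp_graphP 0 hu hf) := h; rewrite e.
Qed.

Lemma bvp_graph_lin c u f v g : bvp_graph (u, f) -> bvp_graph (v, g) ->
  bvp_graph (fun t => c *: u t + v t, fun t => c *: f t + g t).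
Proof.
move=> /bvp_graph0P[hu hf [u0 us uW]] /bvp_graph0P[hv hg [v0 vs vW]].
have lf := L2_vL1 H_separable hf; have lg := L2_vL1 H_separable hg.
apply/bvp_graph0P; split; [by apply: L2D => //; exact: L2Z|by apply: L2D => //; exact: L2Z|].
exists (c *: u0 + v0).
  apply: aeS2 us vs => t e1 e2 tab; rewrite solZD// ?e1 ?e2//.
  by move: tab; rewrite in_itv /= => /andP[/ltW-> /ltW->].
by rewrite solZD ?leab ?lexx// uW vW; have [-> _ _] := W_unitary.
Qed.

Lemma bvp_graph_zero : bvp_graph ((fun=> 0), (fun=> 0)).
Proof.
have h0 := L2_cst0 H_separable a b; have l0' := L2_vL1 H_separable h0.
have s0 t : a <= t <= b -> soln 0 0 (fun=> 0) t = 0.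
  move=> tab; have := @solZD 0 (-1) 0 0 _ _ t l0' l0' tab.
  have -> : (fun _ : R => -1 *: (0 : H) + 0) = (fun=> 0) by apply/funext => s; rewrite scaler0 addr0.
  by rewrite scaler0 addr0 scaleN1r addNr.
apply/bvp_graph0P; split => //; exists 0.
  by apply: aeW => t tab; rewrite s0//; move: tab; rewrite in_itv /= => /andP[/ltW-> /ltW->].
rewrite s0 ?leab ?lexx//; have [Wl _ _] := W_unitary.
by have := Wl (-1) 0 0; rewrite !scaleN1r oppr0 addr0 => ->; rewrite addNr.
Qed.

(** By Duhamel's formula u(t) = V(t - a) p(t) with p' = -i V(a - t) f, so pairing
    with a second solution leaves an integral of (if, v) - (iu, g) and the boundary
    term (p(b), q(b)) - (p(a), q(a)). That term vanishes as W is isometric. *)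
Lemma bvp_graph_green u f v g : bvp_graph (u, f) -> bvp_graph (v, g) ->
  rint a b (fun t => dR (f t) (v t)) = rint a b (fun t => dR (u t) (g t)).
Proof.
have main u' f' : bvp_graph (u', f') -> bvp_graph (v, g) ->
    rint a b (fun t => dR ('i%C *: f' t) (v t)) = rint a b (fun t => dR ('i%C *: u' t) (g t)).
  move=> /bvp_graph0P[hu hf [u0 us uW]] /bvp_graph0P[hv hg [v0 vs vW]].
  have lf := L2_vL1 H_separable hf; have lg := L2_vL1 H_separable hg.
  have pp := data_prim H_separable Vgrp ab 0 u0 lf.
  have pq := data_prim H_separable Vgrp ab 0 v0 lg.
  have Vzdot t x y : dR (Vz 0 t x) (Vz 0 t y) = dR x y.
    by rewrite (Vz_adj Vgrp) conjc0 (VzK Vgrp)// addNr.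
  have bterm : dR (u0 - 'i%C *: duh 0 f' b) (v0 - 'i%C *: duh 0 g b) = dR u0 v0.
    rewrite -(Vzdot l) -/(soln 0 u0 f' b) -/(soln 0 v0 g b) uW vW.
    by rewrite /dR; have [_ -> _] := W_unitary.
  have [ig /=] := prim_by_parts H_separable leab pp pq.
  set I := rint a b _.
  rewrite bterm !(duhamel_a H_separable) scaler0 !subr0 subrr => /esym e.
  have L1 := L2_dR H_separable (L2Z H_separable 'i%C hf) hv.
  have L2 := L2_dR H_separable (L2Z H_separable 'i%C hu) hg.
  apply/eqP; rewrite -subr_eq0 -rintB// -oppr_eq0 -[X in _ == X]e /I; apply/eqP.
  rewrite -mulN1r -rintZ; last exact: rintgB.
  apply: ae_eq_rint.
  - exact: rintg_meas (rintgZ _ (rintgB L1 L2)).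
  - exact: rintg_meas ig.
  apply: aeS2 us vs => t e1 e2 tab; rewrite e1// e2// /sol.
  rewrite -!(VzZ Vgrp); set p := u0 - _; set q := v0 - _.
  rewrite !dRNl dRNr.
  have -> : dR (Vz 0 (a - t) ('i%C *: f' t)) q = dR ('i%C *: f' t) (Vz 0 (t - a) q).
    by rewrite (Vz_adj Vgrp) conjc0 opprB.
  have -> : dR p (Vz 0 (a - t) ('i%C *: g t)) = - dR (Vz 0 (t - a) ('i%C *: p)) (g t).
    by rewrite [in RHS](VzZ Vgrp) dRii opprK (Vz_adj Vgrp 0 (t - a)) conjc0 opprB.
  ring.
move=> hu hv.
have e : (fun t => (- 'i%C) *: u t + 0) = (fun t => (- 'i%C) *: u t).
  by apply/funext => t; rewrite addr0.
have e' : (fun t => (- 'i%C) *: f t + 0) = (fun t => (- 'i%C) *: f t).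
  by apply/funext => t; rewrite addr0.
have := main _ _ _ hv; move=> /(_ (fun t => (- 'i%C) *: u t) (fun t => (- 'i%C) *: f t)).
have -> : (fun t => dR ('i%C *: ((- 'i%C) *: f t)) (v t)) = (fun t => dR (f t) (v t)).
  by apply/funext => t; rewrite scalerA mulrN -expr2 sqr_i opprK scale1r.
have -> : (fun t => dR ('i%C *: ((- 'i%C) *: u t)) (g t)) = (fun t => dR (u t) (g t)).
  by apply/funext => t; rewrite scalerA mulrN -expr2 sqr_i opprK scale1r.
apply; have := bvp_graph_lin (- 'i%C) hu bvp_graph_zero.
by rewrite e e'.
Qed.

Lemma bvp_graph_symmetric u f v g : bvp_graph (u, f) -> bvp_graph (v, g) ->
  cint a b (fun t => dot (f t) (v t)) = cint a b (fun t => dot (u t) (g t)).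
Proof.
move=> hu hv; rewrite !cint_dot; congr (_ +i* _); first exact: bvp_graph_green.
have hiv : bvp_graph (fun t => 'i%C *: v t + 0, fun t => 'i%C *: g t + 0).
  exact: (bvp_graph_lin 'i%C hv bvp_graph_zero).
rewrite (eq_rint (g := fun t => dR (f t) ('i%C *: v t + 0))); last by move=> t _; rewrite addr0.
rewrite (bvp_graph_green hu hiv).
by apply: eq_rint => t _; rewrite addr0.
Qed.

Lemma Vz_zero z t : Vz z t 0 = 0.
Proof. by have := VzZ Vgrp z t 0 0; rewrite !scale0r. Qed.

(** The continuous representative of u vanishes on [a, b], hence so do the increments
    of the Duhamel integral. *)
Lemma bvp_graph_single u f : bvp_graph (u, f) -> u =ae (fun=> 0) -> f =ae (fun=> 0).
Proof.
move=> /bvp_graph0P[hu hf [u0 us uW]] u00.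
have lf := L2_vL1 H_separable hf.
have cs : {within `[a, b], continuous (soln 0 u0 f)}
  := @sol_continuous _ _ D A H_separable V Vgrp a b ab 0 u0 f lf.
have c0 : {within `[a, b], continuous (fun=> 0 : H)} by move=> x; exact: cvg_cst.
have s0 := continuous_ae_eq ab cs c0 (ae_trans (ae_sym us) u00).
have p0 t : a <= t <= b -> u0 - 'i%C *: duh 0 f t = 0.
  move=> /s0; rewrite /sol => e.
  rewrite -[LHS](VzK Vgrp 0 (s := a - t) (t := t - a)); last by rewrite addrA subrK subrr.
  by rewrite e Vz_zero.
have [v1 h1] := data_prim H_separable Vgrp ab 0 u0 lf.
have : (fun s => - ('i%C *: Vz 0 (a - s) (f s))) =ae (fun=> 0).
  apply: (ae_vec0 H_separable) => h; apply: ae_eq0_of_rint.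
    exact: vL1_dR.
  move=> s t as_ st tb; rewrite -h1//.
  by rewrite !p0 ?subrr ?dR0l// ?as_ ?tb ?(le_trans as_ st) ?(le_trans st tb).
apply: aeS => t e tab; have /eqP := e tab.
rewrite oppr_eq0 -(VzZ Vgrp) => /eqP e'.
have : 'i%C *: f t = 0.
  rewrite -[LHS](VzK Vgrp 0 (s := t - a) (t := a - t)); last by rewrite addrA subrK subrr.
  by rewrite e' Vz_zero.
move=> /eqP; rewrite scaler_eq0 => /orP[|/eqP//].
by rewrite -nr_eq0 nri oner_eq0.
Qed.

Lemma snorm_ae (u v : L2space a b H) : L2fun a b u -> L2fun a b v -> u =ae v -> snorm u = snorm v.
Proof.
move=> hu hv uv; rewrite !snormE; congr Num.sqrt; apply: ae_eq_rint.
- exact: rintg_meas hu.2.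
- exact: rintg_meas hv.2.
by apply: aeS uv => t e tab; rewrite e.
Qed.

Lemma same_vec_ae (u v : L2space a b H) : L2fun a b u -> L2fun a b v ->
  same_vec u v <-> u =ae v.
Proof.
move=> hu hv; have huv : L2fun a b (fun t => u t - v t) by exact: L2B.
have -> : same_vec u v <-> (fun t => u t - v t) =ae (fun=> 0) := snorm_eq0 huv.
split; first by apply: aeS => t h /h /eqP; rewrite subr_eq0 => /eqP.
by apply: aeS => t h /h ->; rewrite subrr.
Qed.

(** Brings a pair of the graph to the form (u, f + zu) of [bvp_graphP]. *)
Lemma bvp_graph_shift z u g : bvp_graph (u, g) ->
  [/\ L2fun a b u, L2fun a b (fun t => g t - z *: u t) &
    bvp_graph (u, fun t => (g t - z *: u t) + z *: u t)].
Proof.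
move=> hug; have [[hu hg _] _] := hug; split => //.
  by apply: L2B => //; exact: L2Z.
by rewrite (_ : (fun t => _) = g)//; apply/funext => t; rewrite subrK.
Qed.

Variable T : H -> H.
Hypothesis WT : forall x, W (T x) = V l x.

Let T_unitary : unitary T.
Proof. by apply: (unitary_quotient W_unitary _ WT); have [+ _ _ _ _] := Vgrp; apply. Qed.

(** The value at b is e^{-izl} V l (u0 - iq), q the Duhamel integral, and V l = W T. *)
Lemma sol_boundary z (u0 : H) f :
  soln z u0 f b = W u0 <-> T u0 - ez z (- l) *: u0 = 'i%C *: T (duh z f b).
Proof.
have -> : soln z u0 f b = W (ez z l *: T (u0 - 'i%C *: duh z f b)).
  by rewrite (unitaryZ _ _ W_unitary) WT.
rewrite (unitaryB _ _ T_unitary) (unitaryZ _ _ T_unitary).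
split=> [/(unitary_inj W_unitary) e|e].
  rewrite -{2}e scalerA -ezD addNr ez0 scale1r opprB addrC subrK //.
congr W; rewrite -e opprB addrC subrK scalerA -ezD addrN ez0 scale1r //.
Qed.

Let M z := expR (l * `|complex.Im z|).

Let M0 z : 0 <= M z. Proof. exact: expR_ge0. Qed.

Lemma nr_duhamel_le z f t : vL1 a b f -> a <= t <= b ->
  nr (duh z f t) <= M z * rint a b (fun s => nr (f s)).
Proof.
move=> hf /andP[at_ tb].
have v1 := vL1S (lexx a) tb (vL1_Vz H_separable Vgrp z hf).
have v2 := vL1S (lexx a) tb hf.
apply: le_trans (nr_vint_le H_separable v1) _.
apply: (@le_trans _ _ (M z * rint a t (fun s => nr (f s)))).
  rewrite -rintZ; last exact: v2.2.
  apply: le_rint; [exact: v1.2|exact: rintgZ v2.2|move=> r /andP[ar rt]].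
  apply: (nr_Vz_le Vgrp); have [] := @itv_dist _ a b r _ => //.
  by rewrite !ltW// (lt_le_trans rt tb).
rewrite ler_wpM2l// (@rint_chasles _ a t b)//; last exact: hf.2.
by rewrite lerDl rint_ge0// => r _; exact: nr_ge0.
Qed.

Lemma nr_Vz_itv z t x : a <= t <= b ->
  nr (Vz z (t - a) x) <= M z * nr x /\ nr x <= M z * nr (Vz z (t - a) x).
Proof.
move=> /itv_dist[d1 d2]; split; first exact: (nr_Vz_le Vgrp).
rewrite -{1}(VzK Vgrp z x (s := a - t) (t := t - a)); last by rewrite addrA subrK subrr.
exact: (nr_Vz_le Vgrp).
Qed.

(** The forcing term along the orbit of k has Duhamel integral k at t = b: it turns
    the resolvent equation into an arbitrary equation for T. *)
Definition orbit_forcing z k (s : R) : H := Vz z (s - a) ((l^-1)%:C *: k).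

Lemma orbit_forcing_L2 z k : L2fun a b (orbit_forcing z k).
Proof.
refine (@L2_bounded _ _ H_separable _ _ _ (M z * nr ((l^-1)%:C *: k)) _ _).
  have hw := wmeas_Vz H_separable Vgrp z 1 a (wmeas_cst (s := a) (t := b) ((l^-1)%:C *: k)).
  by apply: eq_wmeas hw => t _; rewrite mul1r.
by move=> t /andP[/ltW at_ /ltW tb]; have [] := @nr_Vz_itv z t ((l^-1)%:C *: k) _; rewrite ?at_.
Qed.

Lemma duhamel_orbit_forcing z k t : a <= t <= b ->
  duh z (orbit_forcing z k) t = ((t - a) / l)%:C *: k.
Proof.
move=> /andP[at_ tb].
have hv := vL1S (lexx a) tb (vL1_Vz H_separable Vgrp z
  (L2_vL1 H_separable (orbit_forcing_L2 z k))).
apply: (vint_uniq H_separable hv) => h.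
rewrite (@eq_rint _ _ _ _ (fun=> l^-1 * dR k h)).
  by rewrite rint_cst// dRZl; ring.
move=> s _; rewrite /orbit_forcing (VzK Vgrp) ?dRZl//.
by rewrite addrA subrK subrr.
Qed.

Lemma duhamel_orbit_forcing_b z k : duh z (orbit_forcing z k) b = k.
Proof. by rewrite duhamel_orbit_forcing ?leab ?lexx// divff ?gt_eqF// scale1r. Qed.

Lemma forcing_vector k : exists2 k', 'i%C *: T k' = k & nr k' = nr k.
Proof.
have [_ _ /(_ k) [y Ty]] := T_unitary; exists ((- 'i%C) *: y).
  by rewrite (unitaryZ _ _ T_unitary) Ty scalerA mulrN -expr2 sqr_i opprK scale1r.
by rewrite nrZ nrN nri mul1r -Ty (nr_unitary _ T_unitary).
Qed.

(** The resolvent equation for L with right-hand side f is, by [sol_boundary], the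
    equation (T - e^{izl}) u0 = i T q for the initial value. From T to L, |q| is bounded
    by the L1 norm of f, and u by u0 and f. From L to T, the forcing term
    [orbit_forcing] makes i T q an arbitrary vector. *)
Lemma bvp_resolvent_set z :
  resolvent_set (X := L2space a b H) bvp_graph z <-> regular T (ez z (- l)).
Proof.
split=> [[onto [c hc]]|[onto [c hc]]]; split.
- move=> k; have [k' Tk' _] := forcing_vector k; pose f := orbit_forcing z k'.
  have hf : L2fun a b f := orbit_forcing_L2 z k'.
  have [|[u g] [hug /= e]] := onto f; first exact/square_integrableP.
  have [hu hg' _] := bvp_graph_shift z hug.
  have {}e : (fun t => g t - z *: u t) =ae f by apply/same_vec_ae.
  have huf : bvp_graph (u, fun t => f t + z *: u t).
    apply: (bvp_graph_ae _ _ _ _ hug) => //=.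
    - by apply: L2D => //; exact: L2Z.
    - exact: aeW.
    - by apply: aeS e => t e tab; rewrite -e// subrK.
  have /(bvp_graphP z hu hf) [u0 _ /sol_boundary bc] := huf.
  by exists u0; rewrite bc duhamel_orbit_forcing_b.
- pose C := 2 * M z ^+ 2 * c ^+ 2 * l^-1 ^+ 2 * M z ^+ 2 + 2 : R.
  have C0 : 0 <= C by apply: addr_ge0 => //; do 4! (apply: mulr_ge0; last exact: sqr_ge0).
  (* C collects the bounds [Nu], [Nf] and [Nx] below, divided by l. *)
  exists (Num.sqrt C) => x; set k := T x - _.
  have [k' Tk' nk'] := forcing_vector k; pose f := orbit_forcing z k'.
  have hf : L2fun a b f := orbit_forcing_L2 z k'.
  have lf := L2_vL1 H_separable hf.
  pose u : R -> H := soln z x f.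
  have hu : L2fun a b u := sol_L2 H_separable Vgrp ab z x lf.
  have huf : bvp_graph (u, fun t => f t + z *: u t).
    apply/bvp_graphP => //; exists x; first exact: aeW.
    by apply/sol_boundary; rewrite -/k duhamel_orbit_forcing_b.
  have Nu : snorm (u : L2space a b H) ^+ 2 <= c ^+ 2 * snorm (f : L2space a b H) ^+ 2.
    have := hc _ huf; rewrite /=.
    have -> : (fun t => f t + z *: u t) - z *: u = f by apply/funext => t; exact: addrK.
    move=> h; have := le_trans h (ler_norm _); rewrite -(@ler_pXn2r _ 2) ?nnegrE ?snorm_ge0//.
    by rewrite real_normK ?num_real// exprMn.
  have Nf : snorm (f : L2space a b H) ^+ 2 <= (M z * (l^-1 * nr k)) ^+ 2 * l.
    rewrite snorm_sqr -rint_cst//; apply: le_rint; [exact: hf.2|exact: rintg_cst|].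
    have P0 : 0 <= M z * (l^-1 * nr k) by rewrite !mulr_ge0 ?nr_ge0 ?invr_ge0.
    move=> t /andP[/ltW at_ /ltW tb]; rewrite lerXn2r ?nnegrE ?nr_ge0//.
    have tab : a <= t <= b by rewrite at_.
    have [+ _] := @nr_Vz_itv z t ((l^-1)%:C *: k') tab.
    by have -> : nr ((l^-1)%:C *: k') = l^-1 * nr k by rewrite nrZ nrR ger0_norm ?invr_ge0// nk'.
  (* Pointwise |x| <= M |u t| + |k|; squaring and integrating over [a, b] replaces
     the value x at the single point a by an L2 norm. *)
  have Nx : nr x ^+ 2 * l <= 2 * M z ^+ 2 * snorm (u : L2space a b H) ^+ 2 + 2 * nr k ^+ 2 * l.
    rewrite snorm_sqr -!rint_cst// -rintZ; last exact: hu.2.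
    rewrite -rintD; [|exact: rintgZ hu.2|exact: rintg_cst].
    apply: le_rint; [exact: rintg_cst| |].
      by apply: rintgD; [exact: rintgZ hu.2|exact: rintg_cst].
    move=> t /andP[/ltW at_ /ltW tb]; have tab : a <= t <= b by rewrite at_.
    have h1 : nr (x - 'i%C *: (((t - a) / l)%:C *: k')) <= M z * nr (u t).
      rewrite -(duhamel_orbit_forcing z k' tab).
      exact: (proj2 (nr_Vz_itv z (x - 'i%C *: duh z f t) tab)).
    have h2 : nr ('i%C *: (((t - a) / l)%:C *: k')) <= nr k.
      rewrite nrZ nri mul1r nrZ nrR nk' ger0_norm; last by rewrite divr_ge0 ?subr_ge0.
      by rewrite -[leRHS]mul1r ler_wpM2r ?nr_ge0// ler_pdivrMr// mul1r lerB.
    have h3 : nr x <= M z * nr (u t) + nr k.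
      apply: le_trans (lerD h1 h2); apply: le_trans (ler_nrD _ _).
      by rewrite subrK.
    move: h3 (nr_ge0 x) (nr_ge0 k) (mulr_ge0 (M0 z) (nr_ge0 (u t))).
    rewrite -mulrA -exprMn; move: (M z * nr (u t)) (nr k) (nr x) => p q r.
    move=> h p0 q0 r0; have := sqr_ge0 (p - q); nra.
  rewrite -(@ler_pXn2r _ 2) ?nnegrE ?nr_ge0 ?mulr_ge0 ?sqrtr_ge0 ?nr_ge0//.
  rewrite exprMn sqr_sqrtr// -(ler_pM2r l0); apply: le_trans Nx _.
  have M2 : 0 <= 2 * M z ^+ 2 by rewrite mulr_ge0// sqr_ge0.
  have := ler_wpM2l M2 (le_trans Nu (ler_wpM2l (sqr_ge0 c) Nf)).
  move=> h; apply: le_trans (lerD h (lexx _)) _.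
  by rewrite le_eqVlt /C; apply/orP; left; apply/eqP; ring.
- move=> f /(square_integrableP H_separable) hf; have lf := L2_vL1 H_separable hf.
  have [u0 bc] := onto ('i%C *: T (duh z f b)).
  pose u : R -> H := soln z u0 f.
  have hu : L2fun a b u := sol_L2 H_separable Vgrp ab z u0 lf.
  exists (u, fun t => f t + z *: u t); split.
    by apply/bvp_graphP => //; exists u0; [exact: aeW|exact/sol_boundary].
  apply/same_vec_ae => //=.
    have -> : (fun t => f t + z *: u t) - z *: u = f by apply/funext => t; exact: addrK.
    exact: hf.
  by apply: aeW => t _; exact: addrK.
- exists (M z ^+ 2 * (`|c| + 1) * l) => -[u g] hug.
  have [hu hf hus] := bvp_graph_shift z hug.
  pose f : R -> H := fun t => g t - z *: u t.
  have lf : vL1 a b f := L2_vL1 H_separable hf.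
  have /(bvp_graphP z hu hf) [u0 us /sol_boundary bc] := hus.
  have hs : L2fun a b (soln z u0 f) := sol_L2 H_separable Vgrp ab z u0 lf.
  pose J := rint a b (fun s => nr (f s)).
  have J0 : 0 <= J by apply: rint_ge0 => s _; exact: nr_ge0.
  have Ju : nr u0 <= `|c| * (M z * J).
    apply: le_trans (hc u0) _; rewrite bc nrZ nri mul1r (nr_unitary _ T_unitary).
    apply: (@le_trans _ _ (`|c| * nr (duh z f b))); first by rewrite ler_wpM2r ?nr_ge0 ?ler_norm.
    by rewrite ler_wpM2l//; apply: nr_duhamel_le; rewrite ?leab ?lexx.
  rewrite /= (snorm_ae hu hs us).
  have -> : g - z *: u = f :> (R -> H) by [].
  have Nf : J ^+ 2 <= l * snorm (f : L2space a b H) ^+ 2 := L1_le_L2 H_separable leab hf.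
  have K0 : 0 <= M z ^+ 2 * (`|c| + 1) by rewrite mulr_ge0 ?sqr_ge0 ?addr_ge0.
  rewrite -(@ler_pXn2r _ 2) ?nnegrE ?snorm_ge0//; last first.
    by rewrite mulr_ge0 ?snorm_ge0// mulr_ge0.
  apply: (@le_trans _ _ ((M z ^+ 2 * (`|c| + 1) * J) ^+ 2 * l)).
    rewrite snorm_sqr -rint_cst//; apply: le_rint; [exact: hs.2|exact: rintg_cst|].
    move=> t /andP[/ltW at_ /ltW tb]; have tab : a <= t <= b by rewrite at_.
    rewrite lerXn2r ?nnegrE ?nr_ge0 ?mulr_ge0//.
    apply: le_trans (proj1 (nr_Vz_itv _ _ tab)) _; rewrite expr2 -!mulrA ler_wpM2l//.
    apply: le_trans (ler_nrB _ _) _; rewrite nrZ nri mul1r.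
    apply: le_trans (lerD Ju (nr_duhamel_le z lf tab)) _.
    by rewrite le_eqVlt; apply/orP; left; apply/eqP; rewrite /J; ring.
  move: (M z ^+ 2 * _) (snorm _) Nf => C N Nf.
  have -> : (C * J) ^+ 2 * l = C ^+ 2 * (l * J ^+ 2) by ring.
  have -> : (C * l * N) ^+ 2 = C ^+ 2 * (l * (l * N ^+ 2)) by ring.
  by rewrite ler_wpM2l ?sqr_ge0// ler_wpM2l.
Qed.

(** For Im z <> 0 the number e^{izl} is off the unit circle. *)
Lemma nonreal_resolvent z : complex.Im z != 0 ->
  resolvent_set (X := L2space a b H) bvp_graph z.
Proof.
move=> z0; apply/bvp_resolvent_set; apply: unitary_regular T_unitary _.
rewrite nr_ez mulNr -expR0 (inj_eq (@expR_inj R)) oppr_eq0 mulf_eq0 negb_or z0 andbT.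
by rewrite gt_eqF.
Qed.

Lemma bvp_onto z f : complex.Im z != 0 -> L2fun a b f ->
  exists u g, bvp_graph (u, g) /\ (fun t => g t - z *: u t) =ae f.
Proof.
move=> /nonreal_resolvent[onto _] hf.
have [|[u g] [hug e]] := onto f; first exact/square_integrableP.
have [_ hg _] := bvp_graph_shift z hug.
by exists u, g; split => //; apply/same_vec_ae.
Qed.

(** As L - i and L + i are onto, a symmetric restriction has no room for a larger
    adjoint: subtract from (v, g) the solution of the same equation with z = i and
    test the difference against the solutions with z = -i. *)
Lemma bvp_adjoint_sub v g : L2fun a b v -> L2fun a b g ->
  (forall u f, bvp_graph (u, f) ->
    rint a b (fun t => dR (f t) (v t)) = rint a b (fun t => dR (u t) (g t))) ->
  bvp_graph (v, g).
Proof.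
move=> hv hg adj.
have i1 : complex.Im ('i%C : R[i]) != 0 by rewrite /= oner_neq0.
have i2 : complex.Im (- 'i%C : R[i]) != 0 by rewrite /= oppr_eq0 oner_neq0.
have [u [h [huh e]]] := bvp_onto i1 (L2B H_separable hg (L2Z H_separable 'i%C hv)).
have [[/= hu hh _] _] := huh.
have hw : L2fun a b (fun t => v t - u t) by exact: L2B.
have [p [q [hpq e']]] := bvp_onto i2 hw.
have [[/= hp hq _] _] := hpq.
have vu : v =ae u.
  have d1 := adj _ _ hpq; have d2 := bvp_graph_green hpq huh.
  have I1 := L2_dR H_separable hq hv; have I2 := L2_dR H_separable hq hu.
  have I3 := L2_dR H_separable hp hg; have I4 := L2_dR H_separable hp hh.
  have N0 : snorm ((fun t => v t - u t) : L2space a b H) = 0.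
    apply/eqP; rewrite -sqrf_eq0 snorm_sqr; apply/eqP.
    have -> : rint a b (fun t => nr (v t - u t) ^+ 2) = rint a b (fun t =>
        (dR (q t) (v t) - dR (q t) (u t)) - (dR (p t) (g t) - dR (p t) (h t))).
      apply: ae_eq_rint.
      - exact: rintg_meas hw.2.
      - exact: rintg_meas (rintgB (rintgB I1 I2) (rintgB I3 I4)).
      apply: aeS2 e e' => t e e' tab; rewrite -dRxx -{1}(e' tab).
      rewrite -!dRBr scaleNr opprK dRDl; congr (_ + _).
      have -> : g t - h t = 'i%C *: (v t - u t).
        rewrite scalerBr; have := e tab => /eqP; rewrite subr_eq => /eqP ->.
        by rewrite -addrA opprD addrA subrr add0r opprD opprK.
      by rewrite dRii.
    by rewrite rintB; [|exact: rintgB|exact: rintgB]; rewrite !rintB// d1 d2 subrr.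
  have /(snorm_eq0 hw) := N0.
  by apply: aeS => t h0 /h0 /eqP; rewrite subr_eq0 => /eqP.
apply: (bvp_graph_ae hv hg (ae_sym vu) _ huh).
apply: aeS2 e vu => t e1 e2 tab.
have /eqP := e1 tab; rewrite subr_eq => /eqP ->.
by rewrite e2// subrK.
Qed.

Lemma bvp_selfadjoint : selfadjoint (X := L2space a b H) bvp_graph.
Proof.
split.
  split.
  - by move=> [u f] [[/= hu hf _] _]; split; exact/square_integrableP.
  - exact: bvp_graph_zero.
  - by move=> c [u f] [v g] hu hv; exact: bvp_graph_lin.
  - move=> [u f] huf /=; have [[/= hu hf _] _] := huf.
    have h0 := L2_cst0 H_separable a b.
    by move=> /(same_vec_ae hu h0) u0; apply/(same_vec_ae hf h0)/(bvp_graph_single huf).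
apply/seteqP; split=> [[v g] [/= /(square_integrableP H_separable) hv
    /(square_integrableP H_separable) hg adj]|[v g] hvg].
  apply: bvp_adjoint_sub => // u f huf.
  by have := adj _ huf; rewrite /= !cint_dot => -[].
have [[/= hv hg _] _] := hvg.
split => /=; [exact/square_integrableP|exact/square_integrableP|].
by move=> [u f] huf; exact: bvp_graph_symmetric.
Qed.

(** The graph is an adjoint, and adjoints are closed by Cauchy-Schwarz. *)
Lemma bvp_closure (G : set (L2space a b H * L2space a b H)) :
  G `<=` bvp_graph -> closure_op G `<=` bvp_graph.
Proof.
move=> sub [v g] [/= /(square_integrableP H_separable) hv /(square_integrableP H_separable) hg appr].
apply: bvp_adjoint_sub => // u f huf; have [[/= hu hf _] _] := huf.
apply/eqP; rewrite -subr_eq0 -normr_eq0 eq_le normr_ge0 andbT.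
apply/ler_addgt0Pr => e e0; rewrite add0r.
pose N := snorm (u : L2space a b H) + snorm (f : L2space a b H) + 1.
have N0 : 0 < N by rewrite ltr_wpDl ?addr_ge0 ?snorm_ge0.
have [[v' g'] [/sub hvg' /= dv dg]] := appr (e / N) (divr_gt0 e0 N0).
have [[/= hv' hg' _] _] := hvg'.
have I1 := L2_dR H_separable hf hv; have I2 := L2_dR H_separable hf hv'.
have I3 := L2_dR H_separable hu hg; have I4 := L2_dR H_separable hu hg'.
have gr := bvp_graph_green huf hvg'.
have e1 : rint a b (fun t => dR (f t) (v t)) - rint a b (fun t => dR (f t) (v' t)) =
    rint a b (fun t => dR (f t) (v t - v' t)).
  by rewrite -rintB//; apply: eq_rint => t _; rewrite dRBr.
have e2 : rint a b (fun t => dR (u t) (g t)) - rint a b (fun t => dR (u t) (g' t)) =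
    rint a b (fun t => dR (u t) (g t - g' t)).
  by rewrite -rintB//; apply: eq_rint => t _; rewrite dRBr.
have c1 := L2_cauchy_schwarz H_separable hf (L2B H_separable hv hv').
have c2 := L2_cauchy_schwarz H_separable hu (L2B H_separable hg hg').
rewrite -e1 in c1; rewrite -e2 in c2; rewrite gr in c1.
have c1' := le_trans c1 (ler_wpM2l (snorm_ge0 _) (ltW dv)).
have c2' := le_trans c2 (ler_wpM2l (snorm_ge0 _) (ltW dg)).
rewrite -(subrKA (rint a b (fun t => dR (u t) (g' t)))).
apply: le_trans (ler_normD _ _) _; rewrite [X in _ + X]distrC.
apply: le_trans (lerD c1' c2') _.
rewrite -mulrDl mulrA ler_pdivrMr// mulrC ler_wpM2l ?(ltW e0)//.
by rewrite addrC /N lerDl.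
Qed.

End BoundaryValueProblem.

(** * The minimal operator *)

Section TestSums.
Context {R : realType} (H : hilbert R) (D : set H) (a b : R).

Lemma cvg_sum_seq (I : Type) (s : seq I) (F : I -> R -> H) (t : R) :
  (forall i, F i x @[x --> t] --> F i t) ->
  (\sum_(i <- s) F i x) @[x --> t] --> \sum_(i <- s) F i t.
Proof.
move=> hF; elim: s => [|i s ih].
  rewrite big_nil; apply: cvg_ext (cvg_cst 0) => x; by rewrite big_nil.
rewrite big_cons; apply: cvg_ext (cvgD (hF i) ih) => x; by rewrite big_cons.
Qed.

Lemma test_sum_continuous (u : R -> H) : test_sum D a b u -> continuous u.
Proof.
move=> [n [phi [h [hphi ->]]]] t; apply: cvg_sum_seq => j.
have [[dphi _] _] := hphi j.
apply/cvg_nr0P.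
have l1 : (fun s : R => nr (phi j s - phi j t) * nr (h j)) @ t --> 0 * nr (h j).
  apply: cvgMl; apply: nr_Re_Im_continuous.
    by apply: differentiable_continuous; apply/derivable1_diffP; exact: (dphi 0 t).1.
  by apply: differentiable_continuous; apply/derivable1_diffP; exact: (dphi 0 t).2.
apply: (squeeze0 _ l1); last by rewrite mul0r.
by apply: nearW => s; rewrite nr_ge0 /= -scalerBl nrZ.
Qed.

Lemma test_sum_boundary (u : R -> H) (t : R) : test_sum D a b u -> t <= a \/ b <= t -> u t = 0.
Proof.
move=> [n [phi [h [hphi ->]]]] tab; apply: big1 => j _.
have [[_ [c [d [ac db phi0]]]] _] := hphi j.
rewrite phi0 ?scale0r// => /andP[ct td].
by case: tab => [ta|bt]; [move: (lt_le_trans ac ct)|move: (le_lt_trans td db)]; rewrite ltNge ?ta ?bt.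
Qed.

Lemma test_sum_boundary_condition (W : H -> H) (u : R -> H) : W 0 = 0 ->
  test_sum D a b u -> boundary_condition a b W u.
Proof.
move=> W0 tu; exists u; split.
- exact: continuous_subspaceT (test_sum_continuous tu).
- exact: aeW.
- rewrite !(test_sum_boundary tu) ?W0//; [by left|by right].
Qed.

End TestSums.

(** * The direct sum with zero spaces *)

Section DirectSum.
Context {R : realType} (X : semihilbert R).
Let Y := dsum (dsum (zero_space R) X) (zero_space R).

(** 0 + G + 0 on 0 + X + 0. The outer components carry no information, the
    space of row vectors of length 0 being a singleton. *)
Definition middle_op (G : set (X * X)) : set (Y * Y) :=
  dsum_op (dsum_op (@zero_op R) G) (@zero_op R).

Definition middle (u : X) : Y := ((0, u), 0).

Lemma middle_opP G p : middle_op G p <-> G (p.1.1.2, p.2.1.2).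
Proof.
split=> [[[_ h] _] //|h]; split; first split=> //.
  exact: thinmx0.
exact: thinmx0.
Qed.

Lemma sdot_middle (x y : Y) : sdot x y = sdot x.1.2 y.1.2.
Proof. by rewrite /= add0r addr0. Qed.

Lemma snorm_middle (x : Y) : snorm x = snorm x.1.2.
Proof. by rewrite /snorm sdot_middle. Qed.

Lemma smem_middle (x : Y) : smem x <-> smem x.1.2.
Proof. by split=> [[[]]|]. Qed.

Lemma selfadjoint_middle G : selfadjoint G -> selfadjoint (middle_op G).
Proof.
move=> [[Gm G0 Gl Gs] Gadj]; split.
  split.
  - by move=> p /middle_opP /Gm [h1 h2]; split; apply/smem_middle.
  - exact/middle_opP.
  - by move=> c p q /middle_opP hp /middle_opP hq; apply/middle_opP; exact: (Gl c _ _ hp hq).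
  - move=> p /middle_opP /Gs; rewrite /same_vec !snorm_middle; exact.
apply/seteqP; split=> [q [q1 q2 adj]|q /middle_opP hq].
  apply/middle_opP; rewrite -Gadj; split.
  - exact: (proj1 (smem_middle _) q1).
  - exact: (proj1 (smem_middle _) q2).
  move=> p hp; have := adj (middle p.1, middle p.2); rewrite !sdot_middle; apply.
  by apply/middle_opP; case: (p) hp.
have := hq; rewrite -{1}Gadj => -[q1 q2 adj]; split.
- exact/smem_middle.
- exact/smem_middle.
- by move=> p /middle_opP /adj h; rewrite !sdot_middle.
Qed.

Lemma resolvent_set_middle G : resolvent_set (middle_op G) = resolvent_set G.
Proof.
apply/seteqP; split=> z [onto [c hc]]; split.
- move=> f hf; have [|p [/middle_opP hp e]] := onto (middle f); first exact/smem_middle.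
  exists (p.1.1.2, p.2.1.2); split => //.
  by move: e; rewrite /same_vec snorm_middle.
- exists c => p hp; have := hc (middle p.1, middle p.2); rewrite !snorm_middle; apply.
  by apply/middle_opP; case: (p) hp.
- move=> f /smem_middle hf; have [p [hp e]] := onto _ hf.
  exists (middle p.1, middle p.2); split; first by apply/middle_opP; case: (p) hp.
  by rewrite /same_vec snorm_middle.
- by exists c => p /middle_opP /hc; rewrite !snorm_middle.
Qed.

End DirectSum.

(** * Arguments of complex numbers *)

Section Arguments.
Context {R : realType}.
Implicit Types (m : R[i]) (t th x : R) (n : int).

Lemma cos_sin_period x n :
  cos (x + 2 * n%:~R * pi) = cos x /\ sin (x + 2 * n%:~R * pi) = sin x.
Proof.
have key (k : nat) (y : R) : cos (y + 2 * k%:R * pi) = cos y /\ sin (y + 2 * k%:R * pi) = sin y.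
  have -> : 2 * k%:R * pi = (pi *+ 2) *+ k :> R by rewrite -mulr_natr -[pi *+ 2]mulr_natr; ring.
  by split; apply: periodicn; [exact: cosD2pi|exact: sinD2pi].
case: n => k; first exact: key.
have [<- <-] := key k.+1 (x + 2 * (Negz k)%:~R * pi).
have -> : x + 2 * (Negz k)%:~R * pi + 2 * k.+1%:R * pi = x; last by [].
by rewrite NegzE mulrNz pmulrn; ring.
Qed.

Lemma angle_reduce x : exists th n, 0 <= th < 2 * pi /\ x = th + 2 * n%:~R * pi.
Proof.
have p0 : 0 < 2 * pi :> R by rewrite mulr_gt0// pi_gt0.
exists (x - 2 * (Num.floor (x / (2 * pi)))%:~R * pi), (Num.floor (x / (2 * pi))); split; last by rewrite subrK.
have /andP[] := floor_itv (x / (2 * pi)); rewrite intrD ler_pdivlMr// ltr_pdivrMr//.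
pose n : R := (Num.floor (x / (2 * pi)))%:~R; rewrite -/n; clearbody n; rewrite mulr1z => h1 h2.
by apply/andP; split; lra.
Qed.

Lemma ez_real x t : ez x%:C (- t) = cos (x * t) +i* sin (x * t).
Proof.
by rewrite /ez /= mulr0 expR0 !mul1r mulNr cosN sinN opprK (mulrC t).
Qed.

Lemma is_argE m th : nr m = 1 -> is_arg m th <-> 0 <= th < 2 * pi /\ m = cos th +i* sin th.
Proof.
move=> m1; have e : `|m| = 1 by rewrite nrE m1.
split=> [[_ h1 h2]|[h1 h2]]; first by split => //; rewrite h2 e mul1r.
by split => //; [rewrite -nr_eq0 m1 oner_neq0|rewrite e mul1r].
Qed.

End Arguments.

(** * The spectrum *)

Section UnitaryAdjoint.
Context {R : realType} (H : hilbert R).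

(** W^* = W^-1. *)
Lemma adjoint_unitary (W : H -> H) (x y : H) : unitary W ->
  @adjoint R (hspace H) (graph_on setT W) (x, y) <-> W y = x.
Proof.
move=> [Wl Wd Ws]; split=> [[_ _ adj]|<-].
  apply: dR_ext => h; have [k <-] := Ws h.
  rewrite !(dRC _ (W k)) /dR Wd; congr complex.Re; apply: esym.
  exact: (adj (k, W k) (conj I erefl)).
split=> // -[k _] [/= _ ->]; exact: Wd.
Qed.

End UnitaryAdjoint.

Theorem theorem3p3
  (R : realType) (H : hilbert R)
  (H_separable : separable H) (H_nontrivial : exists x : H, x <> 0)
  (a2 b2 : R) (a2_lt_b2 : a2 < b2)
  (D : set H) (A : H -> H)
  (A_selfadjoint : @selfadjoint R (hspace H) (graph_on D A))
  (Hm : hilbert R) (iota : {linear H -> Hm})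
  (Hm_negative : negative_space D A iota)
  (At : H -> Hm) (At_adjoint : plus_adjoint D A iota At)
  (E : R -> Hm -> Hm) (E_exp : expi_group (tilde_op iota At) E)
  (W : H -> H) (W_unitary : unitary W) :
  [/\ selfadjoint (LW iota At a2 b2 W),
      op_010 (L2min D iota At a2 b2) `<=` LW iota At a2 b2 W &
      spectrum (LW iota At a2 b2 W) =
      [set z : R[i] | exists lambda : R, z = lambda%:C /\
        exists (mu : R[i]) (theta : R) (n : int),
          [/\ @spectrum R (hspace H)
                (graph_comp (@adjoint R (hspace H) (graph_on setT W))
                            (restrict_to_H iota (E (b2 - a2)))) mu,
              is_arg mu theta &
              lambda = theta / (b2 - a2) + 2 * n%:~R * pi / (b2 - a2)]]].
Proof.
have [V [Vgrp EV]] := group_in_H H_nontrivial A_selfadjoint Hm_negative At_adjoint E_exp.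
have maxE : L2max iota At a2 b2 = @max_graph R H D A a2 b2.
  apply/seteqP; split=> -[u f].
    by move/(L2max_prim H_separable H_nontrivial A_selfadjoint Hm_negative At_adjoint u f a2_lt_b2).
  by move=> h; apply/(L2max_prim H_separable H_nontrivial A_selfadjoint Hm_negative At_adjoint u f a2_lt_b2).
have LWE : LW iota At a2 b2 W = middle_op (@bvp_graph R H D A a2 b2 W).
  rewrite /LW maxE; apply/seteqP; split=> [p [/middle_opP hp bc]|p /middle_opP [hp bc]].
    by apply/middle_opP.
  by split => //; apply/middle_opP.
(* T = W^* e^{i A~ l}. *)
have [T WT] : exists T : H -> H, forall x, W (T x) = V (b2 - a2) x.
  have [_ _ Ws] := W_unitary.
  by have /choice[T WT] := fun x => Ws (V (b2 - a2) x); exists T.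
have TE : graph_comp (@adjoint R (hspace H) (graph_on setT W))
    (restrict_to_H iota (E (b2 - a2))) = graph_on setT T.
  apply/seteqP; split=> [[x y] [x' [/EV -> /(adjoint_unitary _ _ W_unitary) e]]|[x y] [_ /= ->]].
    by split => //=; apply: (unitary_inj W_unitary); rewrite WT.
  by exists (V (b2 - a2) x); split; [exact/EV|apply/(adjoint_unitary _ _ W_unitary); exact: WT].
have l0 : b2 - a2 != 0 by rewrite subr_eq0 gt_eqF.
have resE z := bvp_resolvent_set H_separable A_selfadjoint Vgrp a2_lt_b2 W_unitary WT z.
rewrite LWE TE; split.
- exact/selfadjoint_middle/(bvp_selfadjoint H_separable A_selfadjoint Vgrp a2_lt_b2 W_unitary WT).
- move=> p [[h1 h2] h3]; split=> //; split=> //.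
  apply: (bvp_closure H_separable A_selfadjoint Vgrp a2_lt_b2 W_unitary WT) h2.
  move=> q [hq tq]; split; first by rewrite -maxE.
  exact: test_sum_boundary_condition (unitary0 W_unitary) tq.
- rewrite /spectrum resolvent_set_middle; apply/seteqP; split=> z.
    move=> nz; have Im0 : complex.Im z = 0.
      apply/eqP; apply: contrapT => /negP z0; apply: nz.
      exact: (nonreal_resolvent H_separable A_selfadjoint Vgrp a2_lt_b2 W_unitary WT z0).
    have zE : z = (complex.Re z)%:C by move: Im0; case: (z) => x y /= ->.
    have [th [n [thI thE]]] := angle_reduce (complex.Re z * (b2 - a2)).
    exists (complex.Re z); split=> //; exists (ez z (- (b2 - a2))), th, n; split.
    + by move=> /resolvent_set_graph /resE.
    (* z is real and e^{izl} = cos(zl) + i sin(zl), whose argument is zl modulo 2 pi. *)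
    + apply/is_argE; first by rewrite nr_ez Im0 mulr0 expR0.
      split=> //; rewrite zE ez_real thE.
      by have [-> ->] := cos_sin_period th n.
    + by rewrite -mulrDl -thE mulfK.
move=> [lam [-> [m [th [n [hm harg lamE]]]]]] /resE hreg; apply: hm.
have T_unitary : unitary T.
  by apply: (unitary_quotient W_unitary _ WT); have [+ _ _ _ _] := Vgrp; apply.
apply/resolvent_set_graph; have [m1|] := eqVneq (nr m) 1; last exact: unitary_regular.
have /(is_argE _ m1) [_ ->] := harg.
have [<- <-] := cos_sin_period th n.
by move: hreg; rewrite ez_real lamE -mulrDl divfK.
Qed.
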